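(* Let $0<|q|<1$ and let $a,b,c,d,e,f$ be nonzero complex parameters (generic, so that the expressions below are defined), and put $s=\dfrac{a^3q^3}{bcdef}$. Suppose $s=q^m$ for some $m\in\{1,2,3,\dots\}$. With $a_n,b_n,X_n^{(1)},X_n^{(2)},W_1,W_2$ as defined in the context, $$\cfrac{1}{a_0-\cfrac{b_1}{a_1-\cfrac{b_2}{a_2-\cdots}}}=\lim_{n\to0}\frac{W_2X_n^{(1)}-W_1X_n^{(2)}}{b_n\left(W_2X_{n-1}^{(1)}-W_1X_{n-1}^{(2)}\right)} .$$
   Context: Notation: $(x)_\infty=\prod_{j\ge0}(1-xq^j)$, $(x)_k=\prod_{j=0}^{k-1}(1-xq^j)$, and $(x_1,\dots,x_r)_\infty=\prod_i(x_i)_\infty$. A branch of $\log q$ is fixed, $q^x=e^{x\log q}$, and $s^{x}=q^{mx}$. Products $\prod_{x}$ run over the five parameters $x\in\{b,c,d,e,f\}$. Series: $$\phi(a;b,c,d,e,f,g,h)=\sum_{k\ge0}\frac{1-aq^{2k}}{1-a}\frac{(a)_k}{(q)_k}\prod_{y\in\{b,c,d,e,f,g,h\}}\frac{(y)_k}{(aq/y)_k}\,q^k$$ (a very well poised ${}_{10}\phi_9$), and $$W(a;b,c,d,e,f)=\sum_{k\ge0}\frac{1-aq^{2k}}{1-a}\frac{(a)_k}{(q)_k}\prod_{x}\frac{(x)_k}{(aq/x)_k}\left(\frac{a^2q^2}{bcdef}\right)^k$$ (a very well poised ${}_8\phi_7$). $W_1$ denotes $W(a;b,c,d,e,f)$ for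 $|s|<|qa|$ and its analytic continuation otherwise; $W_2$ denotes $W\left(\frac qa;\frac qb,\frac qc,\frac qd,\frac qe,\frac qf\right)$ for $|s|>|aq^2|$ and its analytic continuation otherwise. Coefficients: $$a_n=\frac{1}{(1-sq^{2n-1})(1-\frac saq^{n-2})(1-aq^{n+1})}\Bigl[\frac{q^{-n+1/2}}{\sqrt s}\frac{(1-sq^{n-1})(1-\frac saq^{n-1})(1-\frac saq^{n-2})\prod_x(1-\frac axq^{n+1})}{1-sq^{2n}}$$ $$\qquad+\frac{q^{-n+3/2}}{\sqrt s}\frac{(1-q^n)(1-aq^n)(1-aq^{n+1})\prod_x(1-\frac{xs}{a}q^{n-2})}{1-sq^{2n-2}}+\frac{\sqrt s}{a}q^{n-1/2}(1-sq^{2n-1})\bigl(1-\tfrac{s}{aq^2}\bigr)\prod_x(1-x)\Bigr],$$ $$b_n=\frac{q^{-2n+3}}{s}\,\frac{(1-q^n)(1-sq^{n-2})\prod_x(1-\frac axq^n)\prod_x(1-\frac{xs}{a}q^{n-2})}{(1-sq^{2n-1})(1-sq^{2n-2})^2(1-sq^{2n-3})} .$$ Solutions of $X_{n+1}-a_nX_n+b_nX_{n-1}=0$: $$X_n^{(1)}=\frac{q^{-n^2/2+n}}{s^{n/2}}\frac{(sq^{2n-1})_\infty(aq^{n+1})_\infty}{(sq^{n-1})_\infty(\frac saq^{n-1})_\infty\prod_x(\frac{a}{x}q^{n+1})_\infty}\;\phi(a;b,c,d,e,f,sq^{n-1},q^{-n}),$$ $$X_n^{(2)}=\frac{q^{-n^2/2+n}}{s^{n/2}}\frac{(\frac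 saq^n)_\infty(sq^{2n-1})_\infty}{(q^{n+1})_\infty(aq^n)_\infty\prod_x(\frac{xs}{a}q^{n-1})_\infty}\;\phi\left(\frac qa;\frac qb,\frac qc,\frac qd,\frac qe,\frac qf,\frac{q^{-n+2}}{s},q^{n+1}\right).$$ Convention: for the exceptional values $s=q,q^2$, where $a_n,b_n,b_{n+1}$ (and $X_n^{(1)},X_{n-1}^{(1)}$) are indeterminate at $n=0$, they are defined by taking the limit $n\to0$ in the explicit expressions for $a_n$, $b_n$, $X_n^{(1)}$ displayed in this context (with $n$ replaced by $n+1$ in the expression for $b_n$ to get $b_{n+1}$, and by $n-1$ in the expression for $X_n^{(1)}$ to get $X_{n-1}^{(1)}$), with $s$ fixed ($n$ being treated as a continuous variable); thus $a_0=\lim_{n\to0}a_n$ and $b_1=\lim_{n\to0}b_{n+1}$. *)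

(* Defs.v *)
From Stdlib Require Export Reals ZArith List.
From Coquelicot Require Export Coquelicot.
Export ListNotations.

Open Scope C_scope.

Definition Cexp (z : C) : C :=
  (exp (Re z) * cos (Im z), exp (Re z) * sin (Im z))%R.

(* q^x for the branch of log q given by L. *)
Definition qpow (L x : C) : C := Cexp (x * L).

(* Value of a limit in C; meaningful only when the limit exists. *)
Definition Clim {T : Type} (F : (T -> Prop) -> Prop) (g : T -> C) : C :=
  iota (T := C_CompleteNormedModule)
    (fun l => filterlim g F (locally (T := C_UniformSpace) l)).

(* The value at 0 of g, by continuity along n <> 0 (n a complex variable). *)
Definition Clim0 (g : C -> C) : C := Clim (locally' (T := C_UniformSpace) (RtoC 0)) g.

(* Value of a convergent complex series. *)
Definition Cseries (u : nat -> C) : C :=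
  iota (T := C_CompleteNormedModule)
    (fun l => is_series (K := C_AbsRing) (V := C_NormedModule) u l).

Definition prodl (g : C -> C) (xs : list C) : C :=
  fold_right (fun x p => g x * p) 1 xs.

Fixpoint qpoch (q x : C) (k : nat) : C :=
  match k with
  | O => 1
  | S j => qpoch q x j * (1 - x * q ^ j)
  end.

Definition qpoch_inf (q x : C) : C := Clim eventually (qpoch q x).

Definition vwp_term (q a : C) (ys : list C) (z : C) (k : nat) : C :=
  (1 - a * q ^ (2 * k)) / (1 - a) * (qpoch q a k / qpoch q q k)
  * prodl (fun y => qpoch q y k / qpoch q (a * q / y) k) ys * z ^ k.

Definition phi (q a b c d e f g h : C) : C :=
  Cseries (vwp_term q a [b; c; d; e; f; g; h] q).

Definition W_term (q a b c d e f : C) : nat -> C :=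
  vwp_term q a [b; c; d; e; f] (a ^ 2 * q ^ 2 / (b * c * d * e * f)).

Definition s_param (q a b c d e f : C) : C :=
  a ^ 3 * q ^ 3 / (b * c * d * e * f).

(* The domain to which W extends analytically in all its parameters.  It is
   connected, being the complement in (C \ {0})^6 of a locally finite union of
   analytic hypersurfaces: those where a term of the series has a pole, and
   those where a^2 q^2 / (bcdef) is q^(-k) for some k >= 0. *)
Definition W_domain (q a b c d e f : C) : Prop :=
  a <> 0 /\ a <> 1 /\
  List.Forall (fun x : C => x <> 0 /\ forall k : nat, a * q / x * q ^ k <> 1)
    [b; c; d; e; f] /\
  forall k : nat, a ^ 2 * q ^ 2 / (b * c * d * e * f) * q ^ k <> 1.

(* Power series expansion along every complex line through the point; on an
   open set this is analyticity in the six variables (Hartogs). *)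
Definition analytic6_at (F : C -> C -> C -> C -> C -> C -> C)
    (a b c d e f : C) : Prop :=
  forall a' b' c' d' e' f' : C,
  exists (u : nat -> C) (r : posreal), forall t : C, (Cmod t < r)%R ->
    is_pseries (K := C_AbsRing) (V := C_NormedModule) u t
      (F (a + t * a') (b + t * b') (c + t * c')
         (d + t * d') (e + t * e') (f + t * f')).

(* F is W where |s| < |q a| and its analytic continuation elsewhere; this
   determines F on W_domain. *)
Definition is_W_continuation (q : C) (F : C -> C -> C -> C -> C -> C -> C)
    : Prop :=
  (forall a b c d e f, W_domain q a b c d e f ->
     analytic6_at F a b c d e f) /\
  (forall a b c d e f, W_domain q a b c d e f ->
     (Cmod (s_param q a b c d e f) < Cmod (q * a))%R ->
     is_series (K := C_AbsRing) (V := C_NormedModule)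
       (W_term q a b c d e f) (F a b c d e f)).

(* Below, s = q^m, so that sqrt s is q^(m/2) and s^(n/2) is q^(m n/2);
   n is a complex variable. *)

Definition a_coef (q L : C) (m : nat) (a b c d e f n : C) : C :=
  let xs := [b; c; d; e; f] in
  let s := s_param q a b c d e f in
  let sqrt_s := qpow L (INR m / 2) in
  let qp := qpow L in
  / ((1 - s * qp (2 * n - 1)) * (1 - s / a * qp (n - 2))
     * (1 - a * qp (n + 1)))
  * (qp (- n + 1 / 2) / sqrt_s
     * ((1 - s * qp (n - 1)) * (1 - s / a * qp (n - 1))
        * (1 - s / a * qp (n - 2))
        * prodl (fun x => 1 - a / x * qp (n + 1)) xs
        / (1 - s * qp (2 * n)))
     + qp (- n + 3 / 2) / sqrt_s
       * ((1 - qp n) * (1 - a * qp n) * (1 - a * qp (n + 1))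
          * prodl (fun x => 1 - x * s / a * qp (n - 2)) xs
          / (1 - s * qp (2 * n - 2)))
     + sqrt_s / a * qp (n - 1 / 2) * (1 - s * qp (2 * n - 1))
       * (1 - s / (a * q ^ 2)) * prodl (fun x => 1 - x) xs).

Definition b_coef (q L : C) (a b c d e f n : C) : C :=
  let xs := [b; c; d; e; f] in
  let s := s_param q a b c d e f in
  let qp := qpow L in
  qp (- 2 * n + 3) / s
  * ((1 - qp n) * (1 - s * qp (n - 2))
     * prodl (fun x => 1 - a / x * qp n) xs
     * prodl (fun x => 1 - x * s / a * qp (n - 2)) xs
     / ((1 - s * qp (2 * n - 1)) * (1 - s * qp (2 * n - 2)) ^ 2
        * (1 - s * qp (2 * n - 3)))).

Definition sol1 (q L : C) (m : nat) (a b c d e f n : C) : C :=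
  let xs := [b; c; d; e; f] in
  let s := s_param q a b c d e f in
  let qp := qpow L in
  let inf := qpoch_inf q in
  qp (- n ^ 2 / 2 + n) / qp (INR m * n / 2)
  * (inf (s * qp (2 * n - 1)) * inf (a * qp (n + 1))
     / (inf (s * qp (n - 1)) * inf (s / a * qp (n - 1))
        * prodl (fun x => inf (a / x * qp (n + 1))) xs))
  * phi q a b c d e f (s * qp (n - 1)) (qp (- n)).

Definition sol2 (q L : C) (m : nat) (a b c d e f n : C) : C :=
  let xs := [b; c; d; e; f] in
  let s := s_param q a b c d e f in
  let qp := qpow L in
  let inf := qpoch_inf q in
  qp (- n ^ 2 / 2 + n) / qp (INR m * n / 2)
  * (inf (s / a * qp n) * inf (s * qp (2 * n - 1))
     / (inf (qp (n + 1)) * inf (a * qp n)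
        * prodl (fun x => inf (x * s / a * qp (n - 1))) xs))
  * phi q (q / a) (q / b) (q / c) (q / d) (q / e) (q / f)
      (qp (- n + 2) / s) (qp (n + 1)).

(* Partial numerators and denominators; for m = 1, 2 the values a_0 and b_1
   are the limits at n = 0 with s fixed.  The value at index 0 of the second
   sequence plays no role in the continued fraction. *)
Definition cf_a (q L : C) (m : nat) (a b c d e f : C) (j : nat) : C :=
  if ((j =? 0)%nat && (m <=? 2)%nat)%bool
  then Clim0 (a_coef q L m a b c d e f)
  else a_coef q L m a b c d e f (INR j).

Definition cf_b (q L : C) (m : nat) (a b c d e f : C) (j : nat) : C :=
  if ((j =? 1)%nat && (m <=? 2)%nat)%bool
  then Clim0 (fun n => b_coef q L a b c d e f (n + 1))
  else b_coef q L a b c d e f (INR j).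

(* The pair (Y_n, Y_(n+1)), where Y_(k+1) = al_k Y_k - be_k Y_(k-1)
   for k >= 1 and (Y_0, Y_1) = y. *)
Fixpoint wallis (al be : nat -> C) (y : C * C) (n : nat) : C * C :=
  match n with
  | O => y
  | S k => let (u, v) := wallis al be y k in (v, al n * v - be n * u)
  end.

(* Numerator and denominator of the approximant
   1/(al_0 - be_1/(al_1 - ... - be_n/al_n)). *)
Definition cf_num (al be : nat -> C) (n : nat) : C :=
  snd (wallis al be (RtoC 0, RtoC 1) n).
Definition cf_den (al be : nat -> C) (n : nat) : C :=
  snd (wallis al be (RtoC 1, al 0%nat) n).

(* 1/(al_0 - be_1/(al_1 - be_2/(al_2 - ...))) converges to l. *)
Definition is_cfrac (al be : nat -> C) (l : C) : Prop :=
  eventually (fun n => cf_den al be n <> 0) /\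
  filterlim (fun n => cf_num al be n / cf_den al be n) eventually
    (locally (T := C_UniformSpace) l).

(* Main.v *)
(** As a function of the complex variable n, each X_n^(i) satisfies the three-term recurrence up to an
    inhomogeneous term: the contiguous relation for the nonterminating series telescopes to a boundary
    value, a quotient of infinite products, which tends to 0 as n approaches a nonnegative integer.
    The second solution is the first one for the parameters q/a, q/b, ..., with s replaced by q^4/s
    and q^n by s q^(n-2); a_n and b_n are invariant under this change.

    After division by an explicit common factor, X_n^(1) and X_n^(2) tend to W_1 and W_2 as n runs
    through the integers.  Where |s| < |qa| this is Tannery's theorem.  In general the increments of the
    normalized sequence satisfy a perturbed geometric recurrence of ratio close to q, so that locally
    in b the sequence converges in the Banach algebra of absolutely convergent power series; the identity
    theorem along a ray b (1 + t tau), t >= 0, on which |s| becomes small, identifies the limit with the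
    analytic continuation.

    Hence W_2 X_n^(1) - W_1 X_n^(2) is of smaller order than the dominant solutions: it is a minimal
    solution, and the continued fraction is given by Pincherle's theorem. *)

(* The exponent is complex because [X_(n-1)] is in general singular at [n = 0], where [b_n]
   vanishes; only [b_n X_(n-1)] has a limit, supplied by the recurrence itself. With [N = q^n] the
   half-integral powers separate into a scalar factor, and the rest is a function of [N]. Genericity
   says that [a] and the quotients [a / x] are no integral powers of [q], whereas [s] is one. So at
   integral [n] a denominator either involves [a] and is not 0, or is a [1 - q^k] whose exponent can
   be counted; this isolates the cases [s = q], [s = q^2]. The continuation moves [b], and then [s]
   is no longer a power of [q]. The asymptotics are therefore proved for arbitrary [s] but integral
   [n], where the boundary value is exactly 0; complex [n] occurs only at [s = q^m]. The slope of
   the ray is chosen outside a countable set, to miss all poles. No Casoratian is computed. If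
   [W_1 = W_2 = 0], the denominator on the right is identically 0, which is excluded; hence one
   solution has the full growth, and it forces that growth on the denominators of the
   approximants. *)
Require Import Defs.
From Stdlib Require Import Lra Lia FunctionalExtensionality ClassicalChoice Classical.
From mathcomp Require Import ssreflect.

(** * Limits and series *)

Notation near0 := (locally' (T := C_UniformSpace) (RtoC 0)).

(** Convergence in terms of [Cmod], in which products and quotients are estimated. The balls of the
    uniform structure on [C] are squares, so [tends_filterlim] pays a factor [sqrt 2]. *)
Definition tends {T : Type} (F : (T -> Prop) -> Prop) (g : T -> C) (l : C) : Prop :=
  forall eps : R, (0 < eps)%R -> F (fun x => (Cmod (g x - l) < eps)%R).

Lemma Cmod_sub_sym (x y : C) : Cmod (x - y) = Cmod (y - x).
Proof. by rewrite -Cmod_opp; congr Cmod; ring. Qed.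

Lemma Cmod_sub_ge (x y : C) : (Cmod x - Cmod y <= Cmod (x - y))%R.
Proof.
have := Cmod_triangle (x - y) y.
replace (x - y + y) with x by ring; lra.
Qed.

Lemma Cinv_neq_0 (x : C) : x <> 0 -> / x <> 0.
Proof.
move=> Hx E; have := Cinv_r x Hx; rewrite E.
by replace (x * 0) with (RtoC 0) by ring; move/RtoC_inj; lra.
Qed.

Lemma Cdiv_neq_0 (x y : C) : x <> 0 -> y <> 0 -> x / y <> 0.
Proof.
move=> Hx Hy E; apply: Hx; replace x with (x / y * y) by (field; done).
by rewrite E; ring.
Qed.

Ltac nz :=
  lazymatch goal with
  | |- Cdiv _ _ <> _ => apply: Cdiv_neq_0; nz
  | |- Cinv _ <> _ => apply: Cinv_neq_0; nz
  | |- Cmult _ _ <> _ => apply: Cmult_neq_0; nz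
  | |- Cpow _ _ <> _ => apply: Cpow_nz; nz
  | _ => done
  end.

Section Limits.
Context {T : Type} {F : (T -> Prop) -> Prop} {FF : Filter F}.
Implicit Types (g h : T -> C) (l k : C).

Lemma tends_filterlim g l :
  tends F g l <-> filterlim g F (locally (T := C_UniformSpace) l).
Proof.
split=> H.
- apply/filterlim_locally=> eps.
  apply: filter_imp (H eps (cond_pos eps)) => x Hx.
  exact: C_NormedModule_mixin_compat1.
- move=> eps He.
  have Hs : (0 < eps / sqrt 2)%R.
    by apply: Rdiv_lt_0_compat => //; apply: sqrt_lt_R0; lra.
  have /filterlim_locally /(_ (mkposreal _ Hs)) H' := H.
  apply: filter_imp H' => x /C_NormedModule_mixin_compat2 /=.
  have Hn : sqrt 2 <> 0%R by have := sqrt_lt_R0 2; lra.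
  have -> : (sqrt 2 * (eps / sqrt 2))%R = eps by field.
  by [].
Qed.

Lemma tends_ext_loc g h l :
  F (fun x => g x = h x) -> tends F g l -> tends F h l.
Proof. by move=> He Hg eps He0; apply: filter_imp (filter_and _ _ He (Hg eps He0)) => x [<-]. Qed.

Lemma tends_ext g h l : (forall x, g x = h x) -> tends F g l -> tends F h l.
Proof. by move=> H; apply: tends_ext_loc; apply: filter_forall. Qed.

Lemma tends_const l : tends F (fun _ => l) l.
Proof.
move=> eps He; apply: filter_forall => _.
by replace (l - l) with (RtoC 0) by ring; rewrite Cmod_0.
Qed.

Lemma tends_sub_0 g l : tends F g l <-> tends F (fun x => g x - l) 0.
Proof.
split=> H eps He; apply: filter_imp (H _ He) => x;
  by replace (g x - l - 0) with (g x - l) by ring.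
Qed.

Lemma tends_plus g h l k :
  tends F g l -> tends F h k -> tends F (fun x => g x + h x) (l + k).
Proof.
move=> Hg Hh eps He.
have He2 : (0 < eps / 2)%R by lra.
apply: filter_imp (filter_and _ _ (Hg _ He2) (Hh _ He2)) => x [H1 H2].
have := Cmod_triangle (g x - l) (h x - k).
by replace (g x - l + (h x - k)) with (g x + h x - (l + k)) by ring; lra.
Qed.

Lemma tends_opp g l : tends F g l -> tends F (fun x => - g x) (- l).
Proof.
move=> Hg eps He; apply: filter_imp (Hg _ He) => x.
by rewrite Cmod_sub_sym; replace (l - g x) with (- g x - - l) by ring.
Qed.

Lemma tends_minus g h l k :
  tends F g l -> tends F h k -> tends F (fun x => g x - h x) (l - k).
Proof. by move=> Hg Hh; apply: tends_plus => //; apply: tends_opp. Qed.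

Lemma tends_bounded g l :
  tends F g l -> F (fun x => (Cmod (g x) < Cmod l + 1)%R).
Proof.
move=> Hg; apply: filter_imp (Hg _ Rlt_0_1) => x.
by have := Cmod_sub_ge (g x) l; lra.
Qed.

Lemma tends_away g l :
  l <> 0 -> tends F g l -> F (fun x => (Cmod l / 2 < Cmod (g x))%R).
Proof.
move=> /Cmod_gt_0 Hl Hg; have Hl2 : (0 < Cmod l / 2)%R by lra.
apply: filter_imp (Hg _ Hl2) => x.
by have := Cmod_sub_ge l (g x); rewrite Cmod_sub_sym; lra.
Qed.

Lemma tends_neq g l k : l <> k -> tends F g l -> F (fun x => g x <> k).
Proof.
move=> Hl Hg; have Hd : l - k <> 0.
  by move=> H; apply: Hl; replace l with (l - k + k) by ring; rewrite H; ring.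
apply: filter_imp (tends_away _ _ Hd (tends_minus _ _ _ _ Hg (tends_const k))).
move=> x Hx Hk; move: Hx; rewrite Hk.
replace (k - k) with (RtoC 0) by ring; rewrite Cmod_0.
by have := Cmod_ge_0 (l - k); lra.
Qed.

Lemma tends_mul_0 g h (M : R) :
  F (fun x => (Cmod (g x) <= M)%R) -> tends F h 0 -> tends F (fun x => g x * h x) 0.
Proof.
move=> Hg Hh eps He.
have HM : (0 < Rmax M 1)%R by have := Rmax_r M 1; lra.
have He2 : (0 < eps / Rmax M 1)%R by apply: Rdiv_lt_0_compat.
apply: filter_imp (filter_and _ _ Hg (Hh _ He2)) => x [H1 H2].
replace (g x * h x - 0) with (g x * (h x - 0)) by ring.
rewrite Cmod_mult.
apply: (Rle_lt_trans _ (Rmax M 1 * Cmod (h x - 0))).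
  by apply: Rmult_le_compat_r (Cmod_ge_0 _) _; have := Rmax_l M 1; lra.
replace eps with (Rmax M 1 * (eps / Rmax M 1))%R by (field; lra).
exact: Rmult_lt_compat_l.
Qed.

Lemma tends_mult g h l k :
  tends F g l -> tends F h k -> tends F (fun x => g x * h x) (l * k).
Proof.
move=> Hg Hh; apply/tends_sub_0.
apply: (tends_ext (fun x => g x * (h x - k) + k * (g x - l))); first by move=> x; ring.
replace (RtoC 0) with (RtoC 0 + RtoC 0) by ring; apply: tends_plus.
- apply: (tends_mul_0 _ _ (Cmod l + 1)); last exact: (proj1 (tends_sub_0 _ _)).
  by apply: filter_imp (tends_bounded _ _ Hg) => x; lra.
- apply: (tends_mul_0 _ _ (Cmod k)); last exact: (proj1 (tends_sub_0 _ _)).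
  by apply: filter_forall => _; lra.
Qed.

Lemma tends_inv g l : l <> 0 -> tends F g l -> tends F (fun x => / g x) (/ l).
Proof.
move=> Hl Hg; have Hm := proj1 (Cmod_gt_0 l) Hl.
apply/tends_sub_0.
apply: (tends_ext_loc (fun x => - (/ l * / g x) * (g x - l))).
  apply: filter_imp (tends_neq _ _ _ Hl Hg) => x Hx; by field.
apply: (tends_mul_0 _ _ (/ Cmod l * (2 / Cmod l))); last exact: (proj1 (tends_sub_0 _ _)).
apply: filter_imp (filter_and _ _ (tends_away _ _ Hl Hg) (tends_neq _ _ _ Hl Hg)) => x [Ha Hx].
rewrite Cmod_opp Cmod_mult !Cmod_inv //.
apply: Rmult_le_compat_l; first by (apply: Rlt_le; apply: Rinv_0_lt_compat).
replace (2 / Cmod l)%R with (/ (Cmod l / 2))%R by (field; lra).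
apply: Rinv_le_contravar; lra.
Qed.

Lemma tends_div g h l k :
  k <> 0 -> tends F g l -> tends F h k -> tends F (fun x => g x / h x) (l / k).
Proof. by move=> Hk Hg Hh; apply: tends_mult => //; apply: tends_inv. Qed.

Lemma tends_pow g l (n : nat) :
  tends F g l -> tends F (fun x => g x ^ n) (l ^ n).
Proof.
move=> Hg; elim: n => [|n IH]; first exact: tends_const.
exact: tends_mult.
Qed.

Lemma tends_prodl (g : C -> T -> C) (l : C -> C) (xs : list C) :
  List.Forall (fun y => tends F (g y) (l y)) xs ->
  tends F (fun x => prodl (fun y => g y x) xs) (prodl l xs).
Proof.
elim=> [|y ys Hy _ IH] /=; first exact: tends_const.
exact: tends_mult.
Qed.
End Limits.

Lemma tends_unique {T : Type} {F : (T -> Prop) -> Prop} {FF : ProperFilter F}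
    (g : T -> C) (l k : C) : tends F g l -> tends F g k -> l = k.
Proof.
move=> Hl Hk; have [H|H] := Req_dec (Cmod (l - k)) 0.
  by move/Cmod_eq_0: H => H; replace l with (l - k + k) by ring; rewrite H; ring.
have He : (0 < Cmod (l - k) / 2)%R by have := Cmod_ge_0 (l - k); lra.
have [x [H1 H2]] := filter_ex _ (filter_and _ _ (Hl _ He) (Hk _ He)).
have := Cmod_triangle (l - g x) (g x - k).
replace (l - g x + (g x - k)) with (l - k) by ring.
by rewrite (Cmod_sub_sym l (g x)); lra.
Qed.

Lemma Clim_eq {T : Type} {F : (T -> Prop) -> Prop} {FF : ProperFilter F}
    (g : T -> C) (l : C) : tends F g l -> Clim F g = l.
Proof.
move=> H; rewrite /Clim; apply: iota_unique; last by apply/tends_filterlim.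
by move=> y /tends_filterlim Hy; apply: tends_unique Hy H.
Qed.

#[global] Instance near0_proper : ProperFilter near0.
Proof.
split; last exact: locally'_filter.
move=> P [eps HP]; exists (RtoC (pos eps / 2)%R); apply: HP.
- apply: C_NormedModule_mixin_compat1.
  have -> : minus (RtoC (pos eps / 2)%R) (RtoC 0) = RtoC (pos eps / 2)%R.
    by apply: injective_projections; rewrite /minus /plus /opp /=; lra.
  rewrite Cmod_R Rabs_pos_eq; have := cond_pos eps; lra.
- move=> /RtoC_inj; have := cond_pos eps; lra.
Qed.

Lemma near0_neq : near0 (fun t : C => t <> 0).
Proof. by exists (mkposreal _ Rlt_0_1). Qed.

Lemma near0_id : tends near0 (fun t : C => t) 0.
Proof.
move=> eps He; have Hs : (0 < eps / sqrt 2)%R.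
  by apply: Rdiv_lt_0_compat => //; apply: sqrt_lt_R0; lra.
exists (mkposreal _ Hs) => t /C_NormedModule_mixin_compat2 /=.
have Hn : sqrt 2 <> 0%R by have := sqrt_lt_R0 2; lra.
have -> : (sqrt 2 * (eps / sqrt 2))%R = eps by field.
by [].
Qed.

Lemma tends_subseq (phi : nat -> nat) (u : nat -> C) (l : C) :
  (forall n, (n <= phi n)%nat) -> tends eventually u l -> tends eventually (fun n => u (phi n)) l.
Proof.
move=> Hp H eps He; have [N HN] := H eps He; exists N => n Hn.
by apply: HN; have := Hp n; lia.
Qed.

Lemma geom_tends (x : C) : (Cmod x < 1)%R -> tends eventually (fun n => x ^ n) 0.
Proof.
move=> Hx eps He.
have [N HN] := pow_lt_1_zero (Cmod x) ltac:(by rewrite Rabs_pos_eq //; apply: Cmod_ge_0) eps He.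
exists N => n Hn; replace (x ^ n - 0) with (x ^ n) by ring.
rewrite Cmod_pow; apply: Rle_lt_trans (HN n Hn); apply: Rle_abs.
Qed.

Fixpoint csum (u : nat -> C) (n : nat) : C :=
  match n with O => 0 | S k => csum u k + u k end.

Definition is_csum (u : nat -> C) (l : C) : Prop := tends eventually (csum u) l.

Lemma sum_n_csum (u : nat -> C) (n : nat) : sum_n u n = csum u (S n).
Proof.
elim: n => [|n IH]; first by rewrite sum_O /=; ring.
by rewrite sum_Sn IH.
Qed.

Lemma is_csum_series (u : nat -> C) (l : C) :
  is_series (K := C_AbsRing) (V := C_NormedModule) u l <-> is_csum u l.
Proof.
rewrite /is_series /is_csum; split.
- move=> /tends_filterlim H eps He; have [N HN] := H eps He.
  exists (S N) => -[|n] Hn; first lia.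
  by rewrite -sum_n_csum; apply: HN; lia.
- move=> H; apply/tends_filterlim => eps He; have [N HN] := H eps He.
  exists N => n Hn; rewrite sum_n_csum; apply: HN; lia.
Qed.

Lemma Cseries_eq (u : nat -> C) (l : C) : is_csum u l -> Cseries u = l.
Proof.
move=> H; rewrite /Cseries; apply: iota_unique; last by apply/is_csum_series.
by move=> y /is_csum_series Hy; apply: tends_unique Hy H.
Qed.

Lemma csum_ext (u v : nat -> C) (n : nat) :
  (forall k, (k < n)%nat -> u k = v k) -> csum u n = csum v n.
Proof.
elim: n => [//|n IH] H /=; rewrite (H n) ?IH //.
by move=> k Hk; apply: H; lia.
Qed.

Lemma csum_plus (u v : nat -> C) (n : nat) :
  csum (fun k => u k + v k) n = csum u n + csum v n.
Proof. by elim: n => [|n IH] /=; rewrite ?IH; ring. Qed.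

Lemma csum_scal (c : C) (u : nat -> C) (n : nat) :
  csum (fun k => c * u k) n = c * csum u n.
Proof. by elim: n => [|n IH] /=; rewrite ?IH; ring. Qed.

Lemma csum_telescope (G : nat -> C) (n : nat) :
  csum (fun k => G (S k) - G k) n = G n - G 0%nat.
Proof. by elim: n => [|n IH] /=; rewrite ?IH; ring. Qed.

Lemma csum_finite (u : nat -> C) (N : nat) :
  (forall k, (N <= k)%nat -> u k = 0) -> is_csum u (csum u N).
Proof.
move=> H eps He; exists N => n Hn.
have -> : csum u n = csum u N.
  elim: n Hn => [|n IH] Hn; first by (have -> : N = 0%nat by lia).
  have [Hle|Hlt] := Nat.le_gt_cases N n; last by (have -> : N = S n by lia).
  by rewrite /= IH // H //; ring.
by replace (csum u N - csum u N) with (RtoC 0) by ring; rewrite Cmod_0.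
Qed.

Lemma tends_csum {T : Type} {F : (T -> Prop) -> Prop} {FF : Filter F}
    (u : T -> nat -> C) (w : nat -> C) (n : nat) :
  (forall k, (k < n)%nat -> tends F (fun x => u x k) (w k)) ->
  tends F (fun x => csum (u x) n) (csum w n).
Proof.
elim: n => [|n IH] H /=; first exact: tends_const.
apply: tends_plus; last by apply: H.
by apply: IH => k Hk; apply: H; lia.
Qed.

Lemma csum_dom_ex (u : nat -> C) (v : nat -> R) :
  (forall k, (Cmod (u k) <= v k)%R) -> ex_series v -> exists l, is_csum u l.
Proof.
move=> Hu Hv.
have [l Hl] : ex_series (K := C_AbsRing) (V := C_CompleteNormedModule) u.
  exact: (@ex_series_le C_AbsRing C_CompleteNormedModule u v).
by exists l; apply/is_csum_series.
Qed.

(** * Sums dominated by a geometric series *)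

Section GeometricDomination.
Variables (M rho : R).
Hypotheses (Hr0 : (0 <= rho)%R) (Hr1 : (rho < 1)%R).

(** The bound keeps the exact geometric sum between [n] and [m]: with it the induction step is an
    identity. The cruder bound of [csum_geom_tail] is derived afterwards. *)
Lemma csum_geom_dist (u : nat -> C) (n m : nat) :
  (forall k, (Cmod (u k) <= M * rho ^ k)%R) -> (n <= m)%nat ->
  (Cmod (csum u m - csum u n) <= M * (rho ^ n - rho ^ m) / (1 - rho))%R.
Proof.
move=> Hu; elim: m => [|m IH] Hnm.
  have -> : n = 0%nat by lia.
  by rewrite /Cminus Cplus_opp_r Cmod_0; right; field; lra.
have [Heq|Hlt] := Nat.eq_dec n (S m).
  by rewrite Heq /Cminus Cplus_opp_r Cmod_0; right; field; lra.
rewrite /=; replace (csum u m + u m - csum u n) with (csum u m - csum u n + u m) by ring.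
apply: Rle_trans (Cmod_triangle _ _) _.
have H1 := IH ltac:(lia); have H2 := Hu m.
replace (M * (rho ^ n - rho * rho ^ m) / (1 - rho))%R with
  (M * (rho ^ n - rho ^ m) / (1 - rho) + M * rho ^ m)%R by (field; lra).
lra.
Qed.

Lemma geom_dom_const (u : nat -> C) :
  (forall k, (Cmod (u k) <= M * rho ^ k)%R) -> (0 <= M)%R.
Proof. by move=> /(_ 0%nat) /=; have := Cmod_ge_0 (u 0%nat); lra. Qed.

Lemma csum_geom_ex (u : nat -> C) :
  (forall k, (Cmod (u k) <= M * rho ^ k)%R) -> exists l, is_csum u l.
Proof.
move=> Hu.
apply: csum_dom_ex Hu _.
apply: (ex_series_scal_l (K := R_AbsRing) (V := R_NormedModule) M (fun k => rho ^ k)%R).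
by apply: ex_series_geom; rewrite Rabs_pos_eq.
Qed.

Lemma csum_geom_tail (u : nat -> C) (l : C) (n : nat) :
  (forall k, (Cmod (u k) <= M * rho ^ k)%R) -> is_csum u l ->
  (Cmod (l - csum u n) <= M * rho ^ n / (1 - rho))%R.
Proof.
move=> Hu Hl; have HM := geom_dom_const _ Hu.
apply: le_epsilon => eps He; have [N HN] := Hl _ He.
pose m := Nat.max n N.
have H1 := HN m ltac:(lia).
have H2 := csum_geom_dist u n m Hu ltac:(lia).
have H3 := Cmod_triangle (l - csum u m) (csum u m - csum u n).
replace (l - csum u m + (csum u m - csum u n)) with (l - csum u n) in H3 by ring.
rewrite (Cmod_sub_sym l (csum u m)) in H3.
have : (M * (rho ^ n - rho ^ m) / (1 - rho) <= M * rho ^ n / (1 - rho))%R.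
  apply: Rmult_le_compat_r; first by (apply: Rlt_le; apply: Rinv_0_lt_compat); lra.
  apply: Rmult_le_compat_l => //; have := pow_le rho m Hr0; lra.
lra.
Qed.

(** The tails beyond a suitable [n] are below [eps / 3], for the limit series and eventually for all
    the series of the family; the first [n] terms converge one by one. Stated for any filter, it
    serves for sequences as well as for continuity in a complex parameter. *)
Lemma tannery {T : Type} {F : (T -> Prop) -> Prop} {FF : Filter F}
    (u : T -> nat -> C) (w : nat -> C) (S : T -> C) (l : C) :
  (0 <= M)%R ->
  (forall k, tends F (fun x => u x k) (w k)) ->
  F (fun x => forall k, (Cmod (u x k) <= M * rho ^ k)%R) ->
  (forall k, (Cmod (w k) <= M * rho ^ k)%R) ->
  F (fun x => is_csum (u x) (S x)) -> is_csum w l -> tends F S l.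
Proof.
move=> HM Hk Hu Hw HS Hl eps He.
have [n Hn] : exists n, (M * rho ^ n / (1 - rho) < eps / 3)%R.
  (* The divisor is [M + 1] because [M] may be 0. *)
  have Hd : (0 < eps / 3 * (1 - rho) / (M + 1))%R.
    by apply: Rdiv_lt_0_compat; [apply: Rmult_lt_0_compat|]; lra.
  have [N HN] := pow_lt_1_zero rho ltac:(by rewrite Rabs_pos_eq) _ Hd.
  exists N; have := HN N (Nat.le_refl _); rewrite Rabs_pos_eq; last exact: pow_le.
  move=> HNN; apply/Rlt_div_l; first lra.
  apply: (Rle_lt_trans _ ((M + 1) * rho ^ N)).
    by apply: Rmult_le_compat_r; [apply: pow_le|lra].
  rewrite Rmult_comm; apply/Rlt_div_r => //; lra.
have He3 : (0 < eps / 3)%R by lra.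
have HT := tends_csum (FF := FF) u w n (fun k _ => Hk k) _ He3.
apply: filter_imp (filter_and _ _ HT (filter_and _ _ Hu HS)) => x [H1 [H2 H3]].
have H4 := csum_geom_tail _ _ n H2 H3.
have H5 := csum_geom_tail _ _ n Hw Hl.
have H6 := Cmod_triangle (S x - csum (u x) n) (csum (u x) n - csum w n).
have H7 := Cmod_triangle (S x - csum w n) (csum w n - l).
replace (S x - csum (u x) n + (csum (u x) n - csum w n)) with (S x - csum w n) in H6 by ring.
replace (S x - csum w n + (csum w n - l)) with (S x - l) in H7 by ring.
rewrite (Cmod_sub_sym (csum w n) l) in H7; lra.
Qed.
End GeometricDomination.

(** * Powers of q and infinite products *)

Lemma Cexp_plus (z w : C) : Cexp (z + w) = Cexp z * Cexp w.
Proof.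
rewrite /Cexp /Re /Im /= exp_plus cos_plus sin_plus.
by apply: injective_projections => /=; ring.
Qed.

Lemma Cexp_0 : Cexp 0 = 1.
Proof. by rewrite /Cexp /Re /Im /= exp_0 cos_0 sin_0; apply: injective_projections => /=; ring. Qed.

Lemma Cexp_neq_0 (z : C) : Cexp z <> 0.
Proof.
move=> H; have := Cexp_plus z (- z); rewrite H.
replace (z + - z) with (RtoC 0) by ring; rewrite Cexp_0.
replace (0 * Cexp (- z)) with (RtoC 0) by ring.
by move=> /RtoC_inj; lra.
Qed.

(** The bound keeps [Im z] inside [(-PI, PI)], where [sin] vanishes only at 0; this discards the
    periods of the exponential. *)
Lemma Cexp_eq_1_small (z : C) : (Cmod z < 1)%R -> Cexp z = 1 -> z = 0.
Proof.
move=> Hz [Hre Him].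
have Hy : (Rabs (Im z) < 1)%R.
  apply: Rle_lt_trans Hz; have := Rmax_Cmod z; have := Rmax_r (Rabs (fst z)) (Rabs (snd z)).
  rewrite /Im; lra.
have He := exp_pos (Re z).
have Hs : sin (Im z) = 0%R by apply: (Rmult_eq_reg_l (exp (Re z))); lra.
have HP := PI2_3_2.
have Hi : Im z = 0%R.
  have [Hlt|[//|Hgt]] := Rtotal_order (Im z) 0.
  - have := sin_gt_0 (- Im z); rewrite sin_neg Hs.
    move: Hy; rewrite Rabs_left // => Hy; lra.
  - have := sin_gt_0 (Im z); move: Hy; rewrite Rabs_pos_eq ?Hs; lra.
have Hr : Re z = 0%R.
  apply: exp_inv; rewrite exp_0; move: Hre; rewrite Hi cos_0; lra.
by apply: injective_projections.
Qed.

Lemma tends_Cexp {T : Type} {F : (T -> Prop) -> Prop} {FF : Filter F}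
    (u : T -> C) (l : C) : tends F u l -> tends F (fun x => Cexp (u x)) (Cexp l).
Proof.
move=> Hu.
have Hc (g : C -> R) : (forall z, Rabs (g z) <= Cmod z)%R ->
    (forall z w : C, g (z - w)%C = (g z - g w)%R) -> filterlim (fun x => g (u x)) F (locally (g l)).
  move=> Hg Hm; apply/filterlim_locally => eps.
  apply: filter_imp (Hu eps (cond_pos eps)) => x Hx.
  rewrite /ball /= /AbsRing_ball /abs /minus /plus /opp /=.
  by apply: Rle_lt_trans Hx; have := Hg (u x - l); rewrite Hm.
have HRe := Hc Re re_le_Cmod (fun z w => eq_refl).
have HIm : filterlim (fun x => Im (u x)) F (locally (Im l)).
  apply: Hc => // z; have := Rmax_Cmod z; have := Rmax_r (Rabs (fst z)) (Rabs (snd z)).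
  rewrite /Im; lra.
have Hco (f : R -> R) (v : T -> R) (y : R) : continuity f ->
    filterlim v F (locally y) -> filterlim (fun x => f (v x)) F (locally (f y)).
  move=> Hf Hv; apply: filterlim_comp Hv _.
  by apply/continuity_pt_filterlim.
have Hmul (v w : T -> R) (y z : R) : filterlim v F (locally y) ->
    filterlim w F (locally z) -> filterlim (fun x => v x * w x)%R F (locally (y * z)%R).
  by move=> Hv Hw; eapply filterlim_comp_2; [exact Hv|exact Hw|exact: (@filterlim_mult R_AbsRing)].
have Hexp := Hco exp _ _ (derivable_continuous _ derivable_exp) HRe.
have H1 := Hmul _ _ _ _ Hexp (Hco cos _ _ continuity_cos HIm).
have H2 := Hmul _ _ _ _ Hexp (Hco sin _ _ continuity_sin HIm).
apply/tends_filterlim/filterlim_locally => eps.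
move/filterlim_locally: H1 => /(_ eps) H1; move/filterlim_locally: H2 => /(_ eps) H2.
by apply: filter_imp (filter_and _ _ H1 H2) => x [].
Qed.

Section Powers.
Variables (q L : C).
Hypothesis hL : Cexp L = q.

Lemma qpow_plus (x y : C) : qpow L (x + y) = qpow L x * qpow L y.
Proof. by rewrite /qpow -Cexp_plus; congr Cexp; ring. Qed.

Lemma qpow_0 : qpow L 0 = 1.
Proof. by rewrite /qpow -Cexp_0; congr Cexp; ring. Qed.

Lemma qpow_neq_0 (x : C) : qpow L x <> 0.
Proof. exact: Cexp_neq_0. Qed.

Lemma qpow_1 : qpow L 1 = q.
Proof. by rewrite /qpow -hL; congr Cexp; ring. Qed.

Lemma qpow_opp (x : C) : qpow L (- x) = / qpow L x.
Proof.
have H := qpow_neq_0 x.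
have E : qpow L x * qpow L (- x) = 1 by rewrite -qpow_plus -qpow_0; congr qpow; ring.
by rewrite -[LHS]Cmult_1_l -(Cinv_l _ H) -Cmult_assoc E; ring.
Qed.

Lemma qpow_minus (x y : C) : qpow L (x - y) = qpow L x / qpow L y.
Proof. by rewrite qpow_plus qpow_opp. Qed.

Lemma qpow_INR (n : nat) : qpow L (INR n) = q ^ n.
Proof.
elim: n => [|n IH]; first exact: qpow_0.
by rewrite S_INR RtoC_plus qpow_plus IH qpow_1 /=; ring.
Qed.

Lemma q_neq_0 : q <> 0.
Proof. by rewrite -hL; apply: Cexp_neq_0. Qed.

Lemma qpow_IZR_opp (n : nat) : qpow L (IZR (- Z.of_nat n)) = / q ^ n.
Proof. by rewrite opp_IZR -INR_IZR_INZ RtoC_opp qpow_opp qpow_INR. Qed.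

Lemma tends_qpow {T : Type} {F : (T -> Prop) -> Prop} {FF : Filter F}
    (u : T -> C) (l : C) : tends F u l -> tends F (fun x => qpow L (u x)) (qpow L l).
Proof. by move=> H; apply: tends_Cexp; apply: tends_mult H (tends_const _). Qed.

Lemma qpow_near0_neq_1 (c : C) : (Cmod q < 1)%R -> c <> 0 -> near0 (fun t => qpow L (c * t) <> 1).
Proof.
move=> hq1 Hc.
have HL : L <> 0.
  by move=> H; move: hq1; rewrite -hL H Cexp_0 Cmod_1; lra.
have H : tends near0 (fun t => c * t * L) (c * 0 * L).
  apply: tends_mult (tends_const _); apply: tends_mult near0_id; exact: tends_const.
apply: filter_imp (filter_and _ _ near0_neq (H _ Rlt_0_1)) => t [Ht Hs] /Cexp_eq_1_small.
replace (c * t * L - c * 0 * L) with (c * t * L) in Hs by ring.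
move=> /(_ Hs); apply: Cmult_neq_0 => //; exact: Cmult_neq_0.
Qed.
End Powers.

(** * Finite and infinite shifted factorials *)

Section Pochhammer.
Variable q : C.
Hypothesis hq1 : (Cmod q < 1)%R.
Let p := Cmod q.

(** No factor of [(w)_k] or of [(w)_infinity] vanishes: the form in which most denominators are
    controlled. *)
Definition no_pole (w : C) : Prop := forall k : nat, w * q ^ k <> 1.

Lemma no_pole_shift (w : C) : no_pole w -> no_pole (w * q).
Proof. by move=> H k; have := H (S k); rewrite /= Cmult_assoc. Qed.

Lemma no_pole_1m (w : C) : no_pole w -> 1 - w <> 0.
Proof.
move=> /(_ 0%nat) /= H E; apply: H.
by replace (w * 1) with (1 - (1 - w)) by ring; rewrite E; ring.
Qed.

Lemma one_minus_neq_0 (w : C) : 1 - w <> 0 <-> w <> 1.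
Proof.
split=> H E; apply: H; first by rewrite E; ring.
by replace w with (1 - (1 - w)) by ring; rewrite E; ring.
Qed.

Lemma qpoch_S (x : C) (k : nat) : qpoch q x (S k) = qpoch q x k * (1 - x * q ^ k).
Proof. by []. Qed.

Lemma qpoch_0 (k : nat) : qpoch q 0 k = 1.
Proof. by elim: k => [//|k IH] /=; rewrite IH; ring. Qed.

Lemma qpoch_add (x : C) (j k : nat) :
  qpoch q x (j + k) = qpoch q x j * qpoch q (x * q ^ j) k.
Proof.
elim: k => [|k IH]; first by rewrite Nat.add_0_r /=; ring.
by rewrite Nat.add_succ_r /= IH Cpow_add_r; ring.
Qed.

Lemma qpoch_front (x : C) (k : nat) : qpoch q x (S k) = (1 - x) * qpoch q (x * q) k.
Proof. by rewrite (qpoch_add x 1) /=; congr Cmult; [ring|congr qpoch; ring]. Qed.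

Lemma qpoch_shift (x : C) (k : nat) :
  (1 - x) * qpoch q (x * q) k = qpoch q x k * (1 - x * q ^ k).
Proof. by rewrite -qpoch_front. Qed.

Lemma qpoch_neq_0 (x : C) (k : nat) : no_pole x -> qpoch q x k <> 0.
Proof.
move=> H; elim: k => [|k IH] /=; first by move/RtoC_inj; lra.
by apply: Cmult_neq_0 => //; apply/one_minus_neq_0.
Qed.

Lemma qpoch_eq_0 (x : C) (j k : nat) : x * q ^ j = 1 -> (j < k)%nat -> qpoch q x k = 0.
Proof.
move=> H Hk; have -> : k = (j + S (k - S j))%nat by lia.
by rewrite qpoch_add qpoch_front H; ring.
Qed.

Lemma p_ge_0 : (0 <= p)%R. Proof. exact: Cmod_ge_0. Qed.

(** From [1 + x p^j <= exp (x p^j)] and the sum of the geometric series in the exponent. *)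
Definition qpoch_bound (x : R) : R := exp (x / (1 - p)).

Lemma qpoch_bound_pos (x : R) : (0 < qpoch_bound x)%R.
Proof. exact: exp_pos. Qed.

Lemma geom_partial_le (x : R) (k : nat) :
  (0 <= x -> x * (1 - p ^ k) / (1 - p) <= x / (1 - p))%R.
Proof.
move=> Hx; have H := pow_le p k p_ge_0; rewrite /p in H |- *.
apply: Rmult_le_compat_r; first by apply: Rlt_le; apply: Rinv_0_lt_compat; lra.
by rewrite -{2}(Rmult_1_r x); apply: Rmult_le_compat_l => //; lra.
Qed.

Lemma qpoch_le (x : C) (r : R) (k : nat) :
  (Cmod x <= r)%R -> (Cmod (qpoch q x k) <= qpoch_bound r)%R.
Proof.
move=> Hr; have Hx := Cmod_ge_0 x; have Hp := p_ge_0.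
(* The induction needs the partial geometric sum in the exponent; it is enlarged to the full sum
   outside the induction. *)
apply: (Rle_trans _ (exp (r * (1 - p ^ k) / (1 - p)))); last first.
  have [H|H] := geom_partial_le r k ltac:(lra).
    by apply: Rlt_le; apply: exp_increasing.
  by rewrite H; right.
elim: k => [|k IH] /=.
  rewrite Cmod_1; replace (r * (1 - 1) / (1 - p))%R with 0%R by (rewrite /p; field; lra).
  by rewrite exp_0; right.
rewrite Cmod_mult.
replace (r * (1 - p * p ^ k) / (1 - p))%R with (r * (1 - p ^ k) / (1 - p) + r * p ^ k)%R
  by (rewrite /p; field; lra).
rewrite exp_plus; apply: Rmult_le_compat => //; try exact: Cmod_ge_0.
have := exp_ineq1_le (r * p ^ k).
have := Cmod_triangle 1 (- (x * q ^ k)); rewrite Cmod_opp Cmod_mult Cmod_1 Cmod_pow -/p.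
have := Rmult_le_compat_r (p ^ k) _ _ (pow_le _ _ Hp) Hr.
rewrite /Cminus; lra.
Qed.

(** Weierstrass's inequality [|prod (1 - u_j)| >= 1 - sum |u_j|], with a sum of at most [1 / 2]. *)
Lemma qpoch_ge_half (x : C) (k : nat) :
  (Cmod x <= (1 - p) / 2)%R -> (1 / 2 <= Cmod (qpoch q x k))%R.
Proof.
move=> Hx; have Hx0 := Cmod_ge_0 x; have Hp := p_ge_0.
have H1 : (Cmod x / (1 - p) <= 1 / 2)%R.
  by apply/Rle_div_l; rewrite /p in Hx *; lra.
apply: (Rle_trans _ (1 - Cmod x * (1 - p ^ k) / (1 - p))).
  by have := geom_partial_le (Cmod x) k ltac:(lra); lra.
elim: k => [|k IH] /=.
  by rewrite Cmod_1; right; rewrite /p; field; lra.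
rewrite Cmod_mult.
replace (Cmod x * (1 - p * p ^ k) / (1 - p))%R with
  (Cmod x * (1 - p ^ k) / (1 - p) + Cmod x * p ^ k)%R by (rewrite /p; field; lra).
have Hk := pow_le p k Hp.
have Hk1 : (p ^ k <= 1)%R.
  by rewrite -(pow1 k); apply: pow_incr; rewrite /p in Hp *; lra.
have H2 : (0 <= Cmod x * p ^ k)%R by apply: Rmult_le_pos.
have H2' : (Cmod x * p ^ k <= Cmod x * 1)%R by apply: Rmult_le_compat_l.
have H3 : (0 <= Cmod x * (1 - p ^ k) / (1 - p))%R.
  by apply: Rdiv_le_0_compat; [apply: Rmult_le_pos; lra|rewrite /p; lra].
have H4 := geom_partial_le (Cmod x) k Hx0.
have H5 := Cmod_sub_ge 1 (x * q ^ k).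
rewrite Cmod_1 Cmod_mult Cmod_pow -/p in H5.
apply: (Rle_trans _ ((1 - Cmod x * (1 - p ^ k) / (1 - p)) * (1 - Cmod x * p ^ k))).
  have := Rmult_le_pos _ _ H3 H2; lra.
apply: Rmult_le_compat => //; lra.
Qed.

Lemma small_pow (M eps : R) : (0 < eps)%R -> exists N, forall n, (N <= n)%nat -> (M * p ^ n <= eps)%R.
Proof.
move=> He; have HM : (0 < Rmax M 1)%R by have := Rmax_r M 1; lra.
have [N HN] := pow_lt_1_zero p ltac:(by rewrite Rabs_pos_eq //; apply: p_ge_0) (eps / Rmax M 1)
  ltac:(by apply: Rdiv_lt_0_compat).
exists N => n Hn; have := HN n Hn; rewrite Rabs_pos_eq; last exact: pow_le p_ge_0.
move=> H; apply: (Rle_trans _ (Rmax M 1 * p ^ n)).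
  by apply: Rmult_le_compat_r (Rmax_l _ _); apply: pow_le p_ge_0.
by rewrite Rmult_comm; apply/Rle_div_r => //; lra.
Qed.

Section LimitParameter.
Context {T : Type} {F : (T -> Prop) -> Prop} {FF : Filter F}.
Variables (w : T -> C) (w0 : C).
Hypothesis Hw : tends F w w0.

Lemma tends_qpoch (k : nat) : tends F (fun x => qpoch q (w x) k) (qpoch q w0 k).
Proof.
elim: k => [|k IH] /=; first exact: tends_const.
apply: tends_mult => //; apply: tends_minus; first exact: tends_const.
by apply: tends_mult => //; apply: tends_const.
Qed.

Lemma qpoch_upper :
  F (fun x => forall k, (Cmod (qpoch q (w x) k) <= qpoch_bound (Cmod w0 + 1))%R).
Proof.
apply: filter_imp (tends_bounded _ _ Hw) => x Hx k.
by apply: qpoch_le; lra.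
Qed.

(** The products of at most [J] factors are finitely many continuous functions, non-zero at [w0];
    the remaining factors form a product [(w q^J)_k] with [|w q^J|] small enough for
    [qpoch_ge_half]. The bound is thus uniform in [k]. *)
Lemma qpoch_lower : no_pole w0 ->
  exists delta : R, (0 < delta)%R /\ F (fun x => forall k, (delta <= Cmod (qpoch q (w x) k))%R).
Proof.
move=> Hn.
have Hfin J : exists delta : R, (0 < delta)%R /\
    F (fun x => forall k, (k <= J)%nat -> (delta <= Cmod (qpoch q (w x) k))%R).
  elim: J => [|J [d [Hd HJ]]].
    exists 1%R; split; first lra.
    apply: filter_forall => x k Hk; have -> : k = 0%nat by lia.
    by rewrite /= Cmod_1; right.
  have Hnz := qpoch_neq_0 w0 (S J) Hn.
  have HS := tends_away (FF := FF) _ _ Hnz (tends_qpoch (S J)).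
  have Hm := proj1 (Cmod_gt_0 _) Hnz.
  exists (Rmin d (Cmod (qpoch q w0 (S J)) / 2)); split; first by apply: Rmin_pos => //; lra.
  apply: filter_imp (filter_and _ _ HJ HS) => x [H1 H2] k Hk.
  have [Hle|Hgt] := Nat.le_gt_cases k J.
    by apply: Rle_trans (H1 k Hle); apply: Rmin_l.
  have -> : k = S J by lia.
  by apply: Rle_trans (Rlt_le _ _ H2); apply: Rmin_r.
have [J HJ] := small_pow (Cmod w0 + 1) ((1 - p) / 2) ltac:(rewrite /p; lra).
have [d [Hd HdJ]] := Hfin J.
exists (d * (1 / 2))%R; split; first lra.
apply: filter_imp (filter_and _ _ HdJ (tends_bounded _ _ Hw)) => x [H1 H2] k.
have [Hle|Hgt] := Nat.le_gt_cases k J; first by have := H1 k Hle; lra.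
have -> : k = (J + (k - J))%nat by lia.
rewrite qpoch_add Cmod_mult.
apply: Rmult_le_compat; [lra|lra|exact: H1|].
apply: qpoch_ge_half; rewrite Cmod_mult Cmod_pow -/p.
apply: Rle_trans (HJ J (Nat.le_refl _)).
apply: Rmult_le_compat_r; [exact: pow_le p_ge_0|lra].
Qed.
End LimitParameter.

(** The increment [(x)_(k+1) - (x)_k]. It turns the infinite product into a geometrically dominated
    series, so that convergence and continuity in [x] both follow from the results on such
    series. *)
Let dif (x : C) (k : nat) : C := - (qpoch q x k * (x * q ^ k)).

Lemma qpoch_csum (x : C) (n : nat) : qpoch q x n = 1 + csum (dif x) n.
Proof.
elim: n => [|n IH] /=; first by ring.
by replace (csum (dif x) n) with (qpoch q x n - 1) by (rewrite IH; ring); rewrite /dif; ring.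
Qed.

Lemma dif_le (x : C) (r : R) (k : nat) :
  (Cmod x <= r)%R -> (Cmod (dif x k) <= qpoch_bound r * r * p ^ k)%R.
Proof.
move=> Hx; rewrite /dif Cmod_opp !Cmod_mult Cmod_pow -/p.
have Hk := pow_le p k p_ge_0; have H0 := Cmod_ge_0 x.
rewrite Rmult_assoc; apply: Rmult_le_compat; try exact: Cmod_ge_0.
- exact: Rmult_le_pos.
- exact: qpoch_le.
- exact: Rmult_le_compat_r.
Qed.

Lemma qpoch_inf_csum (x : C) : is_csum (dif x) (qpoch_inf q x - 1).
Proof.
have [l Hl] := csum_geom_ex _ p p_ge_0 hq1 (dif x) (fun k => dif_le x (Cmod x) k (Rle_refl _)).
suff -> : qpoch_inf q x = 1 + l by replace (1 + l - 1) with l by ring.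
apply: Clim_eq; apply: (tends_ext (fun n => 1 + csum (dif x) n)).
  by move=> n; rewrite -qpoch_csum.
by apply: tends_plus => //; apply: tends_const.
Qed.

Lemma tends_qpoch_inf (x : C) : tends eventually (qpoch q x) (qpoch_inf q x).
Proof.
apply: (tends_ext (fun n => 1 + csum (dif x) n)); first by move=> n; rewrite -qpoch_csum.
replace (qpoch_inf q x) with (1 + (qpoch_inf q x - 1)) by ring.
by apply: tends_plus (qpoch_inf_csum x); apply: tends_const.
Qed.

Lemma qpoch_inf_continuous {T : Type} {F : (T -> Prop) -> Prop} {FF : Filter F}
    (w : T -> C) (w0 : C) :
  tends F w w0 -> tends F (fun x => qpoch_inf q (w x)) (qpoch_inf q w0).
Proof.
move=> Hw; apply: (tends_ext (fun x => 1 + (qpoch_inf q (w x) - 1))); first by move=> x; ring.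
replace (qpoch_inf q w0) with (1 + (qpoch_inf q w0 - 1)) by ring.
apply: tends_plus; first exact: tends_const.
have Hr : (0 <= Cmod w0 + 1)%R by have := Cmod_ge_0 w0; lra.
apply: (tannery (qpoch_bound (Cmod w0 + 1) * (Cmod w0 + 1)) p p_ge_0 hq1
  (fun x => dif (w x)) (dif w0)).
- by apply: Rmult_le_pos => //; apply: Rlt_le; apply: qpoch_bound_pos.
- move=> k; apply: tends_opp; apply: tends_mult; first exact: tends_qpoch.
  by apply: tends_mult => //; apply: tends_const.
- apply: filter_imp (tends_bounded _ _ Hw) => x Hx k; apply: dif_le; lra.
- by move=> k; apply: dif_le; lra.
- by apply: filter_forall => x; apply: qpoch_inf_csum.
- exact: qpoch_inf_csum.
Qed.

Lemma qpoch_inf_step (x : C) : qpoch_inf q x = (1 - x) * qpoch_inf q (x * q).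
Proof.
apply: (tends_unique (fun n => qpoch q x (S n))).
  apply: (tends_subseq S) (tends_qpoch_inf x) => n; lia.
apply: (tends_ext (fun n => (1 - x) * qpoch q (x * q) n)); first by move=> n; rewrite qpoch_front.
by apply: tends_mult (tends_qpoch_inf _); apply: tends_const.
Qed.

Lemma qpoch_inf_0 : qpoch_inf q 0 = 1.
Proof.
by apply: Clim_eq; apply: (tends_ext (fun _ => RtoC 1));
  [move=> n; rewrite qpoch_0|apply: tends_const].
Qed.

Lemma qpoch_inf_neq_0 (x : C) : no_pole x -> qpoch_inf q x <> 0.
Proof.
move=> Hn E.
have [d [Hd [N HN]]] := qpoch_lower (F := eventually) _ _ (tends_const x) Hn.
have := tends_qpoch_inf x; rewrite E => /(_ d Hd) [N' HN'].
have := HN' (Nat.max N N') ltac:(lia); have := HN (Nat.max N N') ltac:(lia) (Nat.max N N').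
replace (qpoch q x (Nat.max N N') - 0) with (qpoch q x (Nat.max N N')) by ring; move=> /=; lra.
Qed.

Lemma qpoch_inf_eq_0 (x : C) (j : nat) : x * q ^ j = 1 -> qpoch_inf q x = 0.
Proof.
move=> H; apply: Clim_eq; apply: (tends_ext_loc (fun _ => RtoC 0)); last exact: tends_const.
by exists (S j) => n Hn; rewrite (qpoch_eq_0 x j n H Hn).
Qed.

Lemma no_pole_near {T : Type} {F : (T -> Prop) -> Prop} {FF : Filter F} (w : T -> C) (w0 : C) :
  tends F w w0 -> no_pole w0 -> F (fun x => no_pole (w x)).
Proof.
move=> Hw Hn; have [d [Hd Hk]] := qpoch_lower w w0 Hw Hn.
apply: filter_imp Hk => x Hx k Hk1.
have := Hx (S k); rewrite (qpoch_eq_0 _ k (S k) Hk1 (le_n _)) Cmod_0; lra.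
Qed.
End Pochhammer.

(** * The contiguous relation *)

(* [esym_poly .. u] is [prod (1 - x u)] and [esym_rev .. u] is [prod (1 - u/x)], in terms of the
   elementary symmetric functions of the five parameters: the identities below
   are linear in these. *)
Definition esym_poly (e1 e2 e3 e4 e5 u : C) : C :=
  1 - e1 * u + e2 * u ^ 2 - e3 * u ^ 3 + e4 * u ^ 4 - e5 * u ^ 5.
Definition esym_rev (e1 e2 e3 e4 e5 u : C) : C :=
  (e5 - e4 * u + e3 * u ^ 2 - e2 * u ^ 3 + e1 * u ^ 4 - u ^ 5) / e5.

(** The first four symmetric functions are hidden behind an existential, so that later [field] calls
    see them as indeterminates. Only the product of the parameters stays explicit, since the
    balancing condition fixes it. *)
Lemma esym_expand (b c d e f : C) :
  b <> 0 -> c <> 0 -> d <> 0 -> e <> 0 -> f <> 0 ->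
  exists e1 e2 e3 e4 : C, forall u : C,
    prodl (fun x => 1 - x * u) [b; c; d; e; f] =
      esym_poly e1 e2 e3 e4 (b * c * d * e * f) u /\
    prodl (fun x => 1 - u / x) [b; c; d; e; f] =
      esym_rev e1 e2 e3 e4 (b * c * d * e * f) u.
Proof.
move=> Hb Hc Hd He Hf.
exists (b + c + d + e + f),
  (b*c + b*d + b*e + b*f + c*d + c*e + c*f + d*e + d*f + e*f),
  (b*c*d + b*c*e + b*c*f + b*d*e + b*d*f + b*e*f + c*d*e + c*d*f + c*e*f + d*e*f),
  (b*c*d*e + b*c*d*f + b*c*e*f + b*d*e*f + c*d*e*f) => u.
by rewrite /esym_poly /esym_rev /=; split; [ring|field].
Qed.

(** The coefficient of the function with [g] raised and [h] lowered. It is found by setting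
    [K = q / h] in [contig_polynomial]: two of the three products on the right vanish there, and so
    does the first product on the left. *)
Definition contig_coef (q a : C) (xs : list C) (g h : C) : C :=
  prodl (fun x => 1 - a * q / (h * x)) xs * ((1 - g) * (1 - a / g) * (1 - a * q / g)) /
  ((1 - g * q / h) * (1 - g / h) * (1 - a * q / (g * h))).

Lemma prodl_ext (g g' : C -> C) (xs : list C) :
  (forall x, g x = g' x) -> prodl g xs = prodl g' xs.
Proof. by move=> H; elim: xs => [//|x xs IH] /=; rewrite H IH. Qed.

Lemma prodl_ext_in (g g' : C -> C) (xs : list C) :
  List.Forall (fun x => g x = g' x) xs -> prodl g xs = prodl g' xs.
Proof. by elim=> [//|x ys H _ IH] /=; rewrite H IH. Qed.

Lemma prodl_neq_0 (g : C -> C) (xs : list C) :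
  List.Forall (fun x => g x <> 0) xs -> prodl g xs <> 0.
Proof.
elim=> [|x ys Hx _ IH] /=; first by move/RtoC_inj; lra.
exact: Cmult_neq_0.
Qed.

Lemma prodl_mult (g g' : C -> C) (xs : list C) :
  prodl (fun x => g x * g' x) xs = prodl g xs * prodl g' xs.
Proof. by elim: xs => [|x xs IH] /=; [ring|rewrite IH; ring]. Qed.

Lemma div_neq_0 (x y : C) : y <> 0 -> 1 - x / y <> 0 <-> y - x <> 0.
Proof.
move=> Hy; have E : y - x = y * (1 - x / y) by field.
split=> H.
  by rewrite E; apply: Cmult_neq_0.
by move=> H0; apply: H; rewrite E H0; ring.
Qed.

(* The two very well poised products differ by [K (1 - a K^2)] times a quadratic
   polynomial in [1/K + a K]; the three products on the right form a basis of such polynomials. *)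
Lemma contig_polynomial (q a b c d e f g h K : C) :
  b <> 0 -> c <> 0 -> d <> 0 -> e <> 0 -> f <> 0 ->
  a <> 0 -> q <> 0 -> g <> 0 -> h <> 0 ->
  b * c * d * e * f * g * h = a ^ 3 * q ^ 2 ->
  h - g * q <> 0 -> h - g <> 0 -> g * h - a * q <> 0 -> g - h * q <> 0 ->
  1 - g <> 0 -> 1 - h <> 0 -> g - a <> 0 -> h - a <> 0 ->
  g - a * q <> 0 -> h - a * q <> 0 ->
  let xs := [b; c; d; e; f] in
  let al := contig_coef q a xs g h in
  let ga := contig_coef q a xs h g in
  (1 - a * K) * prodl (fun x => 1 - x * K) xs * (1 - g * K / q) * (1 - h * K / q)
  - (1 - K) * prodl (fun x => 1 - a * K / x) xs * (1 - a * q * K / g) * (1 - a * q * K / h)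
  = K * (1 - a * K ^ 2) *
    (al * ((1 - h / q) / ((1 - g) * (1 - a / g) * (1 - a * q / g))) *
       ((1 - g * K) * (1 - a * K / g) * (1 - g * K / q) * (1 - a * q * K / g))
     + ga * ((1 - g / q) / ((1 - h) * (1 - a / h) * (1 - a * q / h))) *
       ((1 - h * K) * (1 - a * K / h) * (1 - h * K / q) * (1 - a * q * K / h))
     + (prodl (fun x => 1 - x) xs - al - ga) / ((1 - a * q / g) * (1 - a * q / h)) *
       ((1 - g * K / q) * (1 - a * q * K / g) * (1 - h * K / q) * (1 - a * q * K / h))).
Proof.
move=> Hb Hc Hd He Hf Ha Hq Hg Hh Hbal N1 N2 N3 N4 N5 N6 N7 N8 N9 N10 xs al ga; rewrite /al /ga /xs {al ga xs}.
have N11 : g - h <> 0.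
  by move=> E; apply: N2; replace (h - g) with (- (g - h)) by ring; rewrite E; ring.
have N12 : h * g - a * q <> 0 by rewrite Cmult_comm.
have [e1 [e2 [e3 [e4 H]]]] := esym_expand b c d e f Hb Hc Hd He Hf.
(* The balancing condition makes the fifth symmetric function a monomial in [a], [q], [g], [h]; what
   remains is a rational identity, linear in the other four. *)
have E5 : b * c * d * e * f = a ^ 3 * q ^ 2 / (g * h) by rewrite -Hbal; field.
rewrite /contig_coef.
have HE (u : C) : prodl (fun x => 1 - u / x) [b; c; d; e; f] =
    esym_rev e1 e2 e3 e4 (a ^ 3 * q ^ 2 / (g * h)) u by rewrite -E5; apply: (proj2 (H u)).
have HP (u : C) : prodl (fun x => 1 - x * u) [b; c; d; e; f] =
    esym_poly e1 e2 e3 e4 (a ^ 3 * q ^ 2 / (g * h)) u by rewrite -E5; apply: (proj1 (H u)).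
have HR (y : C) : y <> 0 -> prodl (fun x => 1 - a * q / (y * x)) [b; c; d; e; f] =
    esym_rev e1 e2 e3 e4 (a ^ 3 * q ^ 2 / (g * h)) (a * q / y).
  by move=> Hy; rewrite -HE /=; field; repeat split.
have H1 : prodl (fun x => 1 - x) [b; c; d; e; f] =
    esym_poly e1 e2 e3 e4 (a ^ 3 * q ^ 2 / (g * h)) 1.
  by rewrite -HP /=; ring.
rewrite HP HE H1 !HR // /esym_poly /esym_rev; clear H HE HP HR H1 E5 Hbal.
by field; repeat split.
Qed.

(** * Telescoping of the nonterminating series *)

Section Series.
Variables (q a b c d e f : C).
Hypothesis hq1 : (Cmod q < 1)%R.
Hypothesis hq0 : q <> 0.
Hypothesis ha0 : a <> 0.
Hypothesis ha1 : 1 - a <> 0.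
Let xs := [b; c; d; e; f].
Hypothesis hxs : List.Forall (fun x : C => x <> 0) xs.
Hypothesis hpole : List.Forall (fun x => no_pole q (a * q / x)) xs.

Lemma no_pole_q : no_pole q q.
Proof.
move=> k E.
have := Cmod_1; rewrite -E Cmod_mult Cmod_pow.
have H0 := Cmod_ge_0 q; have H1 : (Cmod q ^ k <= 1)%R.
  by rewrite -(pow1 k); apply: pow_incr; lra.
have := Rmult_le_compat_l _ _ _ H0 H1; lra.
Qed.

Definition term_base (k : nat) : C :=
  qpoch q a k / qpoch q q k * prodl (fun x => qpoch q x k / qpoch q (a * q / x) k) xs.

Definition phi_term (g h : C) (k : nat) : C := vwp_term q a [b; c; d; e; f; g; h] q k.

Lemma phi_termE (g h : C) (k : nat) :
  phi_term g h k = (1 - a * (q ^ k) ^ 2) / (1 - a) * term_base k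
    * (qpoch q g k / qpoch q (a * q / g) k) * (qpoch q h k / qpoch q (a * q / h) k) * q ^ k.
Proof.
rewrite /phi_term /vwp_term /term_base /xs /=.
have -> : q ^ (k + (k + 0)) = q ^ k * (q ^ k * 1) by rewrite Nat.add_0_r Cpow_add_r; ring.
ring.
Qed.

Lemma phi_term_sym (g h : C) (k : nat) : phi_term g h k = phi_term h g k.
Proof. by rewrite !phi_termE; ring. Qed.

(** The telescoping certificate: the contiguous combination of the [k]-th terms is its forward
    difference, see [contig_term]. The factor [1 - q^k] makes it vanish at [k = 0]. *)
Definition contig_sum (g h : C) (k : nat) : C :=
  term_base k * (qpoch q (g / q) k / qpoch q (a * q ^ 2 / g) k)
  * (qpoch q (h / q) k / qpoch q (a * q ^ 2 / h) k) / ((1 - a) * (1 - g / q) * (1 - h / q))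
  * ((1 - q ^ k) * prodl (fun x => 1 - a * q ^ k / x) xs
     * (1 - a * q * q ^ k / g) * (1 - a * q * q ^ k / h)).

(** The new factors of the shifted factorials cancel against the polynomial at [k + 1], which leaves
    the same common factor as in [contig_sum g h k] with another polynomial. The difference of the
    two polynomials is the left side of [contig_polynomial] at [K = q^k]. *)
Lemma contig_sumS (g h : C) (k : nat) :
  g <> 0 -> h <> 0 -> no_pole q (a * q ^ 2 / g) -> no_pole q (a * q ^ 2 / h) ->
  contig_sum g h (S k) =
  term_base k * (qpoch q (g / q) k / qpoch q (a * q ^ 2 / g) k)
  * (qpoch q (h / q) k / qpoch q (a * q ^ 2 / h) k) / ((1 - a) * (1 - g / q) * (1 - h / q))
  * ((1 - a * q ^ k) * prodl (fun x => 1 - x * q ^ k) xs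
     * (1 - g * q ^ k / q) * (1 - h * q ^ k / q)).
Proof.
move=> Hg Hh Pg Ph; rewrite /contig_sum /term_base.
have Hx : prodl (fun x => qpoch q x (S k) / qpoch q (a * q / x) (S k)) xs
    * prodl (fun x => 1 - a * q ^ S k / x) xs =
    prodl (fun x => qpoch q x k / qpoch q (a * q / x) k) xs * prodl (fun x => 1 - x * q ^ k) xs.
  rewrite -!prodl_mult; apply: prodl_ext_in.
  elim: (Forall_and hxs hpole) => [|x ys [H0 Hp] _ IH]; constructor=> //.
  have H1 := qpoch_neq_0 q _ k Hp; have H2 : 1 - a * q / x * q ^ k <> 0 by apply/one_minus_neq_0.
  rewrite !qpoch_S; replace (a * q ^ S k / x) with (a * q / x * q ^ k) by (rewrite /=; field => //).
  by move: (a * q / x) H1 H2 => w H1 H2; field.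
have Hq : qpoch q q k <> 0 by apply: qpoch_neq_0; apply: no_pole_q.
have Hq' : 1 - q * q ^ k <> 0 by apply/one_minus_neq_0; apply: no_pole_q.
have Gk := qpoch_neq_0 q _ k Pg; have Hk := qpoch_neq_0 q _ k Ph.
have G1 : 1 - a * q ^ 2 / g * q ^ k <> 0 by apply/one_minus_neq_0.
have H1 : 1 - a * q ^ 2 / h * q ^ k <> 0 by apply/one_minus_neq_0.
rewrite [LHS](_ : _ = (qpoch q a (S k) / qpoch q q (S k) * (1 - q ^ S k)
  * (qpoch q (g / q) (S k) / qpoch q (a * q ^ 2 / g) (S k) * (1 - a * q * q ^ S k / g))
  * (qpoch q (h / q) (S k) / qpoch q (a * q ^ 2 / h) (S k) * (1 - a * q * q ^ S k / h)))
  * / ((1 - a) * (1 - g / q) * (1 - h / q))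
  * (prodl (fun x => qpoch q x (S k) / qpoch q (a * q / x) (S k)) xs
    * prodl (fun x => 1 - a * q ^ S k / x) xs)); last by rewrite /Cdiv; ring.
rewrite Hx.
have -> : qpoch q a (S k) / qpoch q q (S k) * (1 - q ^ S k) =
  qpoch q a k / qpoch q q k * (1 - a * q ^ k) by rewrite !qpoch_S /=; field.
have HH (y : C) : y <> 0 -> qpoch q (a * q ^ 2 / y) k <> 0 -> 1 - a * q ^ 2 / y * q ^ k <> 0 ->
    qpoch q (y / q) (S k) / qpoch q (a * q ^ 2 / y) (S k) * (1 - a * q * q ^ S k / y) =
    qpoch q (y / q) k / qpoch q (a * q ^ 2 / y) k * (1 - y * q ^ k / q).
  move=> Hy N1 N2; rewrite !qpoch_S.
  replace (1 - a * q * q ^ S k / y) with (1 - a * q ^ 2 / y * q ^ k) by (rewrite /=; field => //).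
  replace (1 - y * q ^ k / q) with (1 - y / q * q ^ k) by (field => //).
  by move: (a * q ^ 2 / y) N1 N2 => w N1 N2; field.
by rewrite !HH //; rewrite /Cdiv; ring.
Qed.

Definition contig_generic (g h : C) : Prop :=
  (g <> 0 /\ h <> 0 /\ 1 - g <> 0 /\ 1 - h <> 0 /\ q - g <> 0 /\ q - h <> 0)
  /\ (h - g * q <> 0 /\ h - g <> 0 /\ g * h - a * q <> 0 /\ g - h * q <> 0)
  /\ no_pole q (a / g) /\ no_pole q (a / h).

(** With [ratio_shift2], it reduces the factors belonging to [y] and [y q] to the one belonging to
    [y / q], the lowest of the three contiguous values. *)
Lemma ratio_shift1 (y : C) (k : nat) :
  y <> 0 -> 1 - y / q <> 0 -> no_pole q (a / y) ->
  qpoch q y k / qpoch q (a * q / y) k =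
  qpoch q (y / q) k / qpoch q (a * q ^ 2 / y) k *
    ((1 - y * q ^ k / q) * (1 - a * q * q ^ k / y) / ((1 - y / q) * (1 - a * q / y))).
Proof.
move=> Hy Hyq H.
have H1 := no_pole_shift _ _ H; have H2 := no_pole_shift _ _ H1.
have E1 := qpoch_shift q (y / q) k; have E2 := qpoch_shift q (a / y * q) k.
have N2 := qpoch_neq_0 q _ k H2.
have N3 := no_pole_1m _ _ H1.
replace (y / q * q) with y in E1 by (field; done).
replace (a * q / y) with (a / y * q) by (field; done).
replace (a * q ^ 2 / y) with (a / y * q * q) by (rewrite /=; field; done).
replace (1 - y * q ^ k / q) with (1 - y / q * q ^ k) by (field; done).
replace (1 - a * q * q ^ k / y) with (1 - a / y * q * q ^ k) by (field; done).
have N4 : 1 - a / y * q * q ^ k <> 0 by apply/one_minus_neq_0.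
have -> : qpoch q y k = qpoch q (y / q) k * (1 - y / q * q ^ k) / (1 - y / q).
  by rewrite -E1; move: (1 - y / q) Hyq => u Hu; field.
have -> : qpoch q (a / y * q) k = (1 - a / y * q) * qpoch q (a / y * q * q) k / (1 - a / y * q * q ^ k).
  by rewrite E2; move: (1 - a / y * q * q ^ k) N4 => w N4; field.
move: (1 - a / y * q * q ^ k) (1 - a / y * q) (1 - y / q) N3 N4 Hyq => w v u N3 N4 Hu.
by field.
Qed.

Lemma ratio_shift2 (y : C) (k : nat) :
  y <> 0 -> 1 - y / q <> 0 -> 1 - y <> 0 -> no_pole q (a / y) ->
  qpoch q (y * q) k / qpoch q (a * q / (y * q)) k =
  qpoch q (y / q) k / qpoch q (a * q ^ 2 / y) k *
    ((1 - y * q ^ k / q) * (1 - y * q ^ k) * (1 - a * q ^ k / y) * (1 - a * q * q ^ k / y) /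
     ((1 - y / q) * (1 - y) * (1 - a / y) * (1 - a * q / y))).
Proof.
move=> Hy Hyq Hy1 H.
have E1 := qpoch_shift q y k; have E2 := qpoch_shift q (a / y) k.
have H1 := no_pole_shift _ _ H.
have N0 := qpoch_neq_0 q _ k H.
have N3 := no_pole_1m _ _ H; have N4 : 1 - a / y * q ^ k <> 0 by apply/one_minus_neq_0.
have N5 := no_pole_1m _ _ H1.
transitivity (qpoch q y k / qpoch q (a * q / y) k *
  ((1 - y * q ^ k) * (1 - a / y * q ^ k) / ((1 - y) * (1 - a / y)))).
  replace (a * q / (y * q)) with (a / y) by (field; done).
  replace (a * q / y) with (a / y * q) by (field; done).
  have -> : qpoch q (y * q) k = qpoch q y k * (1 - y * q ^ k) / (1 - y) by rewrite -E1; field.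
  have -> : qpoch q (a / y * q) k = qpoch q (a / y) k * (1 - a / y * q ^ k) / (1 - a / y).
    by rewrite -E2; move: (1 - a / y) N3 => w N3; field.
  by move: (1 - a / y * q ^ k) (1 - a / y) N3 N4 => w v N3 N4; field.
rewrite (ratio_shift1 y k Hy Hyq H).
replace (1 - a * q / y) with (1 - a / y * q) by (field; done).
replace (1 - a * q ^ k / y) with (1 - a / y * q ^ k) by (field; done).
move: (qpoch q (y / q) k / _) (1 - y * q ^ k / q) (1 - a * q * q ^ k / y) => U A B.
move: (1 - a / y * q) (1 - a / y) (1 - y / q) (1 - y) N3 N5 Hyq Hy1 => u v w z *.
by field.
Qed.

Lemma contig_term (g h : C) (k : nat) :
  b * c * d * e * f * g * h = a ^ 3 * q ^ 2 -> contig_generic g h ->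
  contig_coef q a xs g h * (phi_term (g * q) (h / q) k - phi_term g h k)
  + contig_coef q a xs h g * (phi_term (g / q) (h * q) k - phi_term g h k)
  + prodl (fun x => 1 - x) xs * phi_term g h k
  = contig_sum g h (S k) - contig_sum g h k.
Proof.
move=> Hbal [[Hg [Hh [Hg1 [Hh1 [Hgq Hhq]]]]] [[N1 [N2 [N3 N4]]] [Pg Ph]]].
have Pshift (y : C) : y <> 0 -> no_pole q (a / y) ->
    (no_pole q (a * q / y) /\ no_pole q (a * q ^ 2 / y)).
  move=> Hy H; have H1 := no_pole_shift _ _ H; have H2 := no_pole_shift _ _ H1; split.
    by replace (a * q / y) with (a / y * q) by (field => //).
  by replace (a * q ^ 2 / y) with (a / y * q * q) by (field => //).
have [Pg1 Pg2] := Pshift g Hg Pg; have [Ph1 Ph2] := Pshift h Hh Ph.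
have Dn (y : C) : y <> 0 -> no_pole q (a / y) -> y - a <> 0.
  by move=> Hy /no_pole_1m; apply: (proj1 (div_neq_0 _ _ Hy)).
have Dn' (y : C) : y <> 0 -> no_pole q (a * q / y) -> y - a * q <> 0.
  by move=> Hy /no_pole_1m; apply: (proj1 (div_neq_0 _ _ Hy)).
rewrite (contig_sumS g h k Hg Hh Pg2 Ph2) /contig_sum.
move: (hxs); rewrite /xs !List.Forall_cons_iff => -[Hb [Hc [Hd [He [Hf _]]]]].
have := contig_polynomial q a b c d e f g h (q ^ k) Hb Hc Hd He Hf ha0 hq0 Hg Hh Hbal
  N1 N2 N3 N4 Hg1 Hh1 (Dn g Hg Pg) (Dn h Hh Ph) (Dn' g Hg Pg1) (Dn' h Hh Ph1).
cbv zeta; rewrite -/xs; set al := contig_coef q a xs g h; set ga := contig_coef q a xs h g.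
set PP := prodl _ _; set QQ := prodl _ _; set RR := prodl _ _ => Hpol.
rewrite !phi_termE; set K := q ^ k in Hpol *; set B := term_base k.
have Hpq (y : C) : q - y <> 0 -> 1 - y / q <> 0 by move=> H; apply/div_neq_0.
rewrite !(ratio_shift2 _ _ _ _ _ Pg) ?(ratio_shift2 _ _ _ _ _ Ph); try (exact: Hpq); try done.
rewrite !(ratio_shift1 _ _ _ _ Pg) ?(ratio_shift1 _ _ _ _ Ph); try (exact: Hpq); try done.
replace (a * q / (g / q)) with (a * q ^ 2 / g) by (rewrite /=; field; done).
replace (a * q / (h / q)) with (a * q ^ 2 / h) by (rewrite /=; field; done).
rewrite -/K; set U := qpoch q (g / q) k / qpoch q (a * q ^ 2 / g) k.
set V := qpoch q (h / q) k / qpoch q (a * q ^ 2 / h) k.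
(* Everything has been brought over the common factor; only polynomials in [K] are left to
   compare. *)
transitivity (B * U * V / ((1 - a) * (1 - g / q) * (1 - h / q)) *
   ((1 - a * K) * PP * (1 - g * K / q) * (1 - h * K / q) -
    (1 - K) * QQ * (1 - a * q * K / g) * (1 - a * q * K / h))); last by ring.
rewrite Hpol; move: (Dn g Hg Pg) (Dn h Hh Ph) (Dn' g Hg Pg1) (Dn' h Hh Ph1) => D1 D2 D3 D4.
clear Hpol Hbal; by field.
Qed.

Lemma pole_shift (y : C) :
  y <> 0 -> no_pole q (a / y) -> no_pole q (a * q / y) /\ no_pole q (a * q ^ 2 / y).
Proof.
move=> Hy H; have H1 := no_pole_shift _ _ H; have H2 := no_pole_shift _ _ H1; split.
  by replace (a * q / y) with (a / y * q) by (field; done).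
by replace (a * q ^ 2 / y) with (a / y * q * q) by (rewrite /=; field; done).
Qed.

Lemma ratio_bounded {T : Type} {F : (T -> Prop) -> Prop} {FF : Filter F}
    (y w : T -> C) (y0 w0 : C) :
  tends F y y0 -> tends F w w0 -> no_pole q w0 ->
  exists M : R, (0 <= M)%R /\
    F (fun x => forall k, (Cmod (qpoch q (y x) k / qpoch q (w x) k) <= M)%R).
Proof.
move=> Hy Hw Hn.
have Hu := qpoch_upper (FF := FF) q hq1 y y0 Hy.
have [dl [Hd Hl]] := qpoch_lower q hq1 w w0 Hw Hn.
exists (qpoch_bound q (Cmod y0 + 1) * / dl)%R; split.
  apply: Rmult_le_pos; first by apply: Rlt_le; apply: qpoch_bound_pos.
  by apply: Rlt_le; apply: Rinv_0_lt_compat.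
apply: filter_imp (filter_and _ _ Hu Hl) => x [H1 H2] k.
have Hnz : qpoch q (w x) k <> 0 by apply/Cmod_gt_0; apply: Rlt_le_trans Hd (H2 k).
rewrite Cmod_div //; apply: Rmult_le_compat; [exact: Cmod_ge_0| |exact: H1|].
  by apply: Rlt_le; apply: Rinv_0_lt_compat; apply: Rlt_le_trans Hd (H2 k).
by apply: Rinv_le_contravar.
Qed.

Lemma ratio_bounded_const (y w : C) :
  no_pole q w -> exists M : R, (0 <= M)%R /\ forall k, (Cmod (qpoch q y k / qpoch q w k) <= M)%R.
Proof.
move=> Hn.
have [M [HM [N HN]]] := ratio_bounded (F := eventually) _ _ y w (tends_const y) (tends_const w) Hn.
by exists M; split=> // k; apply: (HN N).
Qed.

Lemma term_base_bounded : exists M : R, (0 <= M)%R /\ forall k, (Cmod (term_base k) <= M)%R.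
Proof.
rewrite /term_base.
have [M1 [HM1 H1]] := ratio_bounded_const a q no_pole_q.
suff [M2 [HM2 H2]] : exists M : R, (0 <= M)%R /\ forall k,
    (Cmod (prodl (fun x => qpoch q x k / qpoch q (a * q / x) k)%C xs) <= M)%R.
  exists (M1 * M2)%R; split; first exact: Rmult_le_pos.
  by move=> k; rewrite Cmod_mult; apply: Rmult_le_compat => //; apply: Cmod_ge_0.
elim: hpole => [|x ys Hx _ [M2 [HM2 H2]]].
  by exists 1%R; split=> [|k] /=; rewrite ?Cmod_1; lra.
have [M3 [HM3 H3]] := ratio_bounded_const x _ Hx.
exists (M3 * M2)%R; split; first exact: Rmult_le_pos.
by move=> k; rewrite /= Cmod_mult; apply: Rmult_le_compat => //; apply: Cmod_ge_0.
Qed.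

Lemma pow_q_le_1 (k : nat) : (Cmod (q ^ k) <= 1)%R.
Proof. by rewrite Cmod_pow -(pow1 k); apply: pow_incr; have := Cmod_ge_0 q; lra. Qed.

Lemma vwp_factor_le (k : nat) :
  (Cmod ((1 - a * (q ^ k) ^ 2) / (1 - a)) <= (1 + Cmod a) / Cmod (1 - a))%R.
Proof.
rewrite Cmod_div //; apply: Rmult_le_compat_r.
  by apply: Rlt_le; apply: Rinv_0_lt_compat; apply/Cmod_gt_0.
apply: Rle_trans (Cmod_triangle _ _) _; rewrite Cmod_opp Cmod_1 Cmod_mult Cmod_pow.
have H : (Cmod (q ^ k) ^ 2 <= 1)%R.
  rewrite -(pow1 2); apply: pow_incr; split; [exact: Cmod_ge_0|exact: pow_q_le_1].
by have := Rmult_le_compat_l _ _ _ (Cmod_ge_0 a) H; lra.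
Qed.

(** The ratios of shifted factorials are bounded in [k], uniformly near the limit point, so the
    decay is that of the argument [q] of the series. *)
Lemma phi_term_bounded {T : Type} {F : (T -> Prop) -> Prop} {FF : Filter F}
    (g h : T -> C) (g0 h0 : C) :
  tends F g g0 -> tends F h h0 -> g0 <> 0 -> h0 <> 0 ->
  no_pole q (a * q / g0) -> no_pole q (a * q / h0) ->
  exists M : R, (0 <= M)%R /\
    F (fun x => forall k, (Cmod (phi_term (g x) (h x) k) <= M * Cmod q ^ k)%R).
Proof.
move=> Hg Hh Ng Nh Pg Ph.
have [M1 [HM1 H1]] := term_base_bounded.
have [M2 [HM2 H2]] := ratio_bounded g _ _ _ Hg (tends_div _ _ _ _ Ng (tends_const (a * q)) Hg) Pg.
have [M3 [HM3 H3]] := ratio_bounded h _ _ _ Hh (tends_div _ _ _ _ Nh (tends_const (a * q)) Hh) Ph.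
have HM0 : (0 <= (1 + Cmod a) / Cmod (1 - a))%R.
  apply: Rdiv_le_0_compat; first by have := Cmod_ge_0 a; lra.
  exact/Cmod_gt_0.
exists ((1 + Cmod a) / Cmod (1 - a) * M1 * M2 * M3)%R; split.
  by repeat apply: Rmult_le_pos => //.
apply: filter_imp (filter_and _ _ H2 H3) => x [H2x H3x] k.
rewrite phi_termE 4!Cmod_mult Cmod_pow; apply: Rmult_le_compat_r.
  by apply: pow_le; apply: Cmod_ge_0.
do 3 (apply: Rmult_le_compat; last by []; try exact: Cmod_ge_0;
  try by repeat apply: Rmult_le_pos; apply: Cmod_ge_0).
exact: vwp_factor_le.
Qed.

Lemma phi_is_csum (g h : C) :
  g <> 0 -> h <> 0 -> no_pole q (a * q / g) -> no_pole q (a * q / h) ->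
  is_csum (phi_term g h) (phi q a b c d e f g h).
Proof.
move=> Ng Nh Pg Ph.
have [M [HM [N HN]]] := phi_term_bounded (F := eventually) _ _ g h (tends_const g) (tends_const h)
  Ng Nh Pg Ph.
have [l Hl] := csum_geom_ex _ _ (Cmod_ge_0 q) hq1 _ (HN N (Nat.le_refl _)).
by rewrite /phi (Cseries_eq _ l).
Qed.

Lemma tends_phi {T : Type} {F : (T -> Prop) -> Prop} {FF : Filter F}
    (g h : T -> C) (g0 h0 : C) :
  tends F g g0 -> tends F h h0 -> g0 <> 0 -> h0 <> 0 ->
  no_pole q (a * q / g0) -> no_pole q (a * q / h0) ->
  tends F (fun x => phi q a b c d e f (g x) (h x)) (phi q a b c d e f g0 h0).
Proof.
move=> Hg Hh Ng Nh Pg Ph.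
have Tg : tends F (fun x => a * q / g x) (a * q / g0) by apply: tends_div Hg => //; exact: tends_const.
have Th : tends F (fun x => a * q / h x) (a * q / h0) by apply: tends_div Hh => //; exact: tends_const.
have [M [HM HF]] := phi_term_bounded g h _ _ Hg Hh Ng Nh Pg Ph.
have [M' [HM' [N HN]]] := phi_term_bounded (F := eventually) _ _ g0 h0 (tends_const g0) (tends_const h0)
  Ng Nh Pg Ph.
have Hp := Cmod_ge_0 q.
apply: (tannery (Rmax M M') _ Hp hq1 (fun x => phi_term (g x) (h x)) (phi_term g0 h0)).
- by apply: Rle_trans (Rmax_l _ _).
- move=> k; apply: (tends_ext _ _ _ (fun x => eq_sym (phi_termE (g x) (h x) k))).
  rewrite phi_termE; apply: tends_mult (tends_const _).
  apply: tends_mult; first (apply: tends_mult; first exact: tends_const).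
    by apply: tends_div; [exact: qpoch_neq_0|exact: (tends_qpoch q _ _ Hg k)|exact: (tends_qpoch q _ _ Tg k)].
  by apply: tends_div; [exact: qpoch_neq_0|exact: (tends_qpoch q _ _ Hh k)|exact: (tends_qpoch q _ _ Th k)].
- apply: filter_imp HF => x Hx k; apply: Rle_trans (Hx k) _.
  by apply: Rmult_le_compat_r (Rmax_l _ _); apply: pow_le.
- move=> k; apply: Rle_trans (HN N (Nat.le_refl _) k) _.
  by apply: Rmult_le_compat_r (Rmax_r _ _); apply: pow_le.
- have Ag := no_pole_near (FF := FF) q hq1 _ _ Tg Pg; have Ah := no_pole_near (FF := FF) q hq1 _ _ Th Ph.
  have Bg := tends_neq (FF := FF) _ _ _ Ng Hg; have Bh := tends_neq (FF := FF) _ _ _ Nh Hh.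
  apply: filter_imp (filter_and _ _ (filter_and _ _ Ag Ah) (filter_and _ _ Bg Bh)).
  by move=> x [[? ?] [? ?]]; apply: phi_is_csum.
- exact: phi_is_csum.
Qed.

(** The limit of [contig_sum], with the factors [1 - a], [1 - g / q], [1 - h / q] of its denominator
    absorbed into the infinite products. It vanishes in the terminating case [h = q^(-n)], through
    [(h)_infinity]. *)
Definition boundary (g h : C) : C :=
  qpoch_inf q (a * q) / qpoch_inf q q
  * prodl (fun x => qpoch_inf q x / qpoch_inf q (a * q / x)) xs
  * (qpoch_inf q g / qpoch_inf q (a * q ^ 2 / g))
  * (qpoch_inf q h / qpoch_inf q (a * q ^ 2 / h)).

Lemma tends_ratio_inf (y w : C) : no_pole q w ->
  tends eventually (fun k => qpoch q y k / qpoch q w k) (qpoch_inf q y / qpoch_inf q w).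
Proof.
by move=> H; apply: (tends_div (F := eventually)); [exact: (qpoch_inf_neq_0 q hq1)|exact: (tends_qpoch_inf q hq1)|exact: (tends_qpoch_inf q hq1)].
Qed.

Lemma tends_contig_sum (g h : C) :
  g <> 0 -> h <> 0 -> q - g <> 0 -> q - h <> 0 ->
  no_pole q (a * q ^ 2 / g) -> no_pole q (a * q ^ 2 / h) ->
  tends eventually (contig_sum g h) (boundary g h).
Proof.
move=> Hg Hh Hgq Hhq Pg Ph.
have Hk := geom_tends q hq1.
have Hpq (y : C) : q - y <> 0 -> 1 - y / q <> 0 by move=> H; apply/div_neq_0.
have Hl (y u : C) : tends eventually (fun k => 1 - y * q ^ k * u) 1.
  have E : 1 - y * 0 * u = 1 by ring.
  rewrite -{2}E; apply: tends_minus; first exact: tends_const.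
  by apply: tends_mult (tends_const _); apply: tends_mult Hk; apply: tends_const.
have -> : boundary g h = qpoch_inf q a / qpoch_inf q q
  * prodl (fun x => qpoch_inf q x / qpoch_inf q (a * q / x)) xs
  * (qpoch_inf q (g / q) / qpoch_inf q (a * q ^ 2 / g))
  * (qpoch_inf q (h / q) / qpoch_inf q (a * q ^ 2 / h))
  / ((1 - a) * (1 - g / q) * (1 - h / q)) * ((1 - 0) * prodl (fun _ => RtoC 1) xs * 1 * 1).
  rewrite /boundary (qpoch_inf_step q hq1 a) (qpoch_inf_step q hq1 (g / q)).
  rewrite (qpoch_inf_step q hq1 (h / q)).
  replace (g / q * q) with g by (field; done); replace (h / q * q) with h by (field; done).
  have Ng := qpoch_inf_neq_0 q hq1 _ Pg; have Nh := qpoch_inf_neq_0 q hq1 _ Ph.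
  have Nq := qpoch_inf_neq_0 q hq1 _ no_pole_q.
  move: (Hpq g Hgq) (Hpq h Hhq); rewrite [prodl (fun _ => RtoC 1) xs]/=.
  move: (prodl _ _) (qpoch_inf q (a * q ^ 2 / g)) Ng (qpoch_inf q (a * q ^ 2 / h)) Nh.
  move=> P G Ng H Nh; move: (1 - g / q) (1 - h / q) => u v Hu Hv.
  by field.
apply: tends_mult; first (apply: tends_mult; last exact: tends_const).
- apply: tends_mult; last exact: tends_ratio_inf.
  apply: tends_mult; last exact: tends_ratio_inf.
  apply: tends_mult; first by apply: tends_ratio_inf; apply: no_pole_q.
  apply: (tends_prodl (fun x k => qpoch q x k / qpoch q (a * q / x) k)).
  by apply: List.Forall_impl hpole => x; apply: tends_ratio_inf.
- apply: tends_mult; last first.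
    by apply: tends_ext (Hl (a * q) (/ h)) => k; rewrite /Cdiv; ring.
  apply: tends_mult; last first.
    by apply: tends_ext (Hl (a * q) (/ g)) => k; rewrite /Cdiv; ring.
  apply: tends_mult; first by apply: tends_minus => //; apply: tends_const.
  apply: (tends_prodl (fun x k => 1 - a * q ^ k / x)).
  apply/List.Forall_forall => x _.
  by apply: tends_ext (Hl a (/ x)) => k; rewrite /Cdiv; ring.
Qed.

Lemma contig_relation (g h : C) :
  b * c * d * e * f * g * h = a ^ 3 * q ^ 2 -> contig_generic g h ->
  contig_coef q a xs g h * (phi q a b c d e f (g * q) (h / q) - phi q a b c d e f g h)
  + contig_coef q a xs h g * (phi q a b c d e f (g / q) (h * q) - phi q a b c d e f g h)
  + prodl (fun x => 1 - x) xs * phi q a b c d e f g h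
  = boundary g h.
Proof.
move=> Hbal Hgen.
have [[Hg [Hh [Hg1 [Hh1 [Hgq Hhq]]]]] [_ [Pg Ph]]] := Hgen.
have [Pg1 Pg2] := pole_shift g Hg Pg; have [Ph1 Ph2] := pole_shift h Hh Ph.
have Eg : a * q / (g * q) = a / g by field.
have Eh : a * q / (h * q) = a / h by field.
have Eg' : a * q / (g / q) = a * q ^ 2 / g by rewrite /=; field.
have Eh' : a * q / (h / q) = a * q ^ 2 / h by rewrite /=; field.
have Nq (y : C) : y <> 0 -> y / q <> 0.
  by move=> Hy; apply: Cdiv_neq_0.
have Nq' (y : C) : y <> 0 -> y * q <> 0 by move=> Hy; apply: Cmult_neq_0.
have S0 := phi_is_csum g h Hg Hh Pg1 Ph1.
have S1 : is_csum (phi_term (g * q) (h / q)) (phi q a b c d e f (g * q) (h / q)).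
  by apply: phi_is_csum; rewrite ?Eg ?Eh' //; [exact: Nq'|exact: Nq].
have S2 : is_csum (phi_term (g / q) (h * q)) (phi q a b c d e f (g / q) (h * q)).
  by apply: phi_is_csum; rewrite ?Eg' ?Eh //; [exact: Nq|exact: Nq'].
apply: (tends_unique (F := eventually) (fun n => contig_sum g h n)); last exact: tends_contig_sum.
apply: (tends_ext (fun n =>
  contig_coef q a xs g h * (csum (phi_term (g * q) (h / q)) n - csum (phi_term g h) n)
  + contig_coef q a xs h g * (csum (phi_term (g / q) (h * q)) n - csum (phi_term g h) n)
  + prodl (fun x => 1 - x) xs * csum (phi_term g h) n)).
- move=> n; have Z : contig_sum g h 0 = 0 by rewrite /contig_sum [q ^ 0]/= /Cdiv; ring.
  replace (contig_sum g h n) with (contig_sum g h n - contig_sum g h 0) by (rewrite Z; ring).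
  rewrite -csum_telescope; have Ht k := contig_term g h k Hbal Hgen; move: (prodl _ xs) Ht => R Ht.
  elim: n => [|n IH] /=; first by ring.
  by rewrite -IH -Ht; ring.
- apply: tends_plus; first apply: tends_plus.
  + by apply: tends_mult; [exact: tends_const|exact: tends_minus].
  + by apply: tends_mult; [exact: tends_const|exact: tends_minus].
  + by apply: tends_mult; [exact: tends_const|].
Qed.
End Series.

(** * Power series *)

Fixpoint rsum (u : nat -> R) (n : nat) : R :=
  match n with O => 0%R | S k => (rsum u k + u k)%R end.

Lemma rsum_ge_0 (u : nat -> R) (n : nat) : (forall k, 0 <= u k)%R -> (0 <= rsum u n)%R.
Proof. by move=> H; elim: n => [|n IH] /=; [|have := H n]; lra. Qed.

Lemma rsum_le (u v : nat -> R) (n : nat) :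
  (forall k, (k < n)%nat -> (u k <= v k)%R) -> (rsum u n <= rsum v n)%R.
Proof.
elim: n => [|n IH] H /=; first lra.
have := IH (fun k Hk => H k ltac:(lia)); have := H n ltac:(lia); lra.
Qed.

Lemma rsum_mono (u : nat -> R) (n m : nat) :
  (forall k, 0 <= u k)%R -> (n <= m)%nat -> (rsum u n <= rsum u m)%R.
Proof. by move=> H; elim=> [|m' _ IH] /=; [|have := H m']; lra. Qed.

Lemma rsum_scal (c : R) (u : nat -> R) (n : nat) :
  rsum (fun k => c * u k)%R n = (c * rsum u n)%R.
Proof. by elim: n => [|n IH] /=; rewrite ?IH; ring. Qed.

Lemma rsum_plus (u v : nat -> R) (n : nat) :
  rsum (fun k => u k + v k)%R n = (rsum u n + rsum v n)%R.
Proof. by elim: n => [|n IH] /=; rewrite ?IH; ring. Qed.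

Lemma rsum_finite (u : nat -> R) (N n : nat) :
  (forall k, 0 <= u k)%R -> (forall k, (N <= k)%nat -> u k = 0%R) -> (rsum u n <= rsum u N)%R.
Proof.
move=> H0 H; elim: n => [|n IH]; first by apply: rsum_ge_0.
have [Hle|Hlt] := Nat.le_gt_cases N n; last by apply: rsum_mono.
by rewrite /= H //; lra.
Qed.

Lemma Cmod_csum_le (u : nat -> C) (n : nat) :
  (Cmod (csum u n) <= rsum (fun k => Cmod (u k)) n)%R.
Proof.
elim: n => [|n IH] /=; first by rewrite Cmod_0; lra.
by have := Cmod_triangle (csum u n) (u n); lra.
Qed.

Section BoundedSums.
Variables (u : nat -> R) (B : R).
Hypotheses (Hu : forall k, (0 <= u k)%R) (HB : forall n, (rsum u n <= B)%R).

Lemma rsum_sum_n (n : nat) : sum_n u n = rsum u (S n).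
Proof.
elim: n => [|n IH]; first by rewrite sum_O /=; ring.
by rewrite sum_Sn IH.
Qed.

Lemma ex_series_bounded : ex_series u.
Proof.
have [l Hl] : ex_finite_lim_seq (sum_n u).
  apply: (ex_finite_lim_seq_incr _ B) => n; rewrite !rsum_sum_n; last exact: HB.
  by have := Hu (S n); rewrite /=; lra.
by exists l.
Qed.

Lemma rsum_tail (eps : R) : (0 < eps)%R ->
  exists N, forall n m, (N <= n)%nat -> (n <= m)%nat -> (rsum u m - rsum u n <= eps)%R.
Proof.
move=> He; have [l Hl] := ex_series_bounded.
have He2 : (0 < eps / 2)%R by lra.
move/filterlim_locally: Hl => /(_ (mkposreal _ He2)) [N HN].
exists (S N) => -[|n] [|m] Hn Hm; try lia.
have := HN n ltac:(lia); have := HN m ltac:(lia).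
rewrite !rsum_sum_n /ball /= /AbsRing_ball /abs /minus /plus /opp /=.
by move=> /Rabs_def2 H1 /Rabs_def2 H2; lra.
Qed.

Lemma csum_bounded_ex (w : nat -> C) :
  (forall k, (Cmod (w k) <= u k)%R) -> exists l, is_csum w l.
Proof. by move=> Hw; apply: csum_dom_ex Hw ex_series_bounded. Qed.
End BoundedSums.

Lemma csum_minus_le (w : nat -> C) (n m : nat) : (n <= m)%nat ->
  (Cmod (csum w m - csum w n) <=
   rsum (fun k => Cmod (w k)) m - rsum (fun k => Cmod (w k)) n)%R.
Proof.
elim=> [|m' Hm IH] /=.
  by rewrite /Cminus Cplus_opp_r Cmod_0; lra.
have := Cmod_triangle (csum w m' - csum w n) (w m').
replace (csum w m' - csum w n + w m') with (csum w m' + w m' - csum w n) by ring; lra.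
Qed.

Lemma is_csum_le (w : nat -> C) (l : C) (B : R) :
  (forall n, (rsum (fun k => Cmod (w k)) n <= B)%R) -> is_csum w l -> (Cmod l <= B)%R.
Proof.
move=> HB Hl; apply: le_epsilon => eps He; have [N HN] := Hl _ He.
have := HN N (Nat.le_refl _); have := Cmod_sub_ge l (csum w N); rewrite Cmod_sub_sym.
by have := Cmod_csum_le w N; have := HB N; lra.
Qed.

Lemma is_csum_tail_le (w : nat -> C) (l : C) (n : nat) (eps : R) :
  (forall m, (n <= m)%nat ->
    (rsum (fun k => Cmod (w k)) m - rsum (fun k => Cmod (w k)) n <= eps)%R) ->
  is_csum w l -> (Cmod (l - csum w n) <= eps)%R.
Proof.
move=> HB Hl; apply: le_epsilon => e He; have [N HN] := Hl _ He.
have H1 := HN (Nat.max n N) ltac:(lia).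
have H2 := csum_minus_le w n (Nat.max n N) ltac:(lia).
have H3 := HB (Nat.max n N) ltac:(lia).
have := Cmod_triangle (l - csum w (Nat.max n N)) (csum w (Nat.max n N) - csum w n).
rewrite (Cmod_sub_sym l (csum w (Nat.max n N))).
replace (l - csum w (Nat.max n N) + (csum w (Nat.max n N) - csum w n)) with (l - csum w n) by ring.
lra.
Qed.

Definition cauchy_prod (u v : nat -> C) (n : nat) : C :=
  csum (fun i => u i * v (n - i)%nat) (S n).

Lemma csum_cauchy_prod (u v : nat -> C) (n : nat) :
  csum (cauchy_prod u v) n = csum (fun i => u i * csum v (n - i)) n.
Proof.
elim: n => [//|n IH].
rewrite [csum (cauchy_prod u v) (S n)]/= IH /cauchy_prod.
rewrite [csum (fun i => u i * csum v (S n - i)) (S n)](csum_ext _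
  (fun i => u i * csum v (n - i) + u i * v (n - i)%nat)); last first.
  by move=> k Hk; replace (S n - k)%nat with (S (n - k)) by lia; rewrite /=; ring.
by rewrite csum_plus /= Nat.sub_diag /=; ring.
Qed.

(** The convolution is split at an index [m] beyond which the [|u_i|] have a small sum: before it
    [w (n - i)] is small for large [n], after it [w] is merely bounded by [W]. *)
Lemma conv_null (u w : nat -> C) (A W : R) :
  (forall n, (rsum (fun k => Cmod (u k)) n <= A)%R) ->
  (forall n, (Cmod (w n) <= W)%R) -> tends eventually w 0 ->
  tends eventually (fun n => csum (fun i => u i * w (n - i)%nat) n) 0.
Proof.
move=> HA HW Hw eps He.
have HA0 : (0 <= A)%R by have := HA 0%nat.
have HW0 : (0 <= W)%R by apply: Rle_trans (Cmod_ge_0 _) (HW 0%nat).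
pose e1 := (eps / 4 / (A + W + 1))%R.
have He1 : (0 < e1)%R by apply: Rdiv_lt_0_compat; lra.
have [m Hm] := rsum_tail _ A (fun k => Cmod_ge_0 (u k)) HA _ He1.
have [N HN] := Hw _ He1.
exists (m + N)%nat => n Hn.
replace (csum (fun i => u i * w (n - i)%nat) n - 0) with (csum (fun i => u i * w (n - i)%nat) n) by ring.
apply: Rle_lt_trans (Cmod_csum_le _ _) _.
have H : forall j, (j <= n)%nat -> (rsum (fun k => Cmod (u k * w (n - k)%nat)) j
    <= e1 * rsum (fun k => Cmod (u k)) j +
       W * (rsum (fun k => Cmod (u k)) j - rsum (fun k => Cmod (u k)) (Nat.min j m)))%R.
  elim=> [|j IH] Hj; first by rewrite /=; lra.
  have IH' := IH ltac:(lia); have Hu := Cmod_ge_0 (u j).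
  have [Hlt|Hge] := Nat.lt_ge_cases j m.
  - move: IH'; have -> : Nat.min (S j) m = S j by lia.
    have -> : Nat.min j m = j by lia.
    have := HN (n - j)%nat ltac:(lia).
    replace (w (n - j)%nat - 0) with (w (n - j)%nat) by ring; move=> /= Hlt' IH'.
    have := Rmult_le_compat_l _ _ _ Hu (Rlt_le _ _ Hlt'); rewrite Cmod_mult; lra.
  - move: IH'; have -> : Nat.min (S j) m = m by lia.
    have -> : Nat.min j m = m by lia.
    have := Rmult_le_compat_l _ _ _ Hu (HW (n - j)%nat).
    have := Rmult_le_pos _ _ (Rlt_le _ _ He1) Hu; rewrite /= Cmod_mult; lra.
apply: Rle_lt_trans (H n (Nat.le_refl _)) _.
have -> : Nat.min n m = m by lia.
have H1 := Hm m n ltac:(lia) ltac:(lia).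
have H2 := Rmult_le_compat_l _ _ _ (Rlt_le _ _ He1) (HA n).
have H3 := Rmult_le_compat_l _ _ _ HW0 H1.
have H4 : (e1 * (A + W + 1) = eps / 4)%R by rewrite /e1; field; lra.
lra.
Qed.

(** Mertens' argument: a partial sum of the product is [csum u n * V] plus the convolution of [u]
    with the null sequence [csum v - V]. *)
Lemma is_csum_cauchy (u v : nat -> C) (A B : R) (U V : C) :
  (forall n, (rsum (fun k => Cmod (u k)) n <= A)%R) ->
  (forall n, (rsum (fun k => Cmod (v k)) n <= B)%R) ->
  is_csum u U -> is_csum v V -> is_csum (cauchy_prod u v) (U * V).
Proof.
move=> HA HB HU HV; rewrite /is_csum.
apply: (tends_ext (fun n => csum u n * V + csum (fun i => u i * (csum v (n - i)%nat - V)) n)).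
  move=> n; rewrite csum_cauchy_prod.
  elim: {1 3 5}n => [|k IH] /=; first by ring.
  by rewrite -IH; ring.
replace (U * V) with (U * V + 0) by ring; apply: tends_plus.
  by apply: tends_mult HU _; apply: tends_const.
apply: (conv_null u (fun n => csum v n - V) A (B + B)) => //.
- move=> n; apply: Rle_trans (Cmod_triangle _ _) _; rewrite Cmod_opp.
  by have := Cmod_csum_le v n; have := HB n; have := is_csum_le _ _ _ HB HV; lra.
- exact: (proj1 (tends_sub_0 _ _)).
Qed.

Lemma rsum_cauchy_le (u v : nat -> C) (n : nat) :
  (rsum (fun k => Cmod (cauchy_prod u v k)) n <=
   rsum (fun k => Cmod (u k)) n * rsum (fun k => Cmod (v k)) n)%R.
Proof.
have Hpos : forall w : nat -> C, forall k, (0 <= Cmod (w k))%R by move=> w k; apply: Cmod_ge_0.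
have H : forall m, (rsum (fun k => Cmod (cauchy_prod u v k)) m <=
    rsum (fun i => Cmod (u i) * rsum (fun k => Cmod (v k)) (m - i))%R m)%R.
  elim=> [|m IH]; first by right.
  rewrite [rsum (fun k => Cmod (cauchy_prod u v k)) (S m)]/=.
  have -> : rsum (fun i => Cmod (u i) * rsum (fun k => Cmod (v k)) (S m - i))%R (S m) =
      (rsum (fun i => Cmod (u i) * rsum (fun k => Cmod (v k)) (m - i))%R m +
       rsum (fun i => Cmod (u i) * Cmod (v (m - i)%nat))%R (S m))%R.
    have -> : rsum (fun i => Cmod (u i) * rsum (fun k => Cmod (v k)) (m - i))%R m =
        rsum (fun i => Cmod (u i) * rsum (fun k => Cmod (v k)) (m - i))%R (S m).
      by rewrite /= Nat.sub_diag /=; ring.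
    rewrite -rsum_plus; have E (x y : nat -> R) j :
        (forall k, (k < j)%nat -> x k = y k) -> rsum x j = rsum y j.
      elim: j => [//|j IHj] Hj /=; rewrite (Hj j) ?IHj //.
      by move=> k Hk; apply: Hj; lia.
    apply: E => k Hk; replace (S m - k)%nat with (S (m - k)) by lia.
    by rewrite /=; ring.
  apply: Rplus_le_compat => //.
  apply: Rle_trans (Cmod_csum_le _ _) _.
  by apply: rsum_le => k _; rewrite Cmod_mult; right.
apply: Rle_trans (H n) _; rewrite Rmult_comm -rsum_scal.
apply: rsum_le => k Hk; rewrite Rmult_comm; apply: Rmult_le_compat_r; first exact: Cmod_ge_0.
by apply: rsum_mono; [exact: Hpos|lia].
Qed.

(* [f] is a power series on the disk of radius [r], with sum of [|u_j| r^j] at most [M]: these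
   functions form a Banach algebra. *)
Definition psb (r M : R) (f : C -> C) : Prop :=
  exists u : nat -> C,
    (forall n, (rsum (fun j => Cmod (u j) * r ^ j) n <= M)%R) /\
    forall t, (Cmod t <= r)%R -> is_csum (fun j => u j * t ^ j) (f t).

Section PowerSeries.
Variable r : R.
Hypothesis Hr : (0 < r)%R.

Lemma psb_term_le (u : nat -> C) (M : R) (t : C) (n : nat) :
  (forall n, (rsum (fun j => Cmod (u j) * r ^ j) n <= M)%R) -> (Cmod t <= r)%R ->
  (rsum (fun j => Cmod (u j * t ^ j)) n <= M)%R.
Proof.
move=> Hu Ht; apply: Rle_trans (Hu n); apply: rsum_le => k _.
rewrite Cmod_mult Cmod_pow; apply: Rmult_le_compat_l; first exact: Cmod_ge_0.
by apply: pow_incr; split=> //; apply: Cmod_ge_0.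
Qed.

Lemma psb_le (M : R) (f : C -> C) (t : C) :
  psb r M f -> (Cmod t <= r)%R -> (Cmod (f t) <= M)%R.
Proof.
move=> [u [Hu Hf]] Ht; apply: is_csum_le (Hf t Ht) => n; exact: psb_term_le.
Qed.

Lemma psb_ge_0 (M : R) (f : C -> C) : psb r M f -> (0 <= M)%R.
Proof. by move=> [u [Hu _]]; apply: (Hu 0%nat). Qed.

Lemma psb_ext (M : R) (f g : C -> C) :
  (forall t, (Cmod t <= r)%R -> f t = g t) -> psb r M f -> psb r M g.
Proof. by move=> E [u [Hu Hf]]; exists u; split=> // t Ht; rewrite -E //; apply: Hf. Qed.

Lemma psb_weaken (M M' : R) (f : C -> C) : (M <= M')%R -> psb r M f -> psb r M' f.
Proof. by move=> HM [u [Hu Hf]]; exists u; split=> // n; apply: Rle_trans (Hu n) HM. Qed.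

Lemma psb_shrink (r' M : R) (f : C -> C) : (0 <= r' <= r)%R -> psb r M f -> psb r' M f.
Proof.
move=> Hr' [u [Hu Hf]]; exists u; split=> [n|t Ht]; last by apply: Hf; lra.
apply: Rle_trans (Hu n); apply: rsum_le => k _.
by apply: Rmult_le_compat_l (Cmod_ge_0 _) _; apply: pow_incr.
Qed.

Lemma psb_const (c : C) : psb r (Cmod c) (fun _ => c).
Proof.
exists (fun j => match j return C with O => c | S _ => 0 end); split=> [n|t _].
  apply: Rle_trans (rsum_finite _ 1 n _ _) _ => [k|[|k] Hk|].
  - by apply: Rmult_le_pos; [exact: Cmod_ge_0|apply: pow_le; lra].
  - lia.
  - by rewrite Cmod_0; ring.
  - by rewrite /=; lra.
have {2}-> : c = csum (fun j => match j return C with O => c | S _ => 0 end * t ^ j) 1 by rewrite /=; ring.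
by apply: csum_finite => -[|k] Hk; [lia|ring].
Qed.

Lemma psb_id : psb r r (fun t => t).
Proof.
exists (fun j => match j return C with S O => 1 | _ => 0 end); split=> [n|t _].
  apply: Rle_trans (rsum_finite _ 2 n _ _) _ => [k|[|[|k]] Hk|]; try lia.
  - by apply: Rmult_le_pos; [exact: Cmod_ge_0|apply: pow_le; lra].
  - by rewrite Cmod_0; ring.
  - by rewrite /= Cmod_0 Cmod_1; lra.
have {2}-> : t = csum (fun j => match j return C with S O => 1 | _ => 0 end * t ^ j) 2 by rewrite /=; ring.
by apply: csum_finite => -[|[|k]] Hk; [lia|lia|ring].
Qed.

Lemma psb_plus (M N : R) (f g : C -> C) :
  psb r M f -> psb r N g -> psb r (M + N) (fun t => f t + g t).
Proof.
move=> [u [Hu Hf]] [v [Hv Hg]]; exists (fun j => u j + v j); split=> [n|t Ht].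
  apply: Rle_trans (Rplus_le_compat _ _ _ _ (Hu n) (Hv n)); rewrite -rsum_plus.
  apply: rsum_le => k _; rewrite -Rmult_plus_distr_r.
  by apply: Rmult_le_compat_r (Cmod_triangle _ _); apply: pow_le; lra.
apply: (tends_ext (fun n => csum (fun j => u j * t ^ j) n + csum (fun j => v j * t ^ j) n)).
  by move=> n; rewrite -csum_plus; apply: csum_ext => k _; ring.
by apply: tends_plus; [exact: Hf|exact: Hg].
Qed.

Lemma cauchy_prod_pow (u v : nat -> C) (t : C) (n : nat) :
  cauchy_prod u v n * t ^ n = cauchy_prod (fun j => u j * t ^ j) (fun j => v j * t ^ j) n.
Proof.
rewrite /cauchy_prod Cmult_comm -csum_scal; apply: csum_ext => k Hk.
have {1}-> : n = (k + (n - k))%nat by lia.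
by rewrite Cpow_add_r; ring.
Qed.

Lemma psb_mult (M N : R) (f g : C -> C) :
  psb r M f -> psb r N g -> psb r (M * N) (fun t => f t * g t).
Proof.
move=> [u [Hu Hf]] [v [Hv Hg]]; exists (cauchy_prod u v); split=> [n|t Ht].
  have E (w : nat -> C) m : rsum (fun j => Cmod (w j) * r ^ j)%R m =
      rsum (fun j => Cmod (w j * RtoC r ^ j)) m.
    elim: m => [//|m IH] /=; rewrite IH Cmod_mult Cmod_pow Cmod_R Rabs_pos_eq //; lra.
  rewrite E; have -> : (fun j => Cmod (cauchy_prod u v j * RtoC r ^ j)) =
      (fun j => Cmod (cauchy_prod (fun j => u j * RtoC r ^ j) (fun j => v j * RtoC r ^ j) j)).
    by apply: functional_extensionality => j; rewrite cauchy_prod_pow.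
  apply: Rle_trans (rsum_cauchy_le _ _ _) _; rewrite -!E.
  by apply: Rmult_le_compat => //; apply: rsum_ge_0 => k;
    apply: Rmult_le_pos; [exact: Cmod_ge_0|apply: pow_le; lra|exact: Cmod_ge_0|apply: pow_le; lra].
apply: (tends_ext (csum (cauchy_prod (fun j => u j * t ^ j) (fun j => v j * t ^ j)))).
  by move=> n; apply: csum_ext => k _; rewrite cauchy_prod_pow.
apply: (is_csum_cauchy _ _ M N) (Hf t Ht) (Hg t Ht) => n; exact: psb_term_le.
Qed.

(** Completeness of the algebra. The coefficients of the sum are the sums of the coefficients;
    remainders are estimated in norm through finitely many coefficients at a time, and this also
    justifies the interchange of the two summations. *)
Lemma psb_sum (f : nat -> C -> C) (M : nat -> R) (B : R) :
  (forall k, psb r (M k) (f k)) -> (forall n, (rsum M n <= B)%R) ->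
  exists F, psb r B F /\ forall t, (Cmod t <= r)%R -> is_csum (fun k => f k t) (F t).
Proof.
move=> Hf HB.
have HM k : (0 <= M k)%R := psb_ge_0 _ _ (Hf k).
have [U HU] := ClassicalChoice.choice _ Hf.
have HF t : exists l, (Cmod t <= r)%R -> is_csum (fun k => f k t) l.
  have [Ht|Ht] := Rle_dec (Cmod t) r; last by exists 0.
  have [l Hl] := csum_bounded_ex M B HM HB (fun k => f k t) (fun k => psb_le _ _ _ (Hf k) Ht).
  by exists l.
have [F HF'] := ClassicalChoice.choice _ HF.
have Hcoef k j : (Cmod (U k j) * r ^ j <= M k)%R.
  apply: Rle_trans (proj1 (HU k) (S j)) => /=.
  suff : (0 <= rsum (fun j => Cmod (U k j) * r ^ j) j)%R by lra.
  by apply: rsum_ge_0 => i; apply: Rmult_le_pos; [exact: Cmod_ge_0|apply: pow_le; lra].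
have HV j : exists l, is_csum (fun k => U k j) l.
  have Hrj : (0 < r ^ j)%R by apply: pow_lt.
  apply: (csum_bounded_ex (fun k => / r ^ j * M k)%R (/ r ^ j * B)) => [k|n|k].
  - by apply: Rmult_le_pos => //; apply: Rlt_le; apply: Rinv_0_lt_compat.
  - rewrite rsum_scal; apply: Rmult_le_compat_l => //.
    by apply: Rlt_le; apply: Rinv_0_lt_compat.
  - by rewrite Rmult_comm; apply/Rle_div_r.
have [V HV'] := ClassicalChoice.choice _ HV.
exists F; split=> //; exists V.
(* The norm of the remainder after [n] functions is at most the tail of the [M k]: this is clear for
   the difference of the partial sums at [m] and [n], and [m] may go to infinity in any finite
   number [J] of coefficients. *)
have Htail n tau : (forall m, (n <= m)%nat -> (rsum M m - rsum M n <= tau)%R) ->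
    forall J, (rsum (fun j => Cmod (V j - csum (fun k => U k j) n) * r ^ j) J <= tau)%R.
  move=> Htau J; apply: le_epsilon => eps He.
  pose D m j := Cmod (csum (fun k => U k j) m - csum (fun k => U k j) n).
  have HT : tends eventually (fun m => RtoC (rsum (fun j => D m j * r ^ j)%R J))
     (RtoC (rsum (fun j => Cmod (V j - csum (fun k => U k j) n) * r ^ j)%R J)).
    elim: J => [|J IH]; first by move=> /=; apply: tends_const.
    rewrite [rsum _ (S J)]/= RtoC_plus RtoC_mult.
    apply: (tends_ext (fun m => RtoC (rsum (fun j => D m j * r ^ j)%R J) + RtoC (D m J) * RtoC (r ^ J))).
      by move=> m; rewrite /= RtoC_plus RtoC_mult.
    apply: tends_plus IH _; apply: tends_mult (tends_const _).
    move=> e0 He0; have [N HN] := HV' J e0 He0; exists N => m Hm.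
    apply: Rle_lt_trans (HN m Hm); rewrite -RtoC_minus Cmod_R /D.
    set X := csum _ m; set Y := csum _ n.
    have H1 := Cmod_sub_ge (X - Y) (V J - Y); have H2 := Cmod_sub_ge (V J - Y) (X - Y).
    move: H1 H2.
    replace (X - Y - (V J - Y)) with (X - V J) by ring.
    replace (V J - Y - (X - Y)) with (V J - X) by ring.
    by rewrite (Cmod_sub_sym (V J) X) => H1 H2; apply: Rabs_le; lra.
  have [N HN] := HT _ He.
  have := HN (Nat.max N n) ltac:(lia); rewrite -RtoC_minus Cmod_R => /Rabs_def2 [_ H].
  suff Hm : forall m, (n <= m)%nat -> (rsum (fun j => D m j * r ^ j) J <= rsum M m - rsum M n)%R.
    by have := Hm (Nat.max N n) ltac:(lia); have := Htau (Nat.max N n) ltac:(lia); lra.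
  move=> m Hnm; have H0 j : (0 <= r ^ j)%R by apply: pow_le; lra.
  apply: (Rle_trans _ (rsum (fun j => r ^ j * (rsum (fun k => Cmod (U k j)) m - rsum (fun k => Cmod (U k j)) n))%R J)).
    apply: rsum_le => j _; rewrite Rmult_comm; apply: Rmult_le_compat_l => //.
    exact: csum_minus_le.
  elim: m / Hnm => [|m Hnm IH].
    rewrite (_ : (fun j => _) = (fun j => 0 * 0)%R); last by apply: functional_extensionality => j; ring.
    by rewrite rsum_scal; lra.
  apply: (Rle_trans _ (rsum (fun j => r ^ j * (rsum (fun k => Cmod (U k j)) m - rsum (fun k => Cmod (U k j)) n))%R J + rsum (fun j => Cmod (U m j) * r ^ j)%R J)).
    by rewrite -rsum_plus; right; congr rsum; apply: functional_extensionality => j /=; ring.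
  by have := proj1 (HU m) J; rewrite /=; lra.
split=> [J|t Ht].
  have := Htail 0%nat B _ J; rewrite (_ : (fun j => _) = (fun j => Cmod (V j) * r ^ j)%R); last first.
    by apply: functional_extensionality => j /=; congr (Cmod _ * _)%R; ring.
  by apply=> m _ /=; have := HB m; lra.
have Hfin n : is_csum (fun j => csum (fun k => U k j) n * t ^ j) (csum (fun k => f k t) n).
  elim: n => [|n IH].
    apply: (tends_ext (fun _ => RtoC 0)); last exact: tends_const.
    by elim=> [//|m IH] /=; rewrite -IH; ring.
  apply: (tends_ext (fun m => csum (fun j => csum (fun k => U k j) n * t ^ j) m
    + csum (fun j => U n j * t ^ j) m)).
    by move=> m; rewrite -csum_plus; apply: csum_ext => k _ /=; ring.
  by apply: tends_plus IH _; apply: (proj2 (HU n)).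
move=> eps He; have He3 : (0 < eps / 4)%R by lra.
have [n Hn] := rsum_tail M B HM HB _ He3.
have Hn' m : (n <= m)%nat -> (rsum M m - rsum M n <= eps / 4)%R by move=> Hm; apply: Hn.
have H3 : (Cmod (F t - csum (fun k => f k t) n) <= eps / 4)%R.
  apply: is_csum_tail_le (HF' t Ht) => m Hm; apply: Rle_trans (Hn' m Hm).
  elim: m / Hm => [|m Hm IH] /=; first lra.
  by have := psb_le _ _ _ (Hf m) Ht; lra.
have [N HN] := Hfin n _ He3; exists N => J HJ.
have H2 := HN J HJ.
have H1 : (Cmod (csum (fun j => V j * t ^ j)%C J - csum (fun j => csum (fun k => U k j) n * t ^ j)%C J)%C <= eps / 4)%R.
  rewrite (_ : _ - _ = csum (fun j => (V j - csum (fun k => U k j) n) * t ^ j) J).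
    apply: Rle_trans (Cmod_csum_le _ _) _; apply: Rle_trans (Htail n _ Hn' J).
    apply: rsum_le => k _; rewrite Cmod_mult Cmod_pow; apply: Rmult_le_compat_l (Cmod_ge_0 _) _.
    by apply: pow_incr; split=> //; apply: Cmod_ge_0.
  by elim: J {HJ H2} => [|J IH] /=; [ring|rewrite -IH; ring].
move: H1 H2; set A := csum _ J; set A' := csum _ J; set A'' := csum _ n in H3 * => H1 H2.
have := Cmod_triangle (A - A') (A' - A''); have := Cmod_triangle (A - A'') (A'' - F t).
replace (A - A'' + (A'' - F t)) with (A - F t) by ring.
replace (A - A' + (A' - A'')) with (A - A'') by ring.
rewrite (Cmod_sub_sym A'' (F t)); lra.
Qed.
End PowerSeries.

Lemma csum_pow (x : C) (n : nat) : (1 - x) * csum (fun k => x ^ k) n = 1 - x ^ n.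
Proof.
elim: n => [|n IH] /=; first by ring.
by rewrite Cmult_plus_distr_l IH; ring.
Qed.

Lemma is_csum_pow (x : C) : (Cmod x < 1)%R -> is_csum (fun k => x ^ k) (/ (1 - x)).
Proof.
move=> Hx; have H : 1 - x <> 0.
  apply/one_minus_neq_0 => E; move: Hx; rewrite E Cmod_1; lra.
apply: (tends_ext (fun n => (1 - x ^ n) / (1 - x))).
  by move=> n; rewrite -csum_pow; field.
replace (/ (1 - x)) with ((1 - 0) / (1 - x)) by (field; done).
apply: tends_mult (tends_const _).
by apply: tends_minus (geom_tends _ Hx); apply: tends_const.
Qed.

Lemma rsum_geom_le (x : R) (n : nat) : (0 <= x < 1)%R -> (rsum (fun k => x ^ k) n <= / (1 - x))%R.
Proof.
move=> Hx; have E : (rsum (fun k => x ^ k) n = (1 - x ^ n) / (1 - x))%R.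
  by elim: n => [|n IH] /=; [field; lra|rewrite IH; field; lra].
rewrite E /Rdiv -{2}(Rmult_1_l (/ (1 - x))); apply: Rmult_le_compat_r.
  by apply: Rlt_le; apply: Rinv_0_lt_compat; lra.
by have := pow_le x n; lra.
Qed.

(** * Inversion, identity theorem and recurrences for power series *)

Section Inverse.
Variable r : R.
Hypothesis Hr : (0 < r)%R.

Lemma psb_scal (c : C) (M : R) (f : C -> C) : psb r M f -> psb r (Cmod c * M) (fun t => c * f t).
Proof. by apply: psb_mult => //; apply: psb_const. Qed.

Lemma psb_minus (M N : R) (f g : C -> C) :
  psb r M f -> psb r N g -> psb r (M + N) (fun t => f t - g t).
Proof.
move=> Hf Hg; apply: psb_plus => //.
apply: (psb_ext _ _ (fun t => - (1) * g t)); first by move=> t _; ring.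
apply: (psb_weaken _ (Cmod (- (1)) * N)); first by rewrite Cmod_m1; lra.
exact: psb_scal.
Qed.

Lemma psb_pow (M : R) (f : C -> C) (k : nat) : psb r M f -> psb r (M ^ k) (fun t => f t ^ k).
Proof.
move=> Hf; elim: k => [|k IH] /=; first by rewrite -{1}Cmod_1; apply: psb_const.
exact: psb_mult.
Qed.

(** Summation of the Neumann series of [h]. *)
Lemma psb_inv_1m (th : R) (h : C -> C) :
  (th < 1)%R -> psb r th h -> psb r (/ (1 - th)) (fun t => / (1 - h t)).
Proof.
move=> Hth Hh; have Hth0 := psb_ge_0 _ _ _ Hh.
have [F [HF Hs]] := psb_sum r Hr (fun k t => h t ^ k) (fun k => th ^ k)%R (/ (1 - th))
  (fun k => psb_pow _ _ k Hh) (fun n => rsum_geom_le th n (conj Hth0 Hth)).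
apply: psb_ext HF => t Ht.
apply: tends_unique (Hs t Ht) (is_csum_pow _ _).
by apply: Rle_lt_trans (psb_le _ _ _ _ Hh Ht) Hth.
Qed.

Lemma psb_coef0 (u : nat -> C) (f : C -> C) :
  (forall t, (Cmod t <= r)%R -> is_csum (fun j => u j * t ^ j) (f t)) -> u 0%nat = f 0.
Proof.
move=> Hf; have H0 := Hf 0 ltac:(by rewrite Cmod_0; lra).
apply: tends_unique H0; replace (u 0%nat) with (csum (fun j => u j * 0 ^ j) 1) by (rewrite /=; ring).
by apply: csum_finite => -[|k] Hk; [lia|rewrite /=; ring].
Qed.

(** Without constant term, every term of the norm gains at least a factor [r' / r], as in Schwarz's
    lemma. Shrinking the disk thus makes the norm as small as desired. *)
Lemma psb_vanish (r' M : R) (h : C -> C) :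
  psb r M h -> h 0 = 0 -> (0 < r' <= r)%R -> psb r' (r' / r * M) h.
Proof.
move=> [u [Hu Hh]] H0 Hr'; exists u; split=> [n|t Ht]; last by apply: Hh; lra.
have Hq : (0 < r' / r)%R by apply: Rdiv_lt_0_compat; lra.
apply: (Rle_trans _ (r' / r * rsum (fun j => Cmod (u j) * r ^ j) n)%R); last first.
  by apply: Rmult_le_compat_l => //; lra.
rewrite -rsum_scal; apply: rsum_le => -[|k] _.
  by rewrite (psb_coef0 u h Hh) H0 Cmod_0; lra.
have Hc := Cmod_ge_0 (u (S k)).
have H1 : (r' ^ k <= r ^ k)%R by apply: pow_incr; lra.
rewrite /=; replace (r' / r * (Cmod (u (S k)) * (r * r ^ k)))%R with (r' * Cmod (u (S k)) * r ^ k)%R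
  by (field; lra).
replace (Cmod (u (S k)) * (r' * r' ^ k))%R with (r' * Cmod (u (S k)) * r' ^ k)%R by ring.
by apply: Rmult_le_compat_l => //; apply: Rmult_le_pos; lra.
Qed.

(** Zeros on a real interval to the right of 0 suffice: once the earlier coefficients are 0, the
    term [u_j t^j] at a zero [t] is balanced by a tail of order [t^(j+1)], and [t] can be taken
    arbitrarily small. *)
Lemma psb_unique (M dl : R) (f : C -> C) :
  psb r M f -> (0 < dl)%R -> (forall t : R, (0 < t < dl)%R -> f t = 0) ->
  forall t, (Cmod t <= r)%R -> f t = 0.
Proof.
move=> [u [Hu Hf]] Hdl H0.
have HM : (0 <= M)%R := Hu 0%nat.
suff Hz : forall j, u j = 0.
  move=> t Ht; apply: tends_unique (Hf t Ht) _.
  by apply: (csum_finite _ 0) => k _; rewrite Hz; ring.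
elim/lt_wf_ind => j IH; apply: Cmod_eq_0; apply: Rle_antisym; last exact: Cmod_ge_0.
apply: le_epsilon => eps He; rewrite Rplus_0_l.
have Hrj : (0 < r ^ S j)%R by apply: pow_lt.
(* The first two bounds keep [t] among the known zeros and inside the disk; the third gives
   [t / r^(j+1) * M <= eps]. *)
pose t := (Rmin (Rmin (dl / 2) r) (eps * r ^ S j / (M + 1)))%R.
have Ht3 : (0 < eps * r ^ S j / (M + 1))%R.
  by apply: Rdiv_lt_0_compat; [apply: Rmult_lt_0_compat|lra].
have Ht0 : (0 < t)%R by apply: Rmin_pos => //; apply: Rmin_pos; lra.
have H1 : (t <= Rmin (dl / 2) r)%R := Rmin_l _ _.
have H2 : (t <= eps * r ^ S j / (M + 1))%R := Rmin_r _ _.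
have H3 := Rmin_l (dl / 2) r; have H4 := Rmin_r (dl / 2) r.
have Htr : (Cmod t <= r)%R by rewrite Cmod_R Rabs_pos_eq; lra.
have Htj : (0 < t ^ j)%R by apply: pow_lt.
have := Hf t Htr; rewrite H0; last lra.
move=> /(is_csum_tail_le _ _ (S j) ((t / r) ^ S j * M)) H.
have {}H : (Cmod (u j) * t ^ j <= (t / r) ^ S j * M)%R.
  have E : csum (fun i => u i * t ^ i) (S j) = u j * t ^ j.
    rewrite /= (csum_ext _ (fun _ => 0)) => [|k Hk]; last by rewrite IH //; ring.
    suff -> : csum (fun _ : nat => 0) j = 0 by ring.
    by elim: j {IH Hrj t Ht3 Ht0 H1 H2 Htr Htj H} => [//|j IH] /=; rewrite IH; ring.
  move: H; rewrite E; replace (0 - u j * t ^ j) with (- (u j * t ^ j)) by ring.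
  rewrite Cmod_opp Cmod_mult Cmod_pow Cmod_R (Rabs_pos_eq t); last lra.
  apply=> m Hm; apply: (Rle_trans _ ((t / r) ^ S j * (rsum (fun i => Cmod (u i) * r ^ i) m
     - rsum (fun i => Cmod (u i) * r ^ i) (S j)))%R).
    elim: m / Hm => [|m Hm IHm]; first by rewrite !Rminus_diag; lra.
    rewrite [rsum _ (S m)]/= [rsum (fun i => Cmod (u i) * r ^ i)%R (S m)]/=.
    suff : (Cmod (u m * t ^ m) <= (t / r) ^ S j * (Cmod (u m) * r ^ m))%R by lra.
    rewrite Cmod_mult Cmod_pow Cmod_R (Rabs_pos_eq t); last lra.
    have {1}-> : t = (t / r * r)%R by field; lra.
    rewrite Rpow_mult_distr.
    have Htr1 : (0 <= t / r <= 1)%R.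
      split; first by apply: Rlt_le; apply: Rdiv_lt_0_compat.
      by apply/Rle_div_l => //; lra.
    have E1 : ((t / r) ^ m <= (t / r) ^ S j)%R.
      have -> : m = (S j + (m - S j))%nat by lia.
      rewrite pow_add -{2}(Rmult_1_r ((t / r) ^ S j)); apply: Rmult_le_compat_l.
        by apply: pow_le; lra.
      by rewrite -(pow1 (m - S j)); apply: pow_incr.
    have E2 : (0 <= Cmod (u m) * r ^ m)%R.
      by apply: Rmult_le_pos; [exact: Cmod_ge_0|apply: pow_le; lra].
    by have := Rmult_le_compat_r _ _ _ E2 E1; lra.
  apply: Rmult_le_compat_l.
    by apply: pow_le; apply: Rlt_le; apply: Rdiv_lt_0_compat.
  have := Hu m; suff : (0 <= rsum (fun i => Cmod (u i) * r ^ i) (S j))%R by lra.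
  by apply: rsum_ge_0 => i; apply: Rmult_le_pos; [exact: Cmod_ge_0|apply: pow_le; lra].
have H5 : (Cmod (u j) <= t / r ^ S j * M)%R.
  apply: (Rmult_le_reg_r (t ^ j)) => //; apply: Rle_trans H _; right.
  by rewrite /Rdiv Rpow_mult_distr pow_inv /=; field; split; [apply: pow_nonzero|]; lra.
apply: Rle_trans H5 _.
have H6 : (t / r ^ S j <= eps / (M + 1))%R.
  apply/Rle_div_l => //; replace (eps / (M + 1) * r ^ S j)%R with (eps * r ^ S j / (M + 1))%R by (field; lra).
  by [].
apply: Rle_trans (Rmult_le_compat_r _ _ _ HM H6) _.
replace (eps / (M + 1) * M)%R with (eps - eps / (M + 1))%R by (field; lra).
suff : (0 < eps / (M + 1))%R by lra.
by apply: Rdiv_lt_0_compat; lra.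
Qed.

Lemma exp_le_compat (x y : R) : (x <= y -> exp x <= exp y)%R.
Proof. by case=> [H|->]; [apply: Rlt_le; apply: exp_increasing|right]. Qed.

(** A discrete Gronwall estimate for the majorants in [psb_recurrence]: [B] bounds the functions and
    [D] their increments. The coupling [K sg^n] is summable, so the product of the growth factors
    stays bounded. *)
Lemma bounded_recurrence (rho K sg B0 D0 : R) (B D : nat -> R) :
  (0 <= rho < 1)%R -> (0 <= sg < 1)%R -> (0 <= K)%R -> (0 <= B 0%nat)%R -> (0 <= D 0%nat)%R ->
  (forall n, B (S n) = B n + D n)%R ->
  (forall n, D (S n) = rho * D n + K * sg ^ n * B (S n))%R ->
  exists A, forall n, (B n <= A)%R.
Proof.
move=> Hrho Hsg HK HB0 HD0 HB HD.
have Hpos n : (0 <= B n /\ 0 <= D n)%R.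
  elim: n => [//|n [H1 H2]].
  have HB1 : (0 <= B (S n))%R by rewrite HB; lra.
  split=> //; rewrite HD; have H3 : (0 <= K * sg ^ n)%R.
    by apply: Rmult_le_pos => //; apply: pow_le; lra.
  by have := Rmult_le_pos _ _ H3 HB1; have := Rmult_le_pos rho (D n); lra.
pose ka := (/ (1 - rho))%R.
have Hka : (0 < ka)%R by apply: Rinv_0_lt_compat; lra.
have Eka : (ka * rho = ka - 1)%R by rewrite /ka; field; lra.
have Hkr : (0 <= ka * rho)%R by apply: Rmult_le_pos; lra.
(* Since [ka * rho = ka - 1], [V] grows at each step by a factor [1 + O(sg ^ n)] only. *)
pose V n := (B (S n) + ka * rho * D n)%R.
have HV n : (V (S n) <= V n * (1 + ka * K * sg ^ n))%R.
  rewrite /V HB HD; have [H1 H2] := Hpos (S n); have [H3 H4] := Hpos n.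
  have Hs : (0 <= K * sg ^ n)%R by apply: Rmult_le_pos => //; apply: pow_le; lra.
  have Hs' : (0 <= ka * (K * sg ^ n))%R by apply: Rmult_le_pos; lra.
  have H5 : (0 <= ka * rho * D n)%R by apply: Rmult_le_pos.
  have -> : (B (S n) + (rho * D n + K * sg ^ n * B (S n)) + ka * rho * (rho * D n + K * sg ^ n * B (S n)) =
    B (S n) + (1 + ka * rho) * (rho * D n + K * sg ^ n * B (S n)))%R by ring.
  have -> : ((1 + ka * rho) = ka)%R by lra.
  nra.
have HVe n : (V n <= V 0%nat * exp (ka * K * (1 - sg ^ n) / (1 - sg)))%R.
  have HV0 : (0 <= V 0%nat)%R.
    rewrite /V; have [H1 _] := Hpos 1%nat; have [_ H2] := Hpos 0%nat.
    have : (0 <= ka * rho * D 0%nat)%R by apply: Rmult_le_pos.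
    lra.
  elim: n => [|n IH].
    rewrite /=; replace (ka * K * (1 - 1) / (1 - sg))%R with 0%R by (field; lra).
    by rewrite exp_0; lra.
  have Hs : (0 <= ka * K * sg ^ n)%R.
    by apply: Rmult_le_pos; [apply: Rmult_le_pos; lra|apply: pow_le; lra].
  apply: Rle_trans (HV n) _.
  replace (ka * K * (1 - sg ^ S n) / (1 - sg))%R with
    (ka * K * (1 - sg ^ n) / (1 - sg) + ka * K * sg ^ n)%R by (rewrite /=; field; lra).
  rewrite exp_plus -Rmult_assoc.
  apply: (Rle_trans _ (V 0%nat * exp (ka * K * (1 - sg ^ n) / (1 - sg)) * (1 + ka * K * sg ^ n))%R).
    by apply: Rmult_le_compat_r => //; lra.
  apply: Rmult_le_compat_l; last by have := exp_ineq1_le (ka * K * sg ^ n); lra.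
  by apply: Rmult_le_pos => //; apply: Rlt_le; apply: exp_pos.
have HV0 : (0 <= V 0%nat)%R.
  rewrite /V; have [H1 _] := Hpos 1%nat; have [_ H2] := Hpos 0%nat.
  have : (0 <= ka * rho * D 0%nat)%R by apply: Rmult_le_pos.
  lra.
exists (V 0%nat * exp (ka * K / (1 - sg)))%R => n.
apply: (Rle_trans _ (V n)).
  rewrite /V HB; have [H1 H2] := Hpos n.
  have : (0 <= ka * rho * D n)%R by apply: Rmult_le_pos.
  lra.
apply: Rle_trans (HVe n) _; apply: Rmult_le_compat_l => //.
apply: exp_le_compat; apply: Rmult_le_compat_r; first by apply: Rlt_le; apply: Rinv_0_lt_compat; lra.
rewrite -{2}(Rmult_1_r (ka * K)); apply: Rmult_le_compat_l.
  by apply: Rmult_le_pos; lra.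
by have := pow_le sg n; lra.
Qed.

(** The increments are contracted, up to a summable multiple of the function itself. The majorants
    obey the same recurrence with norms in place of functions, and their boundedness gives normal
    convergence of the telescoping series. *)
Lemma psb_recurrence (Phi rho eps : nat -> C -> C) (R0 K sg M0 M1 : R) :
  (R0 < 1)%R -> (0 <= sg < 1)%R ->
  psb r M0 (Phi 0%nat) -> psb r M1 (Phi 1%nat) ->
  (forall n, psb r R0 (rho n)) -> (forall n, psb r (K * sg ^ n) (eps n)) ->
  (forall n t, (Cmod t <= r)%R ->
    Phi (S (S n)) t - Phi (S n) t = rho n t * (Phi (S n) t - Phi n t) - eps n t * Phi (S n) t) ->
  exists (G : C -> C) (A : R), psb r A G /\
    forall t, (Cmod t <= r)%R -> tends eventually (fun n => Phi n t) (G t).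
Proof.
move=> HR Hsg H0 H1 Hrho Heps Hrec.
have HR0 := psb_ge_0 _ _ _ (Hrho 0%nat).
have HK : (0 <= K)%R by have := psb_ge_0 _ _ _ (Heps 0%nat); rewrite /=; lra.
pose BD := fix BD n : R * R := match n with
  | O => (M0, M0 + M1)%R
  | S k => let (x, y) := BD k in (x + y, R0 * y + K * sg ^ k * (x + y))%R
  end.
pose B n := fst (BD n); pose D n := snd (BD n).
have HB n : B (S n) = (B n + D n)%R by rewrite /B /D /=; case: (BD n).
have HD n : D (S n) = (R0 * D n + K * sg ^ n * B (S n))%R.
  by rewrite HB /B /D /=; case: (BD n).
have M00 := psb_ge_0 _ _ _ H0; have M10 := psb_ge_0 _ _ _ H1.
have [A HA] := bounded_recurrence R0 K sg 0 0 B D (conj HR0 HR) Hsg HK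
  (M00 : 0 <= B 0%nat)%R (Rplus_le_le_0_compat _ _ M00 M10 : 0 <= D 0%nat)%R HB HD.
have Hpsb n : psb r (B n) (Phi n) /\ psb r (D n) (fun t => Phi (S n) t - Phi n t).
  elim: n => [|n [IH1 IH2]].
    by split=> //; rewrite /D /= Rplus_comm; apply: psb_minus.
  have HS : psb r (B (S n)) (Phi (S n)).
    rewrite HB; apply: (psb_ext _ _ (fun t => Phi n t + (Phi (S n) t - Phi n t))).
      by move=> t _; ring.
    exact: psb_plus.
  split=> //; rewrite HD.
  apply: (psb_ext _ _ (fun t => rho n t * (Phi (S n) t - Phi n t) - eps n t * Phi (S n) t)).
    by move=> t Ht; rewrite -Hrec.
  by apply: psb_minus; apply: psb_mult.
(* Since [B (n + 1) = B n + D n], the partial sums of the norms in the telescoping series are the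
   [B n] themselves. *)
have Hsum n : (rsum (fun k => match k with O => B 0%nat | S j => D j end) n <= A)%R.
  have H m : rsum (fun k => match k with O => B 0%nat | S j => D j end) (S m) = B m.
    by elim: m => [|m IH]; [rewrite /=; ring|rewrite [LHS]/= -/(rsum _ (S m)) IH HB].
  case: n => [|n]; last by rewrite H.
  by apply: Rle_trans (HA 0%nat).
have [G [HG HGs]] := psb_sum r Hr
  (fun k t => match k with O => Phi 0%nat t | S j => Phi (S j) t - Phi j t end)
  (fun k => match k with O => B 0%nat | S j => D j end) A
  ltac:(by case=> [|j]; [exact: (proj1 (Hpsb 0%nat))|exact: (proj2 (Hpsb j))]) Hsum.
exists G, A; split=> // t Ht.
apply: (tends_ext (fun n => csum (fun k => match k with O => Phi 0%nat t | S j => Phi (S j) t - Phi j t end) (S n))).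
  elim=> [|n IH]; first by rewrite /=; ring.
  by rewrite [LHS]/= -/(csum _ (S n)) IH; ring.
by apply: (tends_subseq S _ _ _ (HGs t Ht)) => n; lia.
Qed.
End Inverse.

(** The existential radius suits finitely many functions, whose disks can be reduced to a common
    one. Infinite families need [psb] at a fixed radius. *)
Definition germ (f : C -> C) : Prop := exists r M, (0 < r)%R /\ psb r M f.

Lemma germ_common (f g : C -> C) : germ f -> germ g ->
  exists r M N, (0 < r)%R /\ psb r M f /\ psb r N g.
Proof.
move=> [r [M [Hr Hf]]] [r' [N [Hr' Hg]]].
have H := Rmin_pos _ _ Hr Hr'.
exists (Rmin r r'), M, N; split=> //; split.
- by apply: psb_shrink Hf; have := Rmin_l r r'; lra.
- by apply: psb_shrink Hg; have := Rmin_r r r'; lra.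
Qed.

Lemma germ_const (c : C) : germ (fun _ => c).
Proof. by exists 1%R, (Cmod c); split; [lra|apply: psb_const; lra]. Qed.

Lemma germ_id : germ (fun t => t).
Proof. by exists 1%R, 1%R; split; [lra|apply: psb_id; lra]. Qed.

Lemma germ_plus (f g : C -> C) : germ f -> germ g -> germ (fun t => f t + g t).
Proof.
move=> Hf Hg; have [r [M [N [Hr [H1 H2]]]]] := germ_common _ _ Hf Hg.
by exists r, (M + N)%R; split=> //; apply: psb_plus.
Qed.

Lemma germ_mult (f g : C -> C) : germ f -> germ g -> germ (fun t => f t * g t).
Proof.
move=> Hf Hg; have [r [M [N [Hr [H1 H2]]]]] := germ_common _ _ Hf Hg.
by exists r, (M * N)%R; split=> //; apply: psb_mult.
Qed.

Lemma germ_minus (f g : C -> C) : germ f -> germ g -> germ (fun t => f t - g t).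
Proof.
move=> Hf Hg; have [r [M [N [Hr [H1 H2]]]]] := germ_common _ _ Hf Hg.
by exists r, (M + N)%R; split=> //; apply: psb_minus.
Qed.

(** With [f / f 0 = 1 - h] and [h 0 = 0], the disk is shrunk by [psb_vanish] until the Neumann
    series of [h] converges. *)
Lemma germ_inv (f : C -> C) : germ f -> f 0 <> 0 -> germ (fun t => / f t).
Proof.
move=> [r [M [Hr Hf]]] H0.
pose h t := 1 - / f 0 * f t.
have Hh : psb r (Cmod 1 + Cmod (/ f 0) * M) h.
  by apply: psb_minus; [|exact: psb_const|exact: psb_scal].
have Hh0 : h 0 = 0 by rewrite /h Cinv_l //; ring.
set N := (_ + _)%R in Hh; have HN := psb_ge_0 _ _ _ Hh.
(* Chosen so that [r' (N + 1) = r / 2], which gives both [r' <= r] and [r' / r * N < 1]. *)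
pose r' := (r / 2 / (N + 1))%R.
have Hr' : (0 < r')%R by apply: Rdiv_lt_0_compat; lra.
have E : (r' * (N + 1) = r / 2)%R by rewrite /r'; field; lra.
have Hrr : (r' <= r)%R by have := Rmult_le_pos r' N; lra.
have Hth : (r' / r * N < 1)%R.
  replace (r' / r * N)%R with (r' * N / r)%R by (field; lra).
  by apply/Rlt_div_l => //; lra.
have := psb_inv_1m _ Hr' _ _ Hth (psb_vanish _ Hr _ _ _ Hh Hh0 (conj Hr' Hrr)).
move=> /(psb_scal _ Hr' (/ f 0)) HI; exists r', (Cmod (/ f 0) * / (1 - r' / r * N))%R; split=> //.
apply: psb_ext HI => t Ht; rewrite /h.
have Hm : (Cmod (h t) < 1)%R.
  apply: Rle_lt_trans Hth; apply: (psb_le _ _ _ _ _ Ht).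
  by apply: psb_vanish Hh _ _.
have Hf0 : f t <> 0.
  move=> E0; move: Hm; rewrite /h E0; replace (1 - / f 0 * 0) with (RtoC 1) by ring.
  by rewrite Cmod_1; lra.
by field.
Qed.

Lemma germ_div (f g : C -> C) : germ f -> germ g -> g 0 <> 0 -> germ (fun t => f t / g t).
Proof. by move=> Hf Hg H0; apply: germ_mult => //; apply: germ_inv. Qed.

Lemma germ_csum (f : nat -> C -> C) (n : nat) :
  (forall k, germ (f k)) -> germ (fun t => csum (fun k => f k t) n).
Proof.
by move=> Hf; elim: n => [|n IH] /=; [exact: germ_const|apply: germ_plus].
Qed.

(** * Families of power series with norm near 0 or 1 *)

Section Perturbation.
Variable r : R.
Hypothesis Hr : (0 < r)%R.

Definition null_family (h : nat -> C -> C) : Prop :=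
  forall eta, (0 < eta)%R -> exists N, forall n, (N <= n)%nat -> psb r eta (h n).
(** Only an upper bound on the norm is recorded. It is stable under products and holds for [1 - h n]
    and its inverse when [h] is a null family; multiplied by [q] it eventually yields a
    contraction. *)
Definition unit_family (f : nat -> C -> C) : Prop :=
  forall eta, (0 < eta)%R -> exists N, forall n, (N <= n)%nat -> psb r (1 + eta) (f n).

Lemma unit_mult (f g : nat -> C -> C) :
  unit_family f -> unit_family g -> unit_family (fun n t => f n t * g n t).
Proof.
(* As [d <= 1], one has [(1 + d)^2 <= 1 + 3 d <= 1 + eta]. *)
move=> Hf Hg eta He; pose d := Rmin 1 (eta / 3).
have Hd : (0 < d)%R by apply: Rmin_pos; lra.
have H1 : (d <= 1)%R := Rmin_l _ _; have H2 : (d <= eta / 3)%R := Rmin_r _ _.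
have [N HN] := Hf d Hd; have [N' HN'] := Hg d Hd.
exists (Nat.max N N') => n Hn.
apply: (psb_weaken _ ((1 + d) * (1 + d))); last first.
  by apply: psb_mult => //; [apply: HN|apply: HN']; lia.
have := Rmult_le_compat_l d d 1 ltac:(lra) H1; lra.
Qed.

Lemma unit_const1 : unit_family (fun _ _ => 1).
Proof.
move=> eta He; exists 0%nat => n _; apply: (psb_weaken _ (Cmod 1)); last exact: psb_const.
by rewrite Cmod_1; lra.
Qed.

Lemma unit_1m (h : nat -> C -> C) : null_family h -> unit_family (fun n t => 1 - h n t).
Proof.
move=> Hh eta He; have [N HN] := Hh eta He; exists N => n Hn.
apply: (psb_weaken _ (Cmod 1 + eta)); first by rewrite Cmod_1; lra.
by apply: psb_minus; [|exact: psb_const|exact: HN].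
Qed.

Lemma unit_inv_1m (h : nat -> C -> C) : null_family h -> unit_family (fun n t => / (1 - h n t)).
Proof.
(* The solution [x] of [1 / (1 - x) = 1 + eta]. *)
move=> Hh eta He; have Hd : (0 < eta / (1 + eta))%R by apply: Rdiv_lt_0_compat; lra.
have [N HN] := Hh _ Hd; exists N => n Hn.
have Hlt : (eta / (1 + eta) < 1)%R by apply/Rlt_div_l; lra.
have := psb_inv_1m _ Hr _ _ Hlt (HN n Hn).
by replace (/ (1 - eta / (1 + eta)))%R with (1 + eta)%R by (field; lra).
Qed.

Lemma null_1m_neq_0 (h : nat -> C -> C) : null_family h ->
  exists N, forall n t, (N <= n)%nat -> (Cmod t <= r)%R -> 1 - h n t <> 0.
Proof.
move=> Hh; have [N HN] := Hh (1 / 2)%R ltac:(lra); exists N => n t Hn Ht E.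
have := psb_le _ _ _ _ (HN n Hn) Ht.
have -> : h n t = 1 by replace (h n t) with (1 - (1 - h n t)) by ring; rewrite E; ring.
rewrite Cmod_1; lra.
Qed.

Lemma null_geom (q : C) (M : R) (f : C -> C) :
  (Cmod q < 1)%R -> psb r M f -> null_family (fun n t => q ^ n * f t).
Proof.
move=> hq Hf eta He; have HM := psb_ge_0 _ _ _ Hf.
have [N HN] := small_pow q hq M eta He.
exists N => n Hn; apply: (psb_weaken _ (Cmod (q ^ n) * M)); last exact: psb_scal.
by rewrite Cmod_pow Rmult_comm; apply: HN.
Qed.
End Perturbation.

(** * Asymptotics of the terminating series *)

Lemma qpow_sq (q : C) (n : nat) : (q ^ n) ^ 2 = (q ^ 2) ^ n.
Proof. by rewrite -!Cpow_mult_r Nat.mul_comm. Qed.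

(** A pole means [q^k = z q^n]. For [k <= n] this makes [z q^(n-k)] equal to 1, otherwise
    [q^(k-n) / z]; each hypothesis excludes one case. *)
Lemma no_pole_inv_shift (q z : C) (n : nat) :
  q <> 0 -> z <> 0 -> no_pole q z -> no_pole q (/ z) -> no_pole q (/ (z * q ^ n)).
Proof.
move=> Hq Hz H1 H2 k E.
have Hn := Cpow_nz q n Hq; have Hk := Cpow_nz q k Hq.
have {}E : q ^ k = z * q ^ n.
  by rewrite -[RHS]Cmult_1_r -E; field.
have [Hle|Hlt] := Nat.le_gt_cases k n.
- apply: (H1 (n - k)%nat); move: E; have {1}-> : n = (n - k + k)%nat by lia.
  rewrite Cpow_add_r => E.
  replace (z * q ^ (n - k)) with (z * (q ^ (n - k) * q ^ k) / q ^ k) by (field; done).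
  by rewrite -E; field.
- apply: (H2 (k - n)%nat); move: E; have {1}-> : k = (k - n + n)%nat by lia.
  rewrite Cpow_add_r => E.
  replace (/ z * q ^ (k - n)) with (/ z * (q ^ (k - n) * q ^ n) / q ^ n) by (field; split; done).
  by rewrite E; field.
Qed.

Lemma no_pole_pow (q w : C) (n : nat) : no_pole q w -> no_pole q (w * q ^ n).
Proof. by move=> H k; rewrite -Cmult_assoc -Cpow_add_r. Qed.

Section Asymptotics.
Variables (q a : C).
Hypothesis hq1 : (Cmod q < 1)%R.
Hypothesis hq0 : q <> 0.
Hypothesis ha0 : a <> 0.
Hypothesis ha : no_pole q a.

Definition phi_seq (b c d e f : C) (n : nat) : C :=
  phi q a b c d e f (s_param q a b c d e f * q ^ n / q) (/ q ^ n).

(** With [z = s / (a q)], the condition on [z] belongs to the domain of [W]. Together with the one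
    on [1 / z], it keeps the denominator parameter [a q / g = q / (z q^n)] of the terminating series
    away from poles, for every [n]. *)
Definition admissible (b c d e f : C) : Prop :=
  List.Forall (fun x : C => x <> 0) [b; c; d; e; f] /\
  List.Forall (fun x => no_pole q (a * q / x)) [b; c; d; e; f] /\
  no_pole q (a ^ 2 * q ^ 2 / (b * c * d * e * f)) /\
  no_pole q (/ (a ^ 2 * q ^ 2 / (b * c * d * e * f))).

(** The coefficient of the lower difference divided by that of the upper one in the contiguous
    relation, as [q] times factors [1 - N y], [1 - N^2 y] and inverses of such. This shape lets
    [unit_mult], [unit_1m] and [unit_inv_1m] be applied factor by factor. *)
Definition step_ratio (xs : list C) (s N : C) : C :=
  q * (prodl (fun x => 1 - N * (s * x / (a * q ^ 2))) xs * prodl (fun x => / (1 - N * (a * q / x))) xs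
   * ((1 - N * 1) * ((1 - N * a) * ((1 - N * (a * q)) * ((1 - N ^ 2 * s)
   * (/ (1 - N * (s / q)) * (/ (1 - N * (s / (a * q))) * (/ (1 - N * (s / (a * q ^ 2)))
   * / (1 - N ^ 2 * (s / q ^ 2)))))))))).

(** The term without difference, divided by the coefficient of the upper difference. The factor
    [N^2] makes it summable along [N = q^n]. *)
Definition step_source (xs : list C) (s N : C) : C :=
  N ^ 2 * (prodl (fun x => 1 - x) xs * (s * (s - a * q ^ 2) / (a ^ 2 * q ^ 3)))
  * (prodl (fun x => / (1 - N * (a * q / x))) xs
   * ((1 - N ^ 2 * s) * ((1 - N ^ 2 * (s / q))
   * (/ (1 - N * (s / q)) * (/ (1 - N * (s / (a * q))) * / (1 - N * (s / (a * q ^ 2)))))))).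

Lemma prodl_inv (g : C -> C) (xs : list C) :
  List.Forall (fun x => g x <> 0) xs -> prodl (fun x => / g x) xs = / prodl g xs.
Proof.
elim=> [|x ys Hx Hys IH] /=; first by field.
by rewrite IH; field; split=> //; apply: prodl_neq_0.
Qed.

Lemma phi_term_vanish (b c d e f g h : C) (n k : nat) :
  h * q ^ n = 1 -> (n < k)%nat -> phi_term q a b c d e f g h k = 0.
Proof. by move=> Hh Hk; rewrite phi_termE (qpoch_eq_0 q h n k Hh Hk) /Cdiv; ring. Qed.

Lemma phi_seq_csum (b c d e f : C) (n : nat) :
  phi_seq b c d e f n =
  csum (phi_term q a b c d e f (s_param q a b c d e f * q ^ n / q) (/ q ^ n)) (S n).
Proof.
apply: Cseries_eq; apply: csum_finite => k Hk; apply: (phi_term_vanish _ _ _ _ _ _ _ n) => //.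
by apply: Cinv_l; apply: Cpow_nz.
Qed.

Lemma contig_up (xs : list C) (s N : C) :
  List.Forall (fun x : C => x <> 0) xs -> s <> 0 -> N <> 0 -> s - a * q ^ 2 <> 0 ->
  1 - N ^ 2 * s <> 0 -> 1 - N ^ 2 * (s / q) <> 0 ->
  contig_coef q a xs (s * N / q) (/ N) =
  a ^ 2 * q ^ 3 / (s * N ^ 2) * (prodl (fun x => 1 - N * (a * q / x)) xs
    * ((1 - N * (s / q)) * (1 - N * (s / (a * q))) * (1 - N * (s / (a * q ^ 2)))))
  / ((1 - N ^ 2 * s) * (1 - N ^ 2 * (s / q)) * (s - a * q ^ 2)).
Proof.
move=> Hxs Hs HN HM H0 H1; rewrite /contig_coef.
rewrite (prodl_ext_in _ (fun x => 1 - N * (a * q / x))); last first.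
  by apply: List.Forall_impl Hxs => x Hx; field; repeat split.
have -> : 1 - a * q / (s * N / q) = - (a * q ^ 2 / (s * N)) * (1 - N * (s / (a * q ^ 2))).
  by rewrite /=; field; repeat split.
have -> : 1 - s * N / q * q / / N = 1 - N ^ 2 * s by rewrite /=; field; repeat split.
have -> : 1 - s * N / q / / N = 1 - N ^ 2 * (s / q) by rewrite /=; field; repeat split.
have -> : 1 - a * q / (s * N / q * / N) = (s - a * q ^ 2) / s by rewrite /=; field; repeat split.
move: (1 - N ^ 2 * s) (1 - N ^ 2 * (s / q)) (s - a * q ^ 2) H0 H1 HM => u v w *.
by rewrite /=; field; repeat split.
Qed.

Lemma contig_down (b c d e f N : C) :
  let xs := [b; c; d; e; f] in let s := s_param q a b c d e f in
  List.Forall (fun x : C => x <> 0) xs -> N <> 0 -> s - a * q ^ 2 <> 0 ->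
  1 - N ^ 2 * (s / q) <> 0 -> 1 - N ^ 2 * (s / q ^ 2) <> 0 ->
  contig_coef q a xs (/ N) (s * N / q) =
  a ^ 2 * q ^ 4 / (s * N ^ 2) * (prodl (fun x => 1 - N * (s * x / (a * q ^ 2))) xs
    * ((1 - N) * (1 - N * a) * (1 - N * (a * q))))
  / ((1 - N ^ 2 * (s / q)) * (1 - N ^ 2 * (s / q ^ 2)) * (s - a * q ^ 2)).
Proof.
move=> xs s Hxs HN HM H0 H1; rewrite /contig_coef.
move: (Hxs); rewrite !List.Forall_cons_iff => -[Hb [Hc [Hd [He [Hf _]]]]].
have Hs : s <> 0 by rewrite /s /s_param; nz.
(* The five monomials [- a q^2 / (s N x)] multiply to this constant once [bcdef] is replaced by
   [a^3 q^3 / s]. *)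
have -> : prodl (fun x => 1 - a * q / (s * N / q * x)) xs =
    - (a ^ 2 * q ^ 7 / (s ^ 4 * N ^ 5)) * prodl (fun x => 1 - N * (s * x / (a * q ^ 2))) xs.
  rewrite (prodl_ext_in _ (fun x => - (a * q ^ 2 / (s * N * x)) * (1 - N * (s * x / (a * q ^ 2))))).
    rewrite prodl_mult; congr Cmult; rewrite /= {2}(_ : s = a ^ 3 * q ^ 3 / (b * c * d * e * f)) //.
    by rewrite /=; field; repeat split.
  by apply: List.Forall_impl Hxs => x Hx; rewrite /=; field; repeat split.
have -> : 1 - a * q / (/ N * (s * N / q)) = (s - a * q ^ 2) / s by rewrite /=; field; repeat split.
have -> : 1 - / N * q / (s * N / q) = - (q ^ 2 / (s * N ^ 2)) * (1 - N ^ 2 * (s / q ^ 2)).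
  by rewrite /=; field; repeat split.
have -> : 1 - / N / (s * N / q) = - (q / (s * N ^ 2)) * (1 - N ^ 2 * (s / q)).
  by rewrite /=; field; repeat split.
move: (1 - N ^ 2 * (s / q)) (1 - N ^ 2 * (s / q ^ 2)) (s - a * q ^ 2) H0 H1 HM => u v w *.
move: (prodl _ xs) => PP; move: s Hs => s Hs.
by rewrite /=; field; repeat split.
Qed.

(** The contiguous relation at [h = q^(-n-1)], where the boundary value is 0, solved for the upper
    difference. The inequations in [N] hold for all large [n], as [N] tends to 0, but for general
    [s] they may fail for small [n]. *)
Lemma phi_step (b c d e f : C) (n : nat) :
  let s := s_param q a b c d e f in let N := q ^ S n in
  admissible b c d e f ->
  1 - N * (s / q) <> 0 -> 1 - N * (s / q ^ 2) <> 0 ->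
  1 - N ^ 2 * s <> 0 -> 1 - N ^ 2 * (s / q) <> 0 -> 1 - N ^ 2 * (s / q ^ 2) <> 0 ->
  phi_seq b c d e f (S (S n)) - phi_seq b c d e f (S n) =
  step_ratio [b; c; d; e; f] s N * (phi_seq b c d e f (S n) - phi_seq b c d e f n)
  - step_source [b; c; d; e; f] s N * phi_seq b c d e f (S n).
Proof.
move=> s N [Hxs [Hpole [Hz Hz']]] N1 N2 N3 N4 N5.
have ha1 : 1 - a <> 0 := no_pole_1m _ _ ha.
have HN : N <> 0 := Cpow_nz _ _ hq0.
move: (Hxs); rewrite !List.Forall_cons_iff => -[Hb [Hc [Hd [He [Hf _]]]]].
set z := a ^ 2 * q ^ 2 / (b * c * d * e * f) in Hz Hz'.
have Es : s = z * (a * q) by rewrite /s /s_param /z; field; repeat split.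
have Hz0 : z <> 0 by rewrite /z; nz.
have Hs0 : s <> 0 by rewrite Es; nz.
have HzN : no_pole q (/ (z * N)) by apply: no_pole_inv_shift.
have HzN1 : 1 - N * z <> 0.
  by have := Hz (S n); rewrite -/N Cmult_comm => H; apply/one_minus_neq_0.
have HzN2 : 1 - N * (z / q) <> 0.
  have := Hz n; rewrite (_ : z * q ^ n = N * (z / q)); last by rewrite /N /=; field.
  by move=> H; apply/one_minus_neq_0.
pose g := s * N / q; pose h := / N.
have Hg0 : g <> 0 by rewrite /g; nz.
have Hh0 : h <> 0 by rewrite /h; nz.
have HqN k : (0 < k)%nat -> 1 - q ^ k <> 0.
  case: k => [|k] Hk; first lia.
  by apply/one_minus_neq_0; apply: no_pole_q.
have HzQ : z - q <> 0.
  move=> E; apply: (Hz' 1%nat); rewrite /=.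
  by replace z with (q + (z - q)) by ring; rewrite E; field.
have Hgen : contig_generic q a g h.
  have Hi : / N <> 0 := Hh0.
  have Hi' : - / N <> 0 by move=> E; apply: Hi; replace (/ N) with (- - / N) by ring; rewrite E; ring.
  have H1 := HqN (S n) ltac:(lia); have H2 := HqN (S (S n)) ltac:(lia).
  split; [repeat split=> //|split; [repeat split|split]].
  - by replace (1 - g) with (1 - N * (s / q)) by (rewrite /g; field; done).
  - replace (1 - h) with ((1 - q ^ S n) * - / N) by (rewrite /h -/N; field; done).
    nz.
  - replace (q - g) with (q * (1 - N * (s / q ^ 2))) by (rewrite /g; field; done).
    nz.
  - replace (q - h) with ((1 - q ^ S (S n)) * - / N).
      nz.
    by rewrite [q ^ S (S n)]/= -[q * q ^ n]/(q ^ S n) -/N /h; field.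
  - replace (h - g * q) with ((1 - N ^ 2 * s) * / N) by (rewrite /g /h; field; done).
    nz.
  - replace (h - g) with ((1 - N ^ 2 * (s / q)) * / N) by (rewrite /g /h; field; done).
    nz.
  - replace (g * h - a * q) with (a * (z - q)) by (rewrite /g /h Es; field; done).
    nz.
  - replace (g - h * q) with (q * (1 - N ^ 2 * (s / q ^ 2)) * - / N) by (rewrite /g /h; field; done).
    nz.
  - by replace (a / g) with (/ (z * N)) by (rewrite /g Es; field; done).
  - replace (a / h) with (a * q ^ S n) by (rewrite /h -/N; field; done).
    exact: no_pole_pow.
have Hbal : b * c * d * e * f * g * h = a ^ 3 * q ^ 2.
  by rewrite /g /h /s /s_param; field; repeat split.
have := contig_relation q a b c d e f hq1 hq0 ha0 ha1 Hxs Hpole g h Hbal Hgen.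
have -> : boundary q a b c d e f g h = 0.
  rewrite /boundary (qpoch_inf_eq_0 q h (S n)); first by rewrite /Cdiv; ring.
  by rewrite -/N /h; field.
have Hqn := Cpow_nz q n hq0.
have E1 : s * q ^ S (S n) / q = g * q by rewrite /g /N /=; field.
have E2 : / q ^ S (S n) = h / q by rewrite /h /N /=; field; split.
have E3 : s * q ^ n / q = g / q by rewrite /g /N /=; field.
have E4 : / q ^ n = h * q by rewrite /h /N /=; field; split.
have -> : phi q a b c d e f (g * q) (h / q) = phi_seq b c d e f (S (S n)).
  by rewrite /phi_seq -/s E1 E2.
have -> : phi q a b c d e f (g / q) (h * q) = phi_seq b c d e f n.
  by rewrite /phi_seq -/s E3 E4.
have -> : phi q a b c d e f g h = phi_seq b c d e f (S n).
  by rewrite /phi_seq -/s -/N -/g -/h.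
have HQ : List.Forall (fun x => 1 - N * (a * q / x) <> 0) [b; c; d; e; f].
  apply: List.Forall_impl Hpole => x Hx; apply/one_minus_neq_0; rewrite Cmult_comm; exact: Hx.
have HQ' := prodl_neq_0 _ _ HQ.
have M1 : 1 - N * (s / (a * q)) <> 0.
  by move: HzN1; rewrite Es; replace (z * (a * q) / (a * q)) with z by (field; done).
have M2 : 1 - N * (s / (a * q ^ 2)) <> 0.
  by move: HzN2; rewrite Es; replace (z * (a * q) / (a * q ^ 2)) with (z / q) by (field; done).
have M3 : s - a * q ^ 2 <> 0.
  by replace (s - a * q ^ 2) with (a * q * (z - q)) by (rewrite Es /=; ring); nz.
rewrite /step_ratio /step_source (prodl_inv _ _ HQ) /g /h contig_up // contig_down // -/s.
move: (prodl (fun x => 1 - N * (a * q / x)) _) HQ' => QQ HQQ.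
move: (prodl (fun x => 1 - N * (s * x / (a * q ^ 2))) _) => PP.
move: (prodl (fun x => 1 - x) _) => RR.
move: (phi_seq b c d e f (S (S n))) (phi_seq b c d e f (S n)) (phi_seq b c d e f n) => X Y Z.
move: (1 - N * (s / q)) N1 (1 - N * (s / (a * q))) M1 (1 - N * (s / (a * q ^ 2))) M2 => A1 HA1 A2 HA2 A3 HA3.
move: (1 - N ^ 2 * s) N3 (1 - N ^ 2 * (s / q)) N4 (1 - N ^ 2 * (s / q ^ 2)) N5 => B0 HB0 B1 HB1 B2 HB2.
move: (1 - N * a) (1 - N * (a * q)) => C1 C2.
move: (s - a * q ^ 2) M3 => M HM.
clear - ha0 hq0 HN Hs0 HQQ HA1 HA2 HA3 HB0 HB1 HB2 HM.
set al := (_ / _); set ga := (_ / _) => E.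
have Hal : al <> 0 by rewrite /al; nz.
transitivity ((- ga * (Z - Y) - RR * Y) / al).
  replace (- ga * (Z - Y) - RR * Y) with (al * (X - Y) - (al * (X - Y) + ga * (Z - Y) + RR * Y)) by ring.
  by rewrite E; field.
by rewrite /al /ga {E Hal al ga}; field; repeat split.
Qed.

Lemma s_param_z (b c d e f : C) :
  b <> 0 -> c <> 0 -> d <> 0 -> e <> 0 -> f <> 0 ->
  s_param q a b c d e f = a ^ 2 * q ^ 2 / (b * c * d * e * f) * (a * q).
Proof. by move=> *; rewrite /s_param; field; repeat split. Qed.

Lemma admissible_pole_g (b c d e f : C) (n : nat) :
  admissible b c d e f -> no_pole q (a * q / (s_param q a b c d e f * q ^ n / q)).
Proof.
move=> [Hxs [_ [Hz Hz']]].
move: (Hxs); rewrite !List.Forall_cons_iff => -[Hb [Hc [Hd [He [Hf _]]]]].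
rewrite s_param_z //; set z := _ / _ in Hz Hz' *.
have Hz0 : z <> 0 by rewrite /z; nz.
have Hn := Cpow_nz q n hq0.
replace (a * q / (z * (a * q) * q ^ n / q)) with (/ (z * q ^ n) * q) by (field; repeat split; done).
by apply: no_pole_shift; apply: no_pole_inv_shift.
Qed.

(** * Local analyticity in [b] *)

Section Line.
Variables b c d e f be : C.
Hypothesis hadm : admissible b c d e f.
Let bt (u : C) : C := b + u * be.
Let st (u : C) : C := s_param q a (bt u) c d e f.

Lemma bt_0 : bt 0 = b.
Proof. by rewrite /bt; ring. Qed.

Lemma germ_bt : germ bt.
Proof. exact: germ_plus (germ_const b) (germ_mult _ _ germ_id (germ_const be)). Qed.

Lemma germ_st : germ st.
Proof.
have [Hxs _] := hadm; move: Hxs; rewrite !List.Forall_cons_iff => -[Hb [Hc [Hd [He [Hf _]]]]].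
apply: germ_div; first exact: germ_const.
  by do 4 (apply: germ_mult; last exact: germ_const); apply: germ_bt.
by rewrite bt_0; nz.
Qed.

Lemma germ_qpoch (w : C -> C) (k : nat) : germ w -> germ (fun u => qpoch q (w u) k).
Proof.
move=> Hw; elim: k => [|k IH] /=; first exact: germ_const.
apply: germ_mult => //; apply: germ_minus (germ_const 1) _.
exact: germ_mult Hw (germ_const _).
Qed.

Lemma germ_ratio (y w : C -> C) (k : nat) :
  germ y -> germ w -> no_pole q (w 0) -> germ (fun u => qpoch q (y u) k / qpoch q (w u) k).
Proof.
by move=> Hy Hw H0; apply: germ_div; [exact: germ_qpoch|exact: germ_qpoch|exact: qpoch_neq_0].
Qed.

(** The terminating series is a finite sum of rational functions of [b]. The radius obtained depends
    on [n], so this serves only for the two initial terms of the recurrence. *)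
Lemma phi_seq_germ (n : nat) : germ (fun u => phi_seq (bt u) c d e f n).
Proof.
have [Hxs [Hp _]] := hadm; move: Hxs Hp; rewrite !List.Forall_cons_iff.
move=> -[Hb [Hc [Hd [He [Hf _]]]]] [Pb [Pc [Pd [Pe [Pf _]]]]].
have Hs0 : s_param q a b c d e f <> 0 by rewrite /s_param; nz.
have -> : (fun u => phi_seq (bt u) c d e f n) =
    (fun u => csum (fun k => phi_term q a (bt u) c d e f (st u * q ^ n / q) (/ q ^ n) k) (S n)).
  by apply: functional_extensionality => u; rewrite phi_seq_csum.
apply: germ_csum => k.
have -> : (fun u => phi_term q a (bt u) c d e f (st u * q ^ n / q) (/ q ^ n) k) =
   (fun u => (1 - a * (q ^ k) ^ 2) / (1 - a) * term_base q a (bt u) c d e f k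
    * (qpoch q (st u * q ^ n / q) k / qpoch q (a * q / (st u * q ^ n / q)) k)
    * (qpoch q (/ q ^ n) k / qpoch q (a * q / / q ^ n) k) * q ^ k).
  by apply: functional_extensionality => u; rewrite phi_termE.
have Gg : germ (fun u => st u * q ^ n / q).
  by apply: germ_mult (germ_const _); apply: germ_mult germ_st (germ_const _).
apply: germ_mult (germ_const _); apply: germ_mult (germ_const _); apply: germ_mult.
  apply: germ_mult; first exact: germ_const.
  rewrite /term_base /=; apply: germ_mult; first exact: germ_const.
  apply: germ_mult; last exact: germ_const.
  apply: germ_ratio; [exact: germ_bt| |by rewrite bt_0].
  by apply: germ_div; [exact: germ_const|exact: germ_bt|rewrite bt_0].
apply: germ_ratio => //.
  apply: germ_div => //; first exact: germ_const.
  by rewrite /st bt_0; nz.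
by rewrite /st bt_0; apply: admissible_pole_g.
Qed.

Lemma loc0_id : tends (locally (T := C_UniformSpace) (RtoC 0)) (fun u : C => u) 0.
Proof. apply: (proj2 (tends_filterlim _ _)); exact: filterlim_id. Qed.

Lemma loc0_ex (P : C -> Prop) : locally (T := C_UniformSpace) (RtoC 0) P ->
  exists r, (0 < r)%R /\ forall u, (Cmod u <= r)%R -> P u.
Proof.
move=> [eps HP]; exists (eps / 2)%R; split; first by have := cond_pos eps; lra.
move=> u Hu; apply: HP; apply: C_NormedModule_mixin_compat1.
have -> : minus u (RtoC 0) = u by apply: injective_projections; rewrite /minus /plus /opp /=; ring.
by have := cond_pos eps; lra.
Qed.

(** Infinitely many inequations are involved; that they persist on a disk rests on the bound uniform
    in [k] behind [no_pole_near]. *)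
Lemma admissible_near : exists r, (0 < r)%R /\
  forall u, (Cmod u <= r)%R -> admissible (bt u) c d e f.
Proof.
apply: loc0_ex; set F := locally _; have FF : Filter F by apply: (@filter_filter _ _ (locally_filter _)).
have Tb : tends F bt b.
  rewrite -bt_0; apply: tends_plus (tends_const _) _.
  by apply: tends_mult loc0_id (tends_const _).
have [Hxs [Hp [Hz Hz']]] := hadm; move: Hxs Hp; rewrite !List.Forall_cons_iff.
move=> -[Hb [Hc [Hd [He [Hf _]]]]] [Pb [Pc [Pd [Pe [Pf _]]]]].
have Tz : tends F (fun u => a ^ 2 * q ^ 2 / (bt u * c * d * e * f)) (a ^ 2 * q ^ 2 / (b * c * d * e * f)).
  apply: tends_div (tends_const _) _; first by nz.
  by do 4 (apply: tends_mult (tends_const _)).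
have Tz' := tends_inv (FF := FF) _ _ (ltac:(nz) : a ^ 2 * q ^ 2 / (b * c * d * e * f) <> 0) Tz.
have Tp : tends F (fun u => a * q / bt u) (a * q / b) by apply: tends_div (tends_const _) Tb.
have A1 := no_pole_near (FF := FF) q hq1 _ _ Tp Pb.
have A2 := no_pole_near (FF := FF) q hq1 _ _ Tz Hz.
have A3 := no_pole_near (FF := FF) q hq1 _ _ Tz' Hz'.
have A4 := tends_neq (FF := FF) _ _ _ Hb Tb.
apply: filter_imp (filter_and _ _ (filter_and _ _ A1 A2) (filter_and _ _ A3 A4)) => u [[H1 H2] [H3 H4]].
by rewrite /admissible !List.Forall_cons_iff.
Qed.

Definition analytic_on (r : R) (g : C -> C) : Prop := exists M, psb r M g.

Section Families.
Variable r : R.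
Hypothesis Hr : (0 < r)%R.

Lemma an_const (x : C) : analytic_on r (fun _ => x).
Proof. by exists (Cmod x); apply: psb_const. Qed.

Lemma an_mult (g h : C -> C) : analytic_on r g -> analytic_on r h -> analytic_on r (fun u => g u * h u).
Proof. by move=> [M Hg] [N Hh]; exists (M * N)%R; apply: psb_mult. Qed.

Lemma null_q (g : C -> C) : analytic_on r g -> null_family r (fun n u => q ^ n * g u).
Proof. by move=> [M Hg]; apply: (null_geom _ Hr _ M). Qed.

Lemma null_q2 (g : C -> C) : analytic_on r g -> null_family r (fun n u => (q ^ n) ^ 2 * g u).
Proof.
move=> [M Hg] eta He.
have Hq2 : (Cmod (q ^ 2) < 1)%R.
  rewrite Cmod_pow /=; have H0 := Cmod_ge_0 q; nra.
have [N HN] := null_geom _ Hr (q ^ 2) M g Hq2 Hg eta He; exists N => n Hn.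
by apply: psb_ext (HN n Hn) => t _; rewrite qpow_sq.
Qed.
End Families.

(* [step_ratio] tends to [q] as [N -> 0], so the increments decay geometrically even where the
   series defining [W] diverges. *)
Lemma phi_limit_local : exists (r M : R) (G : C -> C), (0 < r)%R /\ psb r M G /\
  forall u, (Cmod u <= r)%R -> tends eventually (fun n => phi_seq (bt u) c d e f n) (G u).
Proof.
have [Hxs [Hp [Hz Hz']]] := hadm; move: Hxs Hp; rewrite !List.Forall_cons_iff.
move=> -[Hb [Hc [Hd [He [Hf _]]]]] [Pb [Pc [Pd [Pe [Pf _]]]]].
have [r0 [Hr0 Hadm]] := admissible_near.
have [r1 [Mb [Mv [Hr1 [Hb1 Hv1]]]]] := germ_common _ _ germ_bt (germ_inv _ germ_bt ltac:(by rewrite bt_0)).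
pose r := Rmin r0 r1; have Hr : (0 < r)%R := Rmin_pos _ _ Hr0 Hr1.
have Ab : analytic_on r bt by exists Mb; apply: psb_shrink Hb1; have := Rmin_r r0 r1; rewrite -/r; lra.
have Av : analytic_on r (fun u => / bt u).
  by exists Mv; apply: psb_shrink Hv1; have := Rmin_r r0 r1; rewrite -/r; lra.
have {}Hadm u : (Cmod u <= r)%R -> admissible (bt u) c d e f.
  by move=> Hu; apply: Hadm; have := Rmin_l r0 r1; rewrite -/r; lra.
have Hbt u : (Cmod u <= r)%R -> bt u <> 0.
  by move=> /Hadm [/List.Forall_cons_iff [H _] _].
have Am := an_mult r Hr; have Ac := an_const r Hr.
have As : analytic_on r st.
  have [M HM] := Am _ _ (Ac (a ^ 3 * q ^ 3 / (c * d * e * f))) Av; exists M.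
  by apply: psb_ext HM => u /Hbt Hu; rewrite /st /s_param; field; repeat split.
have Asc (x : C) : analytic_on r (fun u => st u * x) by apply: Am.
have AE : analytic_on r (fun u => prodl (fun x => 1 - x) [bt u; c; d; e; f]
    * (st u * (st u - a * q ^ 2) / (a ^ 2 * q ^ 3))).
  have A1m (g : C -> C) (x : C) : analytic_on r g -> analytic_on r (fun u => g u - x).
    by move=> [M HM]; exists (M + Cmod x)%R; apply: psb_minus => //; apply: psb_const.
  have A1 : analytic_on r (fun u => 1 - bt u).
    by have [M HM] := Ab; exists (Cmod 1 + M)%R; apply: psb_minus => //; apply: psb_const.
  rewrite /=; apply: (Am _ _); first by do 5 (apply: (Am _ _) => //).
  by apply: (Am _ _) => //; apply: (Am _ _) => //; apply: A1m.
have [ME HE] := AE.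
have Nq := null_q r Hr; have Nq2 := null_q2 r Hr.
have U1 := unit_1m r Hr; have UI := unit_inv_1m r Hr; have Um := unit_mult r Hr.
have Ucst := unit_const1 r Hr.
have Hrat : unit_family r (fun n u =>
   prodl (fun x => 1 - q ^ n * (st u * x / (a * q ^ 2))) [bt u; c; d; e; f]
   * prodl (fun x => / (1 - q ^ n * (a * q / x))) [bt u; c; d; e; f]
   * ((1 - q ^ n * 1) * ((1 - q ^ n * a) * ((1 - q ^ n * (a * q)) * ((1 - (q ^ n) ^ 2 * st u)
   * (/ (1 - q ^ n * (st u / q)) * (/ (1 - q ^ n * (st u / (a * q))) * (/ (1 - q ^ n * (st u / (a * q ^ 2)))
   * / (1 - (q ^ n) ^ 2 * (st u / q ^ 2)))))))))).
  by cbn [prodl fold_right] ; repeat first [exact Ucst | apply (Um _ _)]; (first [apply (U1 _) | apply (UI _)]);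
    (first [apply (Nq _) | apply (Nq2 _)]); repeat first [exact As | exact Ab | exact Av | exact (Ac _) | apply (Am _ _)].
have Hsrc : unit_family r (fun n u => prodl (fun x => / (1 - q ^ n * (a * q / x))) [bt u; c; d; e; f]
   * ((1 - (q ^ n) ^ 2 * st u) * ((1 - (q ^ n) ^ 2 * (st u / q))
   * (/ (1 - q ^ n * (st u / q)) * (/ (1 - q ^ n * (st u / (a * q))) * / (1 - q ^ n * (st u / (a * q ^ 2)))))))).
  by cbn [prodl fold_right] ; repeat first [exact Ucst | apply (Um _ _)]; (first [apply (U1 _) | apply (UI _)]);
    (first [apply (Nq _) | apply (Nq2 _)]); repeat first [exact As | exact Ab | exact Av | exact (Ac _) | apply (Am _ _)].
have Hp0 := Cmod_ge_0 q.
(* The perturbation is allowed half of the gap [1 - |q|]; the result is below 1 because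
   [(1 - |q|) (2 - |q|) > 0]. *)
pose R0 := (Cmod q * (1 + (1 - Cmod q) / 2))%R.
have HR0 : (R0 < 1)%R by rewrite /R0; nra.
have [N1 HN1] := Hrat ((1 - Cmod q) / 2)%R ltac:(lra).
have [N2 HN2] := Hsrc 1%R Rlt_0_1.
have NZ := null_1m_neq_0 r.
have [K1 HK1] := NZ _ (Nq _ (Asc (/ q))).
have [K2 HK2] := NZ _ (Nq _ (Asc (/ q ^ 2))).
have [K3 HK3] := NZ _ (Nq2 _ As).
have [K4 HK4] := NZ _ (Nq2 _ (Asc (/ q))).
have [K5 HK5] := NZ _ (Nq2 _ (Asc (/ q ^ 2))).
have [N0 EN0] : exists N0, N0 = (N1 + N2 + K1 + K2 + K3 + K4 + K5)%nat by exists (N1 + N2 + K1 + K2 + K3 + K4 + K5)%nat.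
(* The radius for these two initial terms depends on [N0], so the disk is shrunk once more, after
   [N0] is fixed; the bounds on ratios and sources persist on the smaller disk. *)
have [r2 [M0 [M1 [Hr2 [HP0 HP1]]]]] := germ_common _ _ (phi_seq_germ N0) (phi_seq_germ (S N0)).
pose r' := Rmin r r2; have Hr' : (0 < r')%R := Rmin_pos _ _ Hr Hr2.
have Hl : (0 <= r' <= r)%R by have := Rmin_l r r2; rewrite -/r'; lra.
have Hl2 : (0 <= r' <= r2)%R by have := Rmin_r r r2; rewrite -/r'; lra.
have ME0 := psb_ge_0 _ _ _ HE.
have P0 : psb r' M0 (fun u => phi_seq (bt u) c d e f (N0 + 0)).
  by rewrite Nat.add_0_r; apply: psb_shrink HP0.
have P1 : psb r' M1 (fun u => phi_seq (bt u) c d e f (N0 + 1)).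
  by rewrite Nat.add_1_r; apply: psb_shrink HP1.
have Prat n : psb r' R0 (fun u => step_ratio [bt u; c; d; e; f] (st u) (q ^ S (N0 + n))).
  by apply: (psb_shrink r) Hl _; apply: psb_scal => //; apply: HN1; lia.
have Psrc n : psb r' (ME * (1 + 1) * Cmod q ^ n)
    (fun u => step_source [bt u; c; d; e; f] (st u) (q ^ S (N0 + n))).
  apply: (psb_shrink r) Hl _.
    apply: (psb_weaken _ (Cmod ((q ^ S (N0 + n)) ^ 2) * ME * (1 + 1))).
      rewrite !Cmod_pow; set p := Cmod q.
      have H1 : (p ^ S (N0 + n) <= p ^ n)%R.
        replace (S (N0 + n)) with (S N0 + n)%nat by lia; rewrite pow_add -{2}(Rmult_1_l (p ^ n)).
        apply: Rmult_le_compat_r; first exact: pow_le.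
        by rewrite -(pow1 (S N0)); apply: pow_incr; rewrite /p; lra.
      have H2 : (p ^ S (N0 + n) <= 1)%R.
        by rewrite -(pow1 (S (N0 + n))); apply: pow_incr; rewrite /p; lra.
      have H3 := pow_le p (S (N0 + n)) Hp0; move: (p ^ S (N0 + n))%R H1 H2 H3 => y H1 H2 H3.
      have H4 : (y ^ 2 <= p ^ n)%R by rewrite /=; nra.
      by have := Rmult_le_compat_r _ _ _ ME0 H4; lra.
    by apply: psb_mult; [done|apply: psb_scal|apply: HN2; lia].
have Prec n u : (Cmod u <= r')%R ->
    phi_seq (bt u) c d e f (N0 + S (S n)) - phi_seq (bt u) c d e f (N0 + S n) =
    step_ratio [bt u; c; d; e; f] (st u) (q ^ S (N0 + n)) *
      (phi_seq (bt u) c d e f (N0 + S n) - phi_seq (bt u) c d e f (N0 + n))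
    - step_source [bt u; c; d; e; f] (st u) (q ^ S (N0 + n)) * phi_seq (bt u) c d e f (N0 + S n).
  move=> Hu; have Hu' : (Cmod u <= r)%R by lra.
    replace (N0 + S (S n))%nat with (S (S (N0 + n))) by lia.
    replace (N0 + S n)%nat with (S (N0 + n)) by lia.
    apply: phi_step; first exact: Hadm.
    + by apply: (HK1 (S (N0 + n)) u) => //; lia.
    + by apply: (HK2 (S (N0 + n)) u) => //; lia.
    + by apply: (HK3 (S (N0 + n)) u) => //; lia.
    + by apply: (HK4 (S (N0 + n)) u) => //; lia.
    + by apply: (HK5 (S (N0 + n)) u) => //; lia.
have [G [A [HG HGl]]] := psb_recurrence r' Hr' (fun n u => phi_seq (bt u) c d e f (N0 + n))
  (fun n u => step_ratio [bt u; c; d; e; f] (st u) (q ^ S (N0 + n)))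
  (fun n u => step_source [bt u; c; d; e; f] (st u) (q ^ S (N0 + n)))
  R0 (ME * (1 + 1)) (Cmod q) M0 M1 HR0 (conj Hp0 hq1) P0 P1 Prat Psrc Prec.
exists r', A, G; split=> //; split=> // u Hu eps Heps.
have [N HN] := HGl u Hu eps Heps; exists (N0 + N)%nat => n Hn.
by have := HN (n - N0)%nat ltac:(lia); replace (N0 + (n - N0))%nat with n by lia.
Qed.
End Line.
End Asymptotics.

Lemma tends_shift_back (u : nat -> C) (l : C) (k : nat) :
  tends eventually u l -> tends eventually (fun n => u (n - k)%nat) l.
Proof.
move=> H eps He; have [N HN] := H eps He; exists (N + k)%nat => n Hn.
by apply: HN; lia.
Qed.

(** * The limit where the series [W] converges *)

Section Continuation.
Variables (q a : C).
Hypothesis hq1 : (Cmod q < 1)%R.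
Hypothesis hq0 : q <> 0.
Hypothesis ha0 : a <> 0.
Hypothesis ha : no_pole q a.

(** Reversal of finite products: with [n = m + k], [(q^(-n))_k] is expressed by [(q)_n / (q)_m] and
    [(q^(1-n) / z)_k] by [(z)_n / (z)_m]. The signs cancel and the remaining powers combine to
    [z^k]; this is how the argument of the series [W] arises. *)
Lemma terminating_ratio (z : C) (k m : nat) :
  z <> 0 -> no_pole q z -> no_pole q (/ z) ->
  qpoch q (/ q ^ (m + k)) k / qpoch q (/ (z * q ^ (m + k)) * q) k * q ^ k =
  z ^ k * (qpoch q q (m + k) / qpoch q q m * (qpoch q z m / qpoch q z (m + k))).
Proof.
move=> Hz0 Hz Hz'.
(* The induction on [k] keeps the total [n] fixed while [m] decreases. *)
suff H : forall n, (k + m)%nat = n ->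
    qpoch q (/ q ^ n) k / qpoch q (/ (z * q ^ n) * q) k * q ^ k =
    z ^ k * (qpoch q q n / qpoch q q m * (qpoch q z m / qpoch q z n)).
  by apply: H; lia.
move=> n; elim: k m => [|k IH] m Hn.
  have -> : n = m by rewrite -Hn.
  have H1 := qpoch_neq_0 q z m Hz; have H2 := qpoch_neq_0 q q m (no_pole_q q hq1).
  by rewrite /=; field.
have Hqq := no_pole_q q hq1.
have Hm := Cpow_nz q m hq0; have Hk := Cpow_nz q k hq0.
have H1 := qpoch_neq_0 q z n Hz.
have H3 := qpoch_neq_0 q q m Hqq.
have Hpole : no_pole q (/ (z * q ^ n) * q).
  by apply: no_pole_shift; apply: no_pole_inv_shift.
have H4 := qpoch_neq_0 q _ k Hpole.
have H6 : 1 - z * q ^ m <> 0 by apply/one_minus_neq_0.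
have H7 : 1 - q * q ^ m <> 0 by apply/one_minus_neq_0.
have := IH (S m) ltac:(lia); rewrite !qpoch_S.
set X := qpoch q _ k in H4 *; set Y := qpoch q _ k.
have -> : (1 - / q ^ n * q ^ k) = - / q ^ S m * (1 - q * q ^ m).
  rewrite (_ : n = (S m + k)%nat); last lia.
  by rewrite Cpow_add_r /=; field; repeat split.
have E5 : (1 - / (z * q ^ n) * q * q ^ k) = - / (z * q ^ m) * (1 - z * q ^ m).
  rewrite (_ : n = (S m + k)%nat); last lia.
  by rewrite Cpow_add_r /=; field; repeat split.
rewrite E5 => E.
transitivity (Y / X * q ^ k * (z * ((1 - q * q ^ m) / (1 - z * q ^ m)))).
  by rewrite /=; field.
by rewrite E /=; field.
Qed.

(** By [terminating_ratio] the [k]-th term is that of [W] times ratios that tend to 1 and are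
    bounded in [n] and [k], so the series is dominated with ratio [|z|]. Terms with [k > n] are 0
    and satisfy the bound trivially. *)
Lemma phi_seq_tannery (b c d e f w : C) :
  admissible q a b c d e f ->
  (Cmod (a ^ 2 * q ^ 2 / (b * c * d * e * f)) < 1)%R ->
  is_csum (W_term q a b c d e f) w ->
  tends eventually (phi_seq q a b c d e f) w.
Proof.
move=> Hadm Hz1 Hw.
have [Hxs [Hp [Hz Hz']]] := Hadm.
have ha1 : 1 - a <> 0 := no_pole_1m _ _ ha.
move: (Hxs); rewrite !List.Forall_cons_iff => -[Hb [Hc [Hd [He [Hf _]]]]].
set z := a ^ 2 * q ^ 2 / (b * c * d * e * f) in Hz Hz' Hz1.
set s := s_param q a b c d e f.
have Es : s = z * (a * q) by rewrite /s s_param_z.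
have Hz0 : z <> 0 by rewrite /z; nz.
have Hqq := no_pole_q q hq1.
have EW k : W_term q a b c d e f k =
    (1 - a * (q ^ k) ^ 2) / (1 - a) * term_base q a b c d e f k * z ^ k.
  rewrite /W_term /vwp_term /term_base -/z.
  have -> : q ^ (2 * k) = (q ^ k) ^ 2 by rewrite -Cpow_mult_r Nat.mul_comm.
  ring.
have [M1 [HM1 H1]] := term_base_bounded q a b c d e f hq1 Hp.
have HM0 : (0 <= (1 + Cmod a) / Cmod (1 - a))%R.
  apply: Rdiv_le_0_compat; first by have := Cmod_ge_0 a; lra.
  exact/Cmod_gt_0.
have TN : tends eventually (fun n => q ^ n) 0 by apply: geom_tends.
have Tg : tends eventually (fun n => s * q ^ n / q) 0.
  replace (RtoC 0) with (s * 0 / q) by (field; done).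
  by apply: tends_mult (tends_const _); apply: tends_mult TN; apply: tends_const.
have Th : tends eventually (fun n => a * q / / q ^ n) 0.
  replace (RtoC 0) with (a * q * 0) by ring.
  apply: (tends_ext (fun n => a * q * q ^ n)).
    by move=> n; have Hn := Cpow_nz q n hq0; field.
  by apply: tends_mult TN; apply: tends_const.
have H00 : no_pole q 0.
  by move=> k; replace (0 * q ^ k) with (RtoC 0) by ring; move/RtoC_inj; lra.
have [M2 [HM2 [N2 H2]]] := ratio_bounded q hq1 _ _ _ _ Tg Th H00.
have [M3 [HM3 H3]] := ratio_bounded_const q hq1 z q Hqq.
have [M4 [HM4 H4]] := ratio_bounded_const q hq1 q z Hz.
have Eterm m k : phi_term q a b c d e f (s * q ^ (m + k) / q) (/ q ^ (m + k)) k =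
    (1 - a * (q ^ k) ^ 2) / (1 - a) * term_base q a b c d e f k
    * (qpoch q (s * q ^ (m + k) / q) k / qpoch q (a * q / / q ^ (m + k)) k)
    * (qpoch q q (m + k) / qpoch q z (m + k) * (qpoch q z m / qpoch q q m)) * z ^ k.
  have Hn := Cpow_nz q (m + k) hq0.
  rewrite phi_termE.
  have -> : a * q / (s * q ^ (m + k) / q) = / (z * q ^ (m + k)) * q.
    by rewrite Es; field; repeat split.
  have Hr := terminating_ratio z k m Hz0 Hz Hz'.
  transitivity ((1 - a * (q ^ k) ^ 2) / (1 - a) * term_base q a b c d e f k
    * (qpoch q (s * q ^ (m + k) / q) k / qpoch q (a * q / / q ^ (m + k)) k)
    * (qpoch q (/ q ^ (m + k)) k / qpoch q (/ (z * q ^ (m + k)) * q) k * q ^ k)).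
    by rewrite /Cdiv; ring.
  by rewrite Hr /Cdiv; ring.
(* The summands [+ 1] make these factors at least 1, so that the same constant dominates the terms
   of [W], where the ratios are absent. *)
apply: (tannery ((1 + Cmod a) / Cmod (1 - a) * M1 * (M2 + 1) * (M4 * M3 + 1)) (Cmod z) (Cmod_ge_0 z) Hz1
  (fun n => phi_term q a b c d e f (s * q ^ n / q) (/ q ^ n)) (W_term q a b c d e f)) => //.
- by have H34 := Rmult_le_pos _ _ HM4 HM3; repeat apply: Rmult_le_pos => //; lra.
- move=> k.
  apply: (tends_ext_loc (fun n => (1 - a * (q ^ k) ^ 2) / (1 - a) * term_base q a b c d e f k
    * (qpoch q (s * q ^ n / q) k / qpoch q (a * q / / q ^ n) k)
    * (qpoch q q n / qpoch q z n * (qpoch q z (n - k)%nat / qpoch q q (n - k)%nat)) * z ^ k)).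
    exists k => n Hn; rewrite -{3 6}(Nat.sub_add k n Hn).
    by have := Eterm (n - k)%nat k; rewrite (Nat.sub_add k n Hn) => ->.
  rewrite EW; apply: tends_mult (tends_const _).
  rewrite -[X in tends _ _ X]Cmult_1_r -[X in tends _ _ (X * _)]Cmult_1_r.
  apply: tends_mult; first apply: tends_mult (tends_const _) _.
    replace (RtoC 1) with (qpoch q 0 k / qpoch q 0 k) by (rewrite qpoch_0; field; move/RtoC_inj; lra).
    apply: tends_div; [exact: qpoch_neq_0|exact: (tends_qpoch q _ _ Tg k)|exact: (tends_qpoch q _ _ Th k)].
  have N1 := qpoch_inf_neq_0 q hq1 _ Hz; have N3 := qpoch_inf_neq_0 q hq1 _ Hqq.
  replace (RtoC 1) with (qpoch_inf q q / qpoch_inf q z * (qpoch_inf q z / qpoch_inf q q)) by (field; done).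
  apply: tends_mult; first exact: tends_ratio_inf.
  by apply: tends_div => //; apply: tends_shift_back; apply: tends_qpoch_inf.
- exists N2 => n Hn k.
  have [Hle|Hlt] := Nat.le_gt_cases k n; last first.
    rewrite (phi_term_vanish _ _ _ _ _ _ _ _ _ n) //; last by apply: Cinv_l; apply: Cpow_nz.
    rewrite Cmod_0; apply: Rmult_le_pos; last by apply: pow_le; apply: Cmod_ge_0.
    by have H34 := Rmult_le_pos _ _ HM4 HM3; repeat apply: Rmult_le_pos => //; lra.
  have := Eterm (n - k)%nat k; rewrite (Nat.sub_add k n Hle) => ->.
  rewrite 4!Cmod_mult Cmod_pow; apply: Rmult_le_compat_r; first by apply: pow_le; apply: Cmod_ge_0.
  have P1 := Cmod_ge_0.
  apply: Rmult_le_compat => //; first by repeat apply: Rmult_le_pos.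
    apply: Rmult_le_compat => //; first by repeat apply: Rmult_le_pos.
      by apply: Rmult_le_compat => //; apply: vwp_factor_le.
    by have := H2 n Hn k; lra.
  apply: (Rle_trans _ (M4 * M3)); last lra.
  by rewrite Cmod_mult; apply: Rmult_le_compat.
- move=> k; rewrite EW 2!Cmod_mult Cmod_pow; apply: Rmult_le_compat_r.
    by apply: pow_le; apply: Cmod_ge_0.
  have HC := Rmult_le_pos _ _ HM0 HM1; have H34 := Rmult_le_pos _ _ HM4 HM3.
  apply: (Rle_trans _ ((1 + Cmod a) / Cmod (1 - a) * M1)).
    by apply: Rmult_le_compat; try exact: Cmod_ge_0; [exact: vwp_factor_le|].
  move: (_ * M1)%R HC => X HX.
  have := Rmult_le_pos _ _ HX HM2; have := Rmult_le_pos _ _ HX H34.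
  have := Rmult_le_pos _ _ (Rmult_le_pos _ _ HX HM2) H34; lra.
- exists 0%nat => n _; rewrite phi_seq_csum //; apply: csum_finite => k Hk.
  by apply: (phi_term_vanish _ _ _ _ _ _ _ _ _ n) => //; apply: Cinv_l; apply: Cpow_nz.
Qed.
End Continuation.

Lemma tends_seq_bounded (w : nat -> C) (l : C) :
  tends eventually w l -> exists B, forall n, (Cmod (w n) <= B)%R.
Proof.
move=> /tends_bounded [N HN].
exists (Cmod l + 1 + rsum (fun k => Cmod (w k)) N)%R => n.
have Hpos k := Cmod_ge_0 (w k); have Hs := rsum_ge_0 _ N Hpos.
have [Hle|Hlt] := Nat.le_gt_cases N n; first by have := HN n Hle; lra.
have := rsum_mono _ (S n) N Hpos Hlt; rewrite /=.
by have := rsum_ge_0 _ n Hpos; have := Cmod_ge_0 l; lra.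
Qed.

Lemma pow_n_Cpow (t : C) (k : nat) : pow_n (K := C_AbsRing) t k = t ^ k.
Proof. by elim: k => [//|k IH]; rewrite [LHS]/= IH. Qed.

(** At half the radius the terms are bounded, by convergence; at a quarter they are dominated by a
    multiple of [(1 / 2)^k], which gives the absolute bound required by [psb]. *)
Lemma is_pseries_germ (u : nat -> C) (g : C -> C) (r : R) :
  (0 < r)%R ->
  (forall t : C, (Cmod t < r)%R -> is_pseries (K := C_AbsRing) (V := C_NormedModule) u t (g t)) ->
  germ g.
Proof.
move=> Hr H.
have {}H t : (Cmod t < r)%R -> is_csum (fun k => u k * t ^ k) (g t).
  move=> /H /is_csum_series Ht; apply: tends_ext Ht => n; apply: csum_ext => k _.
  by rewrite pow_n_Cpow /scal /= /mult /=; ring.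
have Hc : (Cmod (r / 2)%R < r)%R by rewrite Cmod_R Rabs_pos_eq; lra.
have [B HB] : exists B, forall k, (Cmod (u k) * (r / 2) ^ k <= B)%R.
  have H0 : tends eventually (fun n => u n * RtoC (r / 2)%R ^ n) 0.
    replace (RtoC 0) with (g (r / 2)%R - g (r / 2)%R) by ring.
    apply: (tends_ext (fun n => csum (fun k => u k * RtoC (r / 2)%R ^ k) (S n) -
      csum (fun k => u k * RtoC (r / 2)%R ^ k) n)); first by move=> n /=; ring.
    apply: tends_minus (H _ Hc).
    by apply: (tends_subseq S _ _ _ (H _ Hc)) => n; lia.
  have [B HB] := tends_seq_bounded _ _ H0; exists B => k.
  by have := HB k; rewrite Cmod_mult Cmod_pow Cmod_R Rabs_pos_eq; [|lra].
have HB0 : (0 <= B)%R by apply: Rle_trans (HB 0%nat); rewrite /= Rmult_1_r; apply: Cmod_ge_0.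
exists (r / 4)%R, (B * / (1 - 1 / 2))%R; split; first lra.
exists u; split=> [n|t Ht]; last by apply: H; lra.
apply: (Rle_trans _ (rsum (fun k => B * (1 / 2) ^ k)%R n)).
  apply: rsum_le => k _; replace (r / 4)%R with (r / 2 * (1 / 2))%R by lra.
  rewrite Rpow_mult_distr -Rmult_assoc; apply: Rmult_le_compat_r (HB k).
  by apply: pow_le; lra.
rewrite rsum_scal; apply: Rmult_le_compat_l => //.
by apply: rsum_geom_le; lra.
Qed.

(* Nested thirds: the interval [[l, l + w]] is replaced by its left or right third, away from [u n]. *)
Fixpoint cantor_left (u : nat -> R) (n : nat) : R :=
  match n with
  | O => 0%R
  | S k => let l := cantor_left u k in let w := ((/ 3) ^ S k)%R in
           if Rlt_dec (l + 3 / 2 * w) (u k) is left _ then l else (l + 2 * w)%R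
  end.

Lemma exists_avoiding (u : nat -> R) : exists th : R, forall n, u n <> th.
Proof.
pose l := cantor_left u; pose w n := ((/ 3) ^ n)%R.
have Hw n : (0 < w n)%R by apply: pow_lt; lra.
have Hw3 n : (w n = 3 * w (S n))%R by rewrite /w /=; lra.
have Hstep n : (l n <= l (S n))%R /\ (l (S n) + w (S n) <= l n + w n)%R.
  have H1 := Hw n; have H2 := Hw3 n.
  rewrite /l [cantor_left u (S n)]/=; rewrite -[((/ 3) * (/ 3) ^ n)%R]/(w (S n)).
  by case: Rlt_dec => _; lra.
have Hnest n m : (n <= m)%nat -> (l n <= l m)%R /\ (l m + w m <= l n + w n)%R.
  elim=> [|k Hk [IH1 IH2]]; first lra.
  by have [H1 H2] := Hstep k; lra.
have [th [Hub Hlub]] := completeness (fun x => exists n, x = l n)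
  ltac:(exists (l 0%nat + w 0%nat)%R => x [n ->]; have := Hnest 0%nat n ltac:(lia); have := Hw n; lra)
  ltac:(by exists (l 0%nat); exists 0%nat).
have Hin n : (l n <= th <= l n + w n)%R.
  split; first by apply: Hub; exists n.
  apply: Hlub => x [m ->]; have [Hle|Hle] := Nat.le_ge_cases n m.
    by have := Hnest n m Hle; have := Hw m; lra.
  by have := Hnest m n Hle; have := Hw n; lra.
exists th => n E; have := Hin (S n); have H3 := Hw (S n).
rewrite /l [cantor_left u (S n)]/=; rewrite -[((/ 3) * (/ 3) ^ n)%R]/(w (S n)) E -/l.
by case: Rlt_dec => H4; lra.
Qed.

(** It suffices that [th] differs from the countably many slopes of the points. Where [Re (P n) = 0]
    the quotient is a default value, harmless because such a point is no positive multiple of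
    [(1, th)]. *)
Lemma avoid_direction (P : nat -> C) :
  exists th : R, forall (n : nat) (t : R), (0 < t)%R -> P n <> t * (1, th)%C.
Proof.
have [th Hth] := exists_avoiding (fun n => Im (P n) / Re (P n))%R.
exists th => n t Ht E; apply: (Hth n); rewrite E /Re /Im /=.
by field; lra.
Qed.

(** * Analytic continuation along a ray in [b] *)

Section Continuation.
Variables (q a : C) (W : C -> C -> C -> C -> C -> C -> C).
Hypothesis hq1 : (Cmod q < 1)%R.
Hypothesis hq0 : q <> 0.
Hypothesis ha0 : a <> 0.
Hypothesis ha : no_pole q a.
Hypothesis hW : is_W_continuation q W.

Lemma admissible_domain (b c d e f : C) : admissible q a b c d e f -> W_domain q a b c d e f.
Proof.
move=> [Hxs [Hp [Hz _]]]; split=> //; split.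
  by have := ha 0%nat; rewrite /= Cmult_1_r.
by split=> //; apply: Forall_and.
Qed.

Lemma W_line_germ (b c d e f be : C) :
  admissible q a b c d e f -> germ (fun u => W a (b + u * be) c d e f).
Proof.
move=> /admissible_domain Hdom; have [Han _] := hW.
have [u [r H]] := Han _ _ _ _ _ _ Hdom 0 be 0 0 0 0.
apply: (is_pseries_germ u _ r (cond_pos r)) => t Ht.
have := H t Ht; have E x : x + t * 0 = x by ring.
by rewrite !E.
Qed.

Lemma phi_seq_limit_small (b c d e f : C) :
  admissible q a b c d e f -> (Cmod (a ^ 2 * q ^ 2 / (b * c * d * e * f)) < 1)%R ->
  tends eventually (phi_seq q a b c d e f) (W a b c d e f).
Proof.
move=> Hadm Hz; apply: phi_seq_tannery => //.
have [_ Hser] := hW; apply/is_csum_series; apply: Hser; first exact: admissible_domain.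
move: Hadm => [Hxs _]; move: Hxs; rewrite !List.Forall_cons_iff => -[Hb [Hc [Hd [He [Hf _]]]]].
rewrite s_param_z // Cmod_mult (Cmult_comm q).
have : (0 < Cmod (a * q))%R by apply/Cmod_gt_0; nz.
nra.
Qed.

(** Far out on the ray the series for [W] converges. At the left end of the half-line on which the
    limit is known to be [W], the local limit [G] agrees with [W] to the right, hence on a disk; so
    the end can be moved further left until it reaches the given point. *)
Lemma phi_seq_limit (b c d e f : C) :
  admissible q a b c d e f ->
  tends eventually (phi_seq q a b c d e f) (W a b c d e f).
Proof.
move=> Hadm; have [Hxs [Hp [Hz Hz']]] := Hadm.
move: (Hxs) (Hp); rewrite !List.Forall_cons_iff.
move=> -[Hb [Hc [Hd [He [Hf _]]]]] [Pb [Pc [Pd [Pe [Pf _]]]]].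
set z := a ^ 2 * q ^ 2 / (b * c * d * e * f) in Hz Hz'.
have Hz0 : z <> 0 by rewrite /z; nz.
(* The values of [1 + t tau] at which the moved parameters would stop being admissible, minus 1: the
   families [a q / b * q^k], [z q^k] and [z / q^k], interleaved modulo 3. *)
pose P n := match n mod 3 with
  | O => a * q / b * q ^ (n / 3) - 1 | S O => z * q ^ (n / 3) - 1 | _ => z / q ^ (n / 3) - 1 end.
have [th Hth] := avoid_direction P.
have HP0 k : P (3 * k)%nat = a * q / b * q ^ k - 1.
  by rewrite /P Nat.mul_comm Nat.Div0.mod_mul Nat.div_mul.
have HP1 k : P (1 + k * 3)%nat = z * q ^ k - 1.
  by rewrite /P Nat.Div0.mod_add Nat.div_add.
have HP2 k : P (2 + k * 3)%nat = z / q ^ k - 1.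
  by rewrite /P Nat.Div0.mod_add Nat.div_add.
(* Large enough that [|1 + t tau| >= 1 + t M > |z|] for [t >= 1 / 2], so that the moved argument
   [z / (1 + t tau)] lies in the unit disk. *)
pose M := (2 * Cmod z + 1)%R; have HM : (0 < M)%R by rewrite /M; have := Cmod_ge_0 z; lra.
pose dir : C := (1, th)%R.
pose tau := RtoC M * dir.
pose be := b * tau.
have Havoid n (t : R) : (0 < t)%R -> P n <> t * tau.
  move=> Ht E; apply: (Hth n (t * M)%R); first by apply: Rmult_lt_0_compat.
  by rewrite E /tau RtoC_mult /dir; ring.
have Htau (t : R) : Re (1 + t * tau) = (1 + t * M)%R by rewrite /Re /tau /dir /=; ring.
have Hge (t : R) : (0 <= t)%R -> (1 + t * M <= Cmod (1 + t * tau))%R.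
  move=> Ht; have := re_le_Cmod (1 + t * tau); rewrite Htau Rabs_pos_eq //.
  by have := Rmult_le_pos _ _ Ht (Rlt_le _ _ HM); lra.
have H1t (t : R) : (0 <= t)%R -> 1 + t * tau <> 0.
  move=> Ht E; have := Hge t Ht; rewrite E Cmod_0.
  by have := Rmult_le_pos _ _ Ht (Rlt_le _ _ HM); lra.
have Ebt (t : R) : b + t * be = b * (1 + t * tau) by rewrite /be; ring.
have Ezt (t : R) : (0 <= t)%R ->
    a ^ 2 * q ^ 2 / ((b + t * be) * c * d * e * f) = z / (1 + t * tau).
  by move=> Ht; have H := H1t t Ht; rewrite Ebt /z; field; repeat split.
have Hpath (t : R) : (0 <= t)%R -> admissible q a (b + t * be) c d e f.
  move=> Ht; have [<-|Hlt] := Req_dec 0 t.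
    by replace (b + 0 * be) with b by ring.
  have {Hlt}Ht0 : (0 < t)%R by lra.
  have H1 := H1t t Ht; rewrite /admissible Ezt // !List.Forall_cons_iff Ebt.
  have Hneq n x : x - 1 = P n -> x <> 1 + t * tau.
    by move=> E Ex; apply: (Havoid n t Ht0); rewrite -E Ex; ring.
  move: (1 + t * tau) H1 Hneq => T H1 Hneq.
  split; [by repeat split=> //; nz|split; [split; [|by []]|split]] => k E.
  - apply: (Hneq (3 * k)%nat (a * q / b * q ^ k)); first by rewrite HP0.
    by transitivity (a * q / (b * T) * q ^ k * T); [field|rewrite E; ring].
  - apply: (Hneq (1 + k * 3)%nat (z * q ^ k)); first by rewrite HP1.
    by transitivity (z / T * q ^ k * T); [field|rewrite E; ring].
  - have Hk := Cpow_nz q k hq0; apply: (Hneq (2 + k * 3)%nat (z / q ^ k)); first by rewrite HP2.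
    transitivity (z / q ^ k * (/ (z / T) * q ^ k)); first by rewrite E; ring.
    by field; repeat split.
have Hend (t : R) : (1 / 2 <= t)%R ->
    tends eventually (phi_seq q a (b + t * be) c d e f) (W a (b + t * be) c d e f).
  move=> Ht; have Ht0 : (0 <= t)%R by lra.
  apply: phi_seq_limit_small; first exact: Hpath.
  rewrite Ezt // Cmod_div; last exact: H1t.
  have H := Hge t Ht0.
  apply/Rlt_div_l; first by have := Rmult_le_pos _ _ Ht0 (Rlt_le _ _ HM); lra.
  have : (1 / 2 * M <= t * M)%R by apply: Rmult_le_compat_r; lra.
  rewrite /M in H *; lra.
pose good (t : R) := tends eventually (phi_seq q a (b + t * be) c d e f) (W a (b + t * be) c d e f).
(* The number [x] measures how far to the left of 1 the limit is known: on [t >= 1 - x]. The aim is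
   [x = 1], that is [t = 0]. *)
pose E x := (0 <= x <= 1)%R /\ forall t, (1 - x <= t)%R -> good t.
have HE : E (1 / 2)%R by split; [lra|move=> t Ht; apply: Hend; lra].
have Hbd : bound E by exists 1%R => x [[_ Hx] _].
have [x [Hub Hlub]] := completeness E Hbd (ex_intro _ _ HE).
have Hx1 : (1 / 2 <= x)%R := Hub _ HE.
have Hx2 : (x <= 1)%R by apply: Hlub => y [[_ Hy] _].
have Hright t : (1 - x < t)%R -> good t.
  move=> Ht; apply: NNPP => Hn; have : (x <= 1 - t)%R; last lra.
  apply: Hlub => y [_ Hy]; have [//|Hlt] := Rle_lt_dec y (1 - t).
  by case: Hn; apply: Hy; lra.
pose t0 := (1 - x)%R; have Ht0 : (0 <= t0)%R by rewrite /t0; lra.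
have [r1 [M1 [G [Hr1 [HG HGl]]]]] := phi_limit_local q a hq1 hq0 ha0 ha _ _ _ _ _ be (Hpath t0 Ht0).
have HWg := W_line_germ _ _ _ _ _ be (Hpath t0 Ht0).
have HGg : germ G by exists r1, M1.
have [r2 [M2 [N2 [Hr2 [HG2 HW2]]]]] := germ_common _ _ HGg HWg.
pose r := Rmin r1 r2; have Hr : (0 < r)%R := Rmin_pos _ _ Hr1 Hr2.
have Hrl := Rmin_l r1 r2; have Hrr := Rmin_r r1 r2; rewrite -/r in Hrl Hrr.
have Hshift (u : R) : b + t0 * be + u * be = b + (t0 + u)%R * be by rewrite RtoC_plus; ring.
(* Identity theorem: for small real [v > 0] both functions are limits of the same sequence. *)
have HGW (u : C) : (Cmod u <= r)%R -> G u - W a (b + t0 * be + u * be) c d e f = 0.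
  apply: (psb_unique r Hr (M2 + N2) r (fun u => G u - W a (b + t0 * be + u * be) c d e f)) => //.
    by apply: psb_minus => //; apply: (psb_shrink r2) => //; lra.
  move=> v Hv; have Hvr : (Cmod v <= r1)%R by rewrite Cmod_R Rabs_pos_eq; lra.
  have H1 := HGl v Hvr; rewrite Hshift in H1 *.
  rewrite (tends_unique _ _ _ H1 (Hright (t0 + v)%R _)); last by rewrite /t0; lra.
  by ring.
have Hleft (u : R) : (Rabs u <= r)%R -> good (t0 + u)%R.
  move=> Hu; have Hur : (Cmod u <= r)%R by rewrite Cmod_R.
  rewrite /good -Hshift; have E0 := HGW u Hur.
  have -> : W a (b + t0 * be + u * be) c d e f = G u.
    by rewrite -[LHS]Cplus_0_l -E0; ring.
  by apply: HGl; lra.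
have Hx : x = 1%R.
  apply: Rle_antisym => //; apply: Rnot_lt_le => Hlt.
  pose y := Rmin 1 (x + r).
  have Hy1 : (y <= 1)%R := Rmin_l _ _; have Hy2 : (y <= x + r)%R := Rmin_r _ _.
  have Hy3 : (x < y)%R by apply: Rmin_glb_lt; lra.
  suff : E y by move=> /Hub; lra.
  split=> [|t Ht]; first lra.
  have [Hgt|Hle] := Rlt_le_dec (1 - x) t; first exact: Hright.
  replace t with (t0 + (t - t0))%R by ring; apply: Hleft.
  by rewrite /t0; apply: Rabs_le; lra.
have := Hleft 0%R ltac:(rewrite Rabs_R0; lra).
rewrite /good; have -> : (t0 + 0 = 0)%R by rewrite /t0 Hx; ring.
by replace (b + 0 * be) with b by ring.
Qed.
End Continuation.

(** * The recurrence in a complex variable *)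

(** For [q <> 0]: [y] is not an integral power of [q], negative exponents being moved to the other
    side. [lattice] is the complementary property. *)
Definition off_lattice (q y : C) : Prop := forall k : nat, y * q ^ k <> 1 /\ y <> q ^ k.

Definition lattice (q y : C) : Prop := exists i j : nat, y * q ^ i = q ^ j.

Section Lattice.
Variable q : C.
Hypothesis hq0 : q <> 0.

Lemma off_lattice_mulq (y : C) : off_lattice q y -> off_lattice q (y * q).
Proof.
move=> H k; split=> E.
  by apply: (proj1 (H (S k))); rewrite /= -E; ring.
case: k E => [|k] E.
  by apply: (proj1 (H 1%nat)); rewrite /= Cmult_1_r E.
apply: (proj2 (H k)); replace y with (y * q / q) by (field; done).
by rewrite E /=; field.
Qed.

Lemma off_lattice_divq (y : C) : off_lattice q y -> off_lattice q (y / q).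
Proof.
move=> H k; split=> E; last first.
  by apply: (proj2 (H (S k))); rewrite /= -E; field.
case: k E => [|k] E.
  apply: (proj2 (H 1%nat)); rewrite /= in E.
  replace y with (y / q * 1 * q) by (field; done).
  by rewrite E /=; ring.
by apply: (proj1 (H k)); rewrite -E /=; field.
Qed.

Lemma off_lattice_mul_pow (y : C) (k : nat) : off_lattice q y -> off_lattice q (y * q ^ k).
Proof.
move=> H; elim: k => [|k IH]; first by rewrite /= Cmult_1_r.
have -> : y * q ^ S k = y * q ^ k * q by rewrite /=; ring.
exact: off_lattice_mulq.
Qed.

Lemma off_lattice_div_pow (y : C) (k : nat) : off_lattice q y -> off_lattice q (y / q ^ k).
Proof.
move=> H; have Hk := Cpow_nz q k hq0; elim: k Hk => [|k IH] Hk.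
  by replace (y / q ^ 0) with y by (rewrite /=; field).
have Hk' := Cpow_nz q k hq0.
replace (y / q ^ S k) with (y / q ^ k / q) by (rewrite /=; field; done).
by apply: off_lattice_divq; apply: IH.
Qed.

Lemma off_lattice_inv (y : C) : y <> 0 -> off_lattice q y -> off_lattice q (/ y).
Proof.
move=> Hy H k; split=> E.
  by apply: (proj2 (H k)); transitivity (y * (/ y * q ^ k)); [rewrite E; ring|field].
by apply: (proj1 (H k)); rewrite -E; field.
Qed.

Lemma off_lattice_neq (y : C) : off_lattice q y -> 1 - y <> 0.
Proof. by move=> H; apply/one_minus_neq_0 => E; apply: (proj2 (H 0%nat)). Qed.

Lemma off_lattice_no_pole (y : C) : off_lattice q y -> no_pole q y.
Proof. by move=> H k; apply: (proj1 (H k)). Qed.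
Lemma lattice_neq_0 (y : C) : lattice q y -> y <> 0.
Proof.
move=> [i [j E]] E0; apply: (Cpow_nz q j hq0).
by rewrite -E E0; ring.
Qed.

Lemma lattice_pow (k : nat) : lattice q (q ^ k).
Proof. by exists 0%nat, k; rewrite /=; ring. Qed.

Lemma lattice_q : lattice q q.
Proof. by exists 0%nat, 1%nat; rewrite /=; ring. Qed.

Lemma lattice_mult (x y : C) : lattice q x -> lattice q y -> lattice q (x * y).
Proof.
move=> [i [j E]] [k [l E']]; exists (i + k)%nat, (j + l)%nat.
by rewrite !Cpow_add_r -E -E'; ring.
Qed.

Lemma lattice_inv (x : C) : lattice q x -> lattice q (/ x).
Proof.
move=> Hx; have Hx0 := lattice_neq_0 _ Hx; move: Hx => [i [j E]]; exists j, i.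
by rewrite -E; field.
Qed.

Lemma lattice_div (x y : C) : lattice q x -> lattice q y -> lattice q (x / y).
Proof. by move=> Hx Hy; apply: lattice_mult => //; apply: lattice_inv. Qed.

(** The integral powers of [q] form a group, and its complement is a union of cosets. With [s] in
    the group, this settles the denominators that involve [a] or some [a / x]. *)
Lemma off_lattice_mult (y l : C) : off_lattice q y -> lattice q l -> off_lattice q (y * l).
Proof.
move=> Hy [i [j E]]; have Hi := Cpow_nz q i hq0.
replace (y * l) with (y * q ^ j / q ^ i) by (rewrite -E; field; done).
by apply: off_lattice_div_pow; apply: off_lattice_mul_pow.
Qed.
End Lattice.

Section Prefactor.
Variables (q a b c d e f : C).
Hypothesis hq1 : (Cmod q < 1)%R.
Hypothesis hq0 : q <> 0.
Hypothesis ha0 : a <> 0.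
Hypothesis ha1 : 1 - a <> 0.
Let xs := [b; c; d; e; f].
Let s := s_param q a b c d e f.
Hypothesis hxs : List.Forall (fun x : C => x <> 0) xs.
Hypothesis hpole : List.Forall (fun x => no_pole q (a * q / x)) xs.

(* With [N = q^n], [X_n^(1)] is an elementary factor times [sol N], while [a_n] and [b_n] are
   [rec_a N] and [rec_b N] times monomials in [N]. *)
Definition pref (N : C) : C :=
  qpoch_inf q (s * N ^ 2 / q) * qpoch_inf q (a * q * N)
  / (qpoch_inf q (s * N / q) * qpoch_inf q (s * N / (a * q))
     * prodl (fun x => qpoch_inf q (a * q * N / x)) xs).

Definition sol (N : C) : C := pref N * phi q a b c d e f (s * N / q) (/ N).

Definition rec_a (N : C) : C :=
  ((1 - N * (s / q)) * (1 - N * (s / (a * q))) * (1 - N * (s / (a * q ^ 2)))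
     * prodl (fun x => 1 - N * (a * q / x)) xs / (1 - N ^ 2 * s)
   + q * ((1 - N) * (1 - N * a) * (1 - N * (a * q))
     * prodl (fun x => 1 - N * (s * x / (a * q ^ 2))) xs / (1 - N ^ 2 * (s / q ^ 2)))
   + s * N ^ 2 / (a * q) * (1 - N ^ 2 * (s / q)) * (1 - s / (a * q ^ 2)) * prodl (fun x => 1 - x) xs)
  / ((1 - N ^ 2 * (s / q)) * (1 - N * (s / (a * q ^ 2))) * (1 - N * (a * q))).

Definition rec_b (N : C) : C :=
  (1 - N) * (1 - N * (s / q ^ 2)) * prodl (fun x => 1 - N * (a / x)) xs
  * prodl (fun x => 1 - N * (s * x / (a * q ^ 2))) xs
  / ((1 - N ^ 2 * (s / q)) * (1 - N ^ 2 * (s / q ^ 2)) ^ 2 * (1 - N ^ 2 * (s / q ^ 3))).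

(** The boundary value times the normalizing factor of the recurrence. The products
    [(s N / q)_infinity] and [(a q^2 N)_infinity] have been cancelled against the prefactor, so that
    no denominator vanishes when [N] becomes an integral power of [q]. *)
Definition rec_error (N : C) : C :=
  s * (s - a * q ^ 2) / (a ^ 2 * q ^ 3) * N ^ 2
  * (qpoch_inf q (a * q) / qpoch_inf q q
     * prodl (fun x => qpoch_inf q x / qpoch_inf q (a * q / x)) xs)
  * (qpoch_inf q (s * N ^ 2 / q) * qpoch_inf q (/ N))
  / (qpoch_inf q (s * N / (a * q ^ 2)) * qpoch_inf q (a * q ^ 3 / (s * N))
     * prodl (fun x => qpoch_inf q (a * q * N / x)) xs).

Lemma pref_up (N : C) :
  1 - N ^ 2 * (s / q) <> 0 -> 1 - N ^ 2 * s <> 0 -> 1 - N * (a * q) <> 0 ->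
  no_pole q (s * N / q) -> no_pole q (s * N / (a * q)) ->
  List.Forall (fun x => no_pole q (a * q * N / x)) xs ->
  pref (N * q) = pref N * ((1 - N * (s / q)) * (1 - N * (s / (a * q)))
    * prodl (fun x => 1 - N * (a * q / x)) xs
    / ((1 - N ^ 2 * (s / q)) * (1 - N ^ 2 * s) * (1 - N * (a * q)))).
Proof.
move=> H1 H2 H3 P1 P2 P3; rewrite /pref.
have st := qpoch_inf_step q hq1.
have inf0 := qpoch_inf_neq_0 q hq1.
have -> : qpoch_inf q (s * N ^ 2 / q) =
    (1 - N ^ 2 * (s / q)) * ((1 - N ^ 2 * s) * qpoch_inf q (s * (N * q) ^ 2 / q)).
  rewrite (st (s * N ^ 2 / q)) (st (s * N ^ 2 / q * q)); congr Cmult; first by rewrite /=; field.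
  by congr Cmult; [|congr qpoch_inf]; rewrite /=; field.
have -> : qpoch_inf q (a * q * N) = (1 - N * (a * q)) * qpoch_inf q (a * q * (N * q)).
  by rewrite st; congr Cmult; [ring|congr qpoch_inf; ring].
have E1 : qpoch_inf q (s * N / q) = (1 - N * (s / q)) * qpoch_inf q (s * (N * q) / q).
  by rewrite st; congr Cmult; [field|congr qpoch_inf; field].
have E2 : qpoch_inf q (s * N / (a * q)) = (1 - N * (s / (a * q))) * qpoch_inf q (s * (N * q) / (a * q)).
  by rewrite st; congr Cmult; [field; split|congr qpoch_inf; field; split].
have E3 : prodl (fun x => qpoch_inf q (a * q * N / x)) xs =
    prodl (fun x => 1 - N * (a * q / x)) xs * prodl (fun x => qpoch_inf q (a * q * (N * q) / x)) xs.
  rewrite -prodl_mult; apply: prodl_ext_in; apply: List.Forall_impl hxs => x Hx.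
  by rewrite st; congr Cmult; [field|congr qpoch_inf; field].
have N1 := inf0 _ P1; have N2 := inf0 _ P2.
have N3 : prodl (fun x => qpoch_inf q (a * q * N / x)) xs <> 0.
  by apply: prodl_neq_0; apply: List.Forall_impl P3 => x; apply: inf0.
move: N1 N2 N3; rewrite E1 E2 E3.
move: (1 - N * (s / q)) (1 - N * (s / (a * q))) (prodl (fun x => 1 - N * (a * q / x)) xs).
move: (qpoch_inf q (s * (N * q) / q)) (qpoch_inf q (s * (N * q) / (a * q))) (prodl _ xs) => U V T A B D N1 N2 N3.
have nl (x y : C) : x * y <> 0 -> x <> 0 /\ y <> 0.
  by move=> H; split=> E; apply: H; rewrite E; ring.
have [? ?] := nl _ _ N1; have [? ?] := nl _ _ N2; have [? ?] := nl _ _ N3.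
move: (1 - N ^ 2 * (s / q)) (1 - N ^ 2 * s) (1 - N * (a * q)) H1 H2 H3 => x y z *.
by field; repeat split.
Qed.

(** Sufficient for the recurrence at [N], with its neighbours [N q] and [N / q]. Integral exponents
    are excluded because [N] and [N^2] are off the lattice; they are reached only as limits. *)
Definition regular (N : C) : Prop :=
  N <> 0 /\ lattice q s /\ off_lattice q N /\ off_lattice q (N ^ 2) /\
  no_pole q (s * N / (a * q ^ 2)) /\ List.Forall (fun x => no_pole q (a * N / x)) xs /\
  no_pole q (a * q / (s * N)) /\ no_pole q (a * N) /\ s - a * q ^ 2 <> 0.

Lemma s_neq_0 : s <> 0.
Proof.
move: hxs; rewrite !List.Forall_cons_iff => -[Hb [Hc [Hd [He [Hf _]]]]].
by rewrite /s /s_param; nz.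
Qed.

Lemma regular_neq_0 (N : C) : regular N ->
  (forall k, 1 - N * (s / q ^ k) <> 0) /\ (forall k, 1 - N ^ 2 * (s / q ^ k) <> 0) /\
  1 - N <> 0 /\ 1 - N * a <> 0 /\ 1 - N * (a * q) <> 0 /\
  1 - N * (s / (a * q ^ 2)) <> 0 /\ 1 - N * (s / (a * q)) <> 0.
Proof.
move=> [HN [Hs [O1 [O2 [P1 [_ [_ [P4 _]]]]]]]].
have Off (y : C) (k : nat) : off_lattice q y -> 1 - y * (s / q ^ k) <> 0.
  move=> Hy; apply: (off_lattice_neq q); apply: off_lattice_mult => //.
  by apply: lattice_div => //; apply: lattice_pow.
split; [|split; [|split; [|split; [|split; [|split]]]]].
- by move=> k; apply: Off.
- by move=> k; apply: Off.
- exact: (off_lattice_neq q).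
- by rewrite Cmult_comm; apply: no_pole_1m P4.
- by replace (N * (a * q)) with (a * N * q) by ring; apply: no_pole_1m (no_pole_shift _ _ P4).
- by replace (N * (s / (a * q ^ 2))) with (s * N / (a * q ^ 2)) by (field; done); apply: no_pole_1m P1.
- replace (N * (s / (a * q))) with (s * N / (a * q ^ 2) * q) by (rewrite /=; field; done).
  exact: no_pole_1m (no_pole_shift _ _ P1).
Qed.

(** The contiguous relation for [g = s N / q], [h = 1 / N], where moving [g] up and [h] down amounts
    to [N q] in place of [N]. The factor [q] before [rec_b] is the ratio of consecutive values of
    [scale_step]. *)
Lemma sol_relation (N : C) : regular N ->
  sol (N * q) - rec_a N * sol N + q * rec_b N * sol (N / q) = rec_error N.
Proof.
move=> HR; have [A [B [C0 [C1 [C2 [A3 A4]]]]]] := regular_neq_0 _ HR.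
move: HR => [HN [Hs [O1 [O2 [P1 [P2 [P3 [P4 HM]]]]]]]].
have Hs0 := s_neq_0.
have A1 : 1 - N * (s / q) <> 0 by have := A 1%nat; rewrite [q ^ 1]/= Cmult_1_r.
have A2 := A 2%nat.
have B0 : 1 - N ^ 2 * s <> 0.
  by have := B 0%nat; replace (s / q ^ 0) with s by (rewrite /=; field).
have B1 : 1 - N ^ 2 * (s / q) <> 0 by have := B 1%nat; rewrite [q ^ 1]/= Cmult_1_r.
have B2 := B 2%nat; have B3 := B 3%nat.
have P0 : no_pole q (s * N / q).
  apply: off_lattice_no_pole; replace (s * N / q) with (N * (s / q)) by (field; done).
  by apply: off_lattice_mult => //; apply: lattice_div => //; apply: lattice_q.
have P00 : no_pole q (s * N / q ^ 2).
  apply: off_lattice_no_pole; replace (s * N / q ^ 2) with (N * (s / q ^ 2)) by (rewrite /=; field; done).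
  by apply: off_lattice_mult => //; apply: lattice_div => //; apply: lattice_pow.
have P4' := no_pole_shift _ _ P4.
have P1' := no_pole_shift _ _ P1.
have EP1 : s * N / (a * q ^ 2) * q = s * N / (a * q) by rewrite /=; field; split.
rewrite EP1 in P1'.
have P2' : List.Forall (fun x => no_pole q (a * q * N / x)) xs.
  apply: List.Forall_impl (Forall_and hxs P2) => x [Hx /no_pole_shift].
  by replace (a * N / x * q) with (a * q * N / x) by (field; done).
have RX : prodl (fun x => 1 - N * (a / x)) xs <> 0.
  apply: prodl_neq_0; apply: List.Forall_impl (Forall_and hxs P2) => x [Hx /no_pole_1m].
  by replace (a * N / x) with (N * (a / x)) by (field; done).
have Eup : pref (N * q) = pref N * ((1 - N * (s / q)) * (1 - N * (s / (a * q)))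
    * prodl (fun x => 1 - N * (a * q / x)) xs
    / ((1 - N ^ 2 * (s / q)) * (1 - N ^ 2 * s) * (1 - N * (a * q)))).
  exact: pref_up.
have Edn : pref (N / q) = pref N * ((1 - N ^ 2 * (s / q ^ 3)) * (1 - N ^ 2 * (s / q ^ 2)) * (1 - N * a)
    / ((1 - N * (s / q ^ 2)) * (1 - N * (s / (a * q ^ 2))) * prodl (fun x => 1 - N * (a / x)) xs)).
  have := pref_up (N / q).
  have -> : (N / q) ^ 2 * (s / q) = N ^ 2 * (s / q ^ 3) by rewrite /=; field.
  have -> : (N / q) ^ 2 * s = N ^ 2 * (s / q ^ 2) by rewrite /=; field.
  have -> : N / q * (a * q) = N * a by field.
  have -> : s * (N / q) / q = s * N / q ^ 2 by rewrite /=; field.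
  have -> : s * (N / q) / (a * q) = s * N / (a * q ^ 2) by rewrite /=; field; split.
  have -> : N / q * q = N by field.
  have -> : N / q * (s / q) = N * (s / q ^ 2) by rewrite /=; field.
  have -> : N / q * (s / (a * q)) = N * (s / (a * q ^ 2)) by rewrite /=; field; split.
  have -> : prodl (fun x => 1 - N / q * (a * q / x)) xs = prodl (fun x => 1 - N * (a / x)) xs.
    by apply: prodl_ext_in; apply: List.Forall_impl hxs => x Hx; field; split.
  move=> -> //; last first.
    apply: List.Forall_impl (Forall_and hxs P2) => x [Hx].
    by replace (a * q * (N / q) / x) with (a * N / x) by (field; done).
  move: (1 - N ^ 2 * (s / q ^ 3)) B3 (1 - N ^ 2 * (s / q ^ 2)) B2 (1 - N * a) C1 => x Hx y Hy z Hz.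
  move: (1 - N * (s / q ^ 2)) A2 (1 - N * (s / (a * q ^ 2))) A3 (prodl _ xs) RX => u Hu v Hv w Hw.
  by field; repeat split.
have Hgen : contig_generic q a (s * N / q) (/ N).
  have HiN : - / N <> 0.
    have : / N <> 0 by nz.
    by move=> H E; apply: H; replace (/ N) with (- - / N) by ring; rewrite E; ring.
  have Cq : 1 - N * q <> 0.
    by apply: (off_lattice_neq q); apply: off_lattice_mulq.
  split; [split; [by nz|split; [by nz|repeat split]]|split; [repeat split|split]].
  - by replace (1 - s * N / q) with (1 - N * (s / q)) by (field; done).
  - by replace (1 - / N) with ((1 - N) * - / N) by (field; done); nz.
  - by replace (q - s * N / q) with (q * (1 - N * (s / q ^ 2))) by (rewrite /=; field; done); nz.
  - by replace (q - / N) with ((1 - N * q) * - / N) by (field; done); nz.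
  - by replace (/ N - s * N / q * q) with ((1 - N ^ 2 * s) * / N) by (rewrite /=; field; done); nz.
  - by replace (/ N - s * N / q) with ((1 - N ^ 2 * (s / q)) * / N) by (rewrite /=; field; done); nz.
  - replace (s * N / q * / N - a * q) with ((s - a * q ^ 2) / q) by (rewrite /=; field; done).
    by nz.
  - by replace (s * N / q - / N * q) with (q * (1 - N ^ 2 * (s / q ^ 2)) * - / N)
      by (rewrite /=; field; done); nz.
  - by replace (a / (s * N / q)) with (a * q / (s * N)) by (field; done).
  - by replace (a / / N) with (a * N) by (field; done).
have Hbal : b * c * d * e * f * (s * N / q) * / N = a ^ 3 * q ^ 2.
  move: hxs; rewrite !List.Forall_cons_iff => -[Hb [Hc [Hd [He [Hf _]]]]].
  by rewrite /s /s_param; field; repeat split.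
have E := contig_relation q a b c d e f hq1 hq0 ha0 ha1 hxs hpole _ _ Hbal Hgen.
rewrite -/xs contig_up // contig_down // -/s in E.
rewrite /sol Eup Edn.
have -> : s * (N * q) / q = s * N / q * q by field.
have -> : / (N * q) = / N / q by field; split.
have -> : s * (N / q) / q = s * N / q / q by field.
have -> : / (N / q) = / N * q by field; split.
move: E; set X := phi _ _ _ _ _ _ _ (_ * q) _; set Y := phi _ _ _ _ _ _ _ _ (/ N); set Z := phi _ _ _ _ _ _ _ (_ / q) _ => E.
(* The factor before [boundary] is the one that reduces the coefficient of [sol (N * q)] to 1. *)
transitivity (pref N * (s * N ^ 2 * (s - a * q ^ 2) / (a ^ 2 * q ^ 3)
   / ((1 - N * (s / (a * q ^ 2))) * (1 - N * (a * q)))) * boundary q a b c d e f (s * N / q) (/ N)).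
  rewrite -E /rec_a /rec_b.
  have -> : 1 - s / (a * q ^ 2) = - (s - a * q ^ 2) / (a * q ^ 2) by field.
  move: (pref N) (prodl (fun x => 1 - N * (a * q / x)) xs) (prodl (fun x => 1 - N * (s * x / (a * q ^ 2))) xs) => V QQ PP.
  move: (prodl (fun x => 1 - x) xs) => RR.
  move: (prodl (fun x => 1 - N * (a / x)) xs) RX => T RX.
  move: (1 - N * (s / q)) A1 (1 - N * (s / (a * q))) A4 (1 - N * (s / (a * q ^ 2))) A3 (1 - N * (s / q ^ 2)) A2 => u1 A1 u2 A4 u3 A3 u4 A2.
  move: (1 - N ^ 2 * s) B0 (1 - N ^ 2 * (s / q)) B1 (1 - N ^ 2 * (s / q ^ 2)) B2 (1 - N ^ 2 * (s / q ^ 3)) B3 => v0 B0 v1 B1 v2 B2 v3 B3.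
  move: (1 - N * a) C1 (1 - N * (a * q)) C2 (s - a * q ^ 2) HM => w1 C1 w2 C2 M HM.
  clear - ha0 hq0 HN Hs0 RX A1 A2 A3 A4 B0 B1 B2 B3 C1 C2 HM.
  move: (s) Hs0 => s1 Hs1.
  by field; repeat split.
have inf0 := qpoch_inf_neq_0 q hq1.
have P3' : no_pole q (a * q ^ 3 / (s * N)).
  have := no_pole_shift _ _ (no_pole_shift _ _ P3).
  by replace (a * q / (s * N) * q * q) with (a * q ^ 3 / (s * N)) by (rewrite /=; field; done).
have P5 : no_pole q (a * q * N * q).
  by have := no_pole_shift _ _ P4'; replace (a * N * q * q) with (a * q * N * q) by ring.
have N1 := inf0 _ P0.
have N2 := inf0 _ P1'; have N3 := inf0 _ P3'; have N4 := inf0 _ P5.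
have N5 : prodl (fun x => qpoch_inf q (a * q * N / x)) xs <> 0.
  by apply: prodl_neq_0; apply: List.Forall_impl P2' => x; apply: inf0.
have N6 := inf0 _ (no_pole_q q hq1).
rewrite /rec_error /pref /boundary -/xs.
rewrite (qpoch_inf_step q hq1 (s * N / (a * q ^ 2))) (qpoch_inf_step q hq1 (a * q * N)) EP1.
have -> : a * q ^ 2 / (s * N / q) = a * q ^ 3 / (s * N) by rewrite /=; field; repeat split.
have -> : a * q ^ 2 / / N = a * q * N * q by rewrite /=; field.
have -> : 1 - s * N / (a * q ^ 2) = 1 - N * (s / (a * q ^ 2)) by field.
have -> : 1 - a * q * N = 1 - N * (a * q) by ring.
move: (1 - N * (s / (a * q ^ 2))) A3 (1 - N * (a * q)) C2 => u Hu v Hv.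
move: (prodl (fun x => qpoch_inf q x / _) xs) (prodl _ xs) N5 => R5 T N5.
move: (qpoch_inf q (s * N / q)) N1 (qpoch_inf q (s * N / (a * q))) N2 (qpoch_inf q (a * q ^ 3 / (s * N))) N3.
move: (qpoch_inf q (a * q * N * q)) N4 (qpoch_inf q q) N6 => G4 N4 G6 N6 G1 N1 G2 N2 G3 N3.
by field; repeat split.
Qed.
End Prefactor.

(** * Minimal solutions and continued fractions *)

Section Pincherle.
Variables (A B : C -> C) (al be sc : nat -> C).
Hypothesis hA : forall j, tends near0 (fun t : C => A (INR j + t)) (al j).
Hypothesis hB : forall j, tends near0 (fun t : C => B (INR (S j) + t)) (be (S j)).
Hypothesis hsc : forall n, sc n <> 0.

(** Limits are asked at the integers [j >= 0] only, since [X] may be singular at [-1]. The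
    recurrence holds merely in the limit, as the boundary value is non-zero at complex exponents. *)
Definition is_solution (X : C -> C) (y : nat -> C) (w : C) : Prop :=
  (forall j, tends near0 (fun t : C => X (INR j + t)) (y j)) /\
  (forall j, tends near0 (fun t : C => X (INR j + t + 1) - A (INR j + t) * X (INR j + t)
                                   + B (INR j + t) * X (INR j + t - 1)) 0) /\
  tends eventually (fun n => y n / sc n) w.

Lemma solution_comb (X1 X2 : C -> C) (y1 y2 : nat -> C) (w1 w2 k1 k2 : C) :
  is_solution X1 y1 w1 -> is_solution X2 y2 w2 ->
  is_solution (fun n => k1 * X1 n - k2 * X2 n) (fun j => k1 * y1 j - k2 * y2 j)
    (k1 * w1 - k2 * w2).
Proof.
move=> [H1 [E1 L1]] [H2 [E2 L2]]; split=> [j|].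
  by apply: tends_minus; apply: tends_mult => //; apply: tends_const.
split=> [j|].
  rewrite -[X in tends _ _ X](_ : k1 * 0 - k2 * 0 = 0); last by ring.
  pose err (X : C -> C) (t : C) := X (INR j + t + 1) - A (INR j + t) * X (INR j + t)
    + B (INR j + t) * X (INR j + t - 1).
  apply: (tends_ext (fun t => k1 * err X1 t - k2 * err X2 t)).
    by move=> t; rewrite /err /=; ring.
  by apply: tends_minus; apply: tends_mult; [exact: tends_const|exact: (E1 j)
    |exact: tends_const|exact: (E2 j)].
apply: (tends_ext (fun n => k1 * (y1 n / sc n) - k2 * (y2 n / sc n))).
  by move=> n; rewrite /Cdiv; ring.
by apply: tends_minus; apply: tends_mult => //; apply: tends_const.
Qed.

Lemma solution_shift (X : C -> C) (y : nat -> C) (w : C) (j : nat) :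
  is_solution X y w -> tends near0 (fun t : C => X (INR j + t + 1)) (y (S j)).
Proof.
move=> [H _]; apply: tends_ext (H (S j)) => t.
by congr X; rewrite S_INR RtoC_plus; ring.
Qed.

(** At [n = 0] the recurrence itself provides the limit of the product, even where one of the two
    factors has none. *)
Lemma solution_initial (X : C -> C) (y : nat -> C) (w : C) :
  is_solution X y w ->
  tends near0 (fun t : C => B t * X (t - 1)) (al 0%nat * y 0%nat - y 1%nat).
Proof.
move=> HX; have [H [E _]] := HX.
replace (al 0%nat * y 0%nat - y 1%nat) with (0 - y 1%nat + al 0%nat * y 0%nat) by ring.
apply: (tends_ext (fun t : C => X (INR 0 + t + 1) - A (INR 0 + t) * X (INR 0 + t)
  + B (INR 0 + t) * X (INR 0 + t - 1) - X (INR 0 + t + 1) + A (INR 0 + t) * X (INR 0 + t))).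
  by move=> t /=; replace (0 + t) with t by ring; ring.
apply: tends_plus; first apply: tends_minus.
- exact: (E 0%nat).
- exact: solution_shift 0%nat HX.
- by apply: tends_mult; [exact: (hA 0%nat)|exact: (H 0%nat)].
Qed.

Lemma solution_rec (X : C -> C) (y : nat -> C) (w : C) (j : nat) :
  is_solution X y w -> y (S (S j)) = al (S j) * y (S j) - be (S j) * y j.
Proof.
move=> HX; have [H [E _]] := HX.
have Hm : tends near0 (fun t : C => X (INR (S j) + t - 1)) (y j).
  by apply: tends_ext (H j) => t; congr X; rewrite S_INR RtoC_plus; ring.
suff E0 : y (S (S j)) - al (S j) * y (S j) + be (S j) * y j = 0.
  replace (y (S (S j))) with (y (S (S j)) - al (S j) * y (S j) + be (S j) * y j
    + al (S j) * y (S j) - be (S j) * y j) by ring.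
  by rewrite E0; ring.
apply: tends_unique _ (E (S j)).
apply: tends_plus; first apply: tends_minus.
- exact: solution_shift (S j) HX.
- by apply: tends_mult; [exact: (hA (S j))|exact: (H (S j))].
- by apply: tends_mult; [exact: (hB j)|].
Qed.

(** [cf_den] and [cf_num] continue the solutions with initial data [(1, al_0)] and [(0, 1)];
    matching [y_0] and [y_1 = al_0 y_0 - eta] fixes the two coefficients. *)
Lemma wallis_solution (y : nat -> C) (eta : C) (n : nat) :
  y 1%nat = al 0%nat * y 0%nat - eta ->
  (forall j, y (S (S j)) = al (S j) * y (S j) - be (S j) * y j) ->
  y n = y 0%nat * fst (wallis al be (RtoC 1, al 0%nat) n) - eta * fst (wallis al be (RtoC 0, RtoC 1) n)
  /\ y (S n) = y 0%nat * cf_den al be n - eta * cf_num al be n.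
Proof.
move=> H1 Hrec; rewrite /cf_den /cf_num; elim: n => [|n [IH1 IH2]] /=.
  by split; [ring|rewrite H1; ring].
rewrite Hrec.
move: IH1 IH2; case: (wallis al be (RtoC 1, al 0%nat) n) => [u v].
case: (wallis al be (RtoC 0, RtoC 1) n) => [u' v'] /= IH1 IH2.
by split=> //; rewrite IH1 IH2; ring.
Qed.

(* Some [w_i] is non-zero, so the denominators grow at the dominant rate [sc],
   while the combination with coefficients [w2], [w1] is of smaller order. *)
Lemma pincherle (X1 X2 : C -> C) (y1 y2 : nat -> C) (w1 w2 : C) :
  is_solution X1 y1 w1 -> is_solution X2 y2 w2 ->
  let num := fun n : C => w2 * X1 n - w1 * X2 n in
  let den := fun n : C => B n * (w2 * X1 (n - 1) - w1 * X2 (n - 1)) in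
  ~ tends near0 den 0 ->
  exists l : C, is_cfrac al be l /\ tends near0 (fun n => num n / den n) l.
Proof.
move=> S1 S2 num den Hden.
have SY := solution_comb _ _ _ _ _ _ w2 w1 S1 S2.
set y := fun j => w2 * y1 j - w1 * y2 j in SY.
pose eta := al 0%nat * y 0%nat - y 1%nat.
have Tden : tends near0 den eta := solution_initial _ _ _ SY.
have Heta : eta <> 0 by move=> E; apply: Hden; move: Tden; rewrite E.
have Tnum : tends near0 num (y 0%nat).
  by have [H _] := SY; apply: tends_ext (H 0%nat) => t; rewrite /num /= !Cplus_0_l.
have Hw n : y (S n) = y 0%nat * cf_den al be n - eta * cf_num al be n.
  apply: (proj2 (wallis_solution y eta n _ _)); first by rewrite /eta; ring.
  by move=> j; apply: solution_rec SY.
have Hsmall : tends eventually (fun n => y (S n) / sc (S n)) 0.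
  have [_ [_ L]] := SY; replace (w2 * w1 - w1 * w2) with (RtoC 0) in L by ring.
  by apply: (tends_subseq S _ _ _ L) => n; lia.
have Hdom : exists D : C, D <> 0 /\ tends eventually (fun n => cf_den al be n / sc (S n)) D.
  have Hone X z w : is_solution X z w -> w <> 0 ->
      exists D : C, D <> 0 /\ tends eventually (fun n => cf_den al be n / sc (S n)) D.
    move=> SX Hw0.
    pose ez := al 0%nat * z 0%nat - z 1%nat.
    have Hz n : z (S n) = z 0%nat * cf_den al be n - ez * cf_num al be n.
      apply: (proj2 (wallis_solution z ez n _ _)); first by rewrite /ez; ring.
      by move=> j; apply: solution_rec SX.
    (* Eliminating [cf_num] between [z] and the small solution [y] leaves the multiple [ka] of
       [cf_den]. The contribution of [y] is negligible, so this multiple has the non-zero limit [w]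
       at the scale [sc]. *)
    pose ka := z 0%nat - ez * y 0%nat / eta.
    have Lka : tends eventually (fun n => ka * (cf_den al be n / sc (S n))) w.
      apply: (tends_ext (fun n => z (S n) / sc (S n) - ez / eta * (y (S n) / sc (S n)))).
        by move=> n; rewrite Hz Hw /ka; have Hn := hsc (S n); field; split.
      replace w with (w - ez / eta * 0) by ring.
      apply: tends_minus; last by apply: tends_mult Hsmall; apply: tends_const.
      by have [_ [_ L]] := SX; apply: (tends_subseq S _ _ _ L) => n; lia.
    have Hka : ka <> 0.
      move=> E; apply: Hw0; apply: tends_unique Lka _; rewrite E.
      by apply: (tends_ext (fun _ => RtoC 0)); [move=> n; ring|exact: tends_const].
    exists (w / ka); split; first by nz.
    apply: (tends_ext (fun n => ka * (cf_den al be n / sc (S n)) / ka)).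
      by move=> n; have Hn := hsc (S n); field; split.
    by apply: tends_mult Lka _; apply: tends_const.
  case: (Classical_Prop.classic (w1 = 0)) => E1; last exact: Hone S1 E1.
  case: (Classical_Prop.classic (w2 = 0)) => E2; last exact: Hone S2 E2.
  (* If both limits vanish, [den] is identically 0, against the hypothesis. *)
  case: Hden; apply: (tends_ext (fun _ => RtoC 0)); last exact: tends_const.
  by move=> t; rewrite /den E1 E2; ring.
have [D [HD LD]] := Hdom.
have Hev : eventually (fun n => cf_den al be n <> 0).
  have Hev := tends_neq (F := eventually) _ _ _ HD LD.
  apply: filter_imp (Hev _) => n H E; apply: H; rewrite E /Cdiv; ring.
exists (y 0%nat / eta); split; last by apply: tends_div.
split=> //; apply/tends_filterlim.
(* The approximant differs from [y_0 / eta] by the small solution over the dominant denominator. *)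
apply: (tends_ext_loc (fun n => y 0%nat / eta - y (S n) / sc (S n) / (eta * (cf_den al be n / sc (S n))))).
  apply: filter_imp Hev => n Hn; rewrite Hw; have Hs := hsc (S n).
  by field; repeat split.
have {2}-> : y 0%nat / eta = y 0%nat / eta - 0 / (eta * D) by field; split.
apply: tends_minus; first exact: tends_const.
apply: tends_div => //; first by nz.
by apply: tends_mult LD; apply: tends_const.
Qed.
End Pincherle.

(** * Limits at integral powers of q *)

Lemma filter_Forall {T A : Type} {F : (T -> Prop) -> Prop} {FF : Filter F} (P : A -> T -> Prop) (xs : list A) :
  List.Forall (fun x => F (P x)) xs -> F (fun t => List.Forall (fun x => P x t) xs).
Proof.
elim=> [|x ys Hx _ IH]; first by apply: filter_forall => t; constructor.
by apply: filter_imp (filter_and _ _ Hx IH) => t [H1 H2]; constructor.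
Qed.

Section Limits.
Variables (q a b c d e f : C).
Hypothesis hq1 : (Cmod q < 1)%R.
Hypothesis hq0 : q <> 0.
Hypothesis ha0 : a <> 0.
Hypothesis ha : off_lattice q a.
Let xs := [b; c; d; e; f].
Let s := s_param q a b c d e f.
Hypothesis hs : lattice q s.
Hypothesis hxs : List.Forall (fun x : C => x <> 0) xs.
Hypothesis hax : List.Forall (fun x => off_lattice q (a / x)) xs.

Let hs0 : s <> 0 := lattice_neq_0 q hq0 s hs.

Lemma param_pole : List.Forall (fun x => no_pole q (a * q / x)) xs.
Proof.
apply: List.Forall_impl (Forall_and hxs hax) => x [Hx /(off_lattice_mulq _ hq0) H].
by apply: off_lattice_no_pole; replace (a * q / x) with (a / x * q) by (field; done).
Qed.

Lemma no_pole_a_over (l : C) : lattice q l -> no_pole q (l * a).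
Proof.
by move=> Hl; rewrite Cmult_comm; apply: off_lattice_no_pole; apply: off_lattice_mult.
Qed.

Lemma no_pole_over_a (l : C) : lattice q l -> no_pole q (l / a).
Proof.
move=> Hl; rewrite /Cdiv Cmult_comm; apply: off_lattice_no_pole; apply: off_lattice_mult => //.
exact: off_lattice_inv.
Qed.

Lemma no_pole_a_x (l : C) : lattice q l -> List.Forall (fun x => no_pole q (l * a / x)) xs.
Proof.
move=> Hl; apply: List.Forall_impl (Forall_and hxs hax) => x [Hx H].
apply: off_lattice_no_pole; replace (l * a / x) with (a / x * l) by (field; done).
exact: off_lattice_mult.
Qed.

Section AtPoint.
Context {T : Type} {F : (T -> Prop) -> Prop} {FF : Filter F}.
Variables (N : T -> C) (N0 : C).
Hypothesis hN : tends F N N0.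
Hypothesis hN0 : lattice q N0.

Let hN00 : N0 <> 0 := lattice_neq_0 q hq0 N0 hN0.

Lemma tends_monomial (x : C) : tends F (fun t => x * N t) (x * N0).
Proof. by apply: tends_mult hN; apply: tends_const. Qed.

Lemma tends_monomial_r (x : C) : tends F (fun t => N t * x) (N0 * x).
Proof. by apply: tends_mult hN _; apply: tends_const. Qed.

Lemma tends_sq (x : C) : tends F (fun t => N t ^ 2 * x) (N0 ^ 2 * x).
Proof. by apply: tends_mult; [exact: tends_pow|exact: tends_const]. Qed.

Lemma tends_scaled (x y : C) : tends F (fun t => x * N t / y) (x * N0 / y).
Proof. by apply: tends_mult; [exact: tends_monomial|exact: tends_const]. Qed.

(** The conditions involving [a] hold at [N0] itself and are open. Those on [N] and [N^2] fail at
    [N0] and have to be supplied on the punctured neighbourhood. *)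
Lemma near_regular :
  F (fun t => off_lattice q (N t)) -> F (fun t => off_lattice q (N t ^ 2)) ->
  F (fun t => regular q a b c d e f (N t)).
Proof.
move=> O1 O2.
have lq := lattice_q q; have lm := lattice_mult q.
have A1 : F (fun t => N t <> 0) by apply: tends_neq hN.
have A2 : F (fun t => no_pole q (s * N t / (a * q ^ 2))).
  apply: (no_pole_near _ hq1 _ _ (tends_scaled s (a * q ^ 2))).
  replace (s * N0 / (a * q ^ 2)) with (s * N0 / q ^ 2 / a) by (field; done).
  apply: no_pole_over_a; apply: lattice_div; [done|exact: lm|exact: lattice_pow].
have A3 : F (fun t => List.Forall (fun x => no_pole q (a * N t / x)) xs).
  apply: (filter_Forall (fun x t => no_pole q (a * N t / x))).
  apply: List.Forall_impl (no_pole_a_x _ hN0) => x Hx.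
  by apply: (no_pole_near _ hq1 _ _ (tends_scaled a x)); rewrite (Cmult_comm a).
have A4 : F (fun t => no_pole q (a * q / (s * N t))).
  apply: (no_pole_near _ hq1 _ (a * q / (s * N0))).
    apply: tends_div (tends_monomial s); [by nz|exact: tends_const].
  replace (a * q / (s * N0)) with (q / (s * N0) * a) by (field; split; done).
  by apply: no_pole_a_over; apply: lattice_div => //; apply: lm.
have A5 : F (fun t => no_pole q (a * N t)).
  by apply: (no_pole_near _ hq1 _ _ (tends_monomial a)); rewrite Cmult_comm; apply: no_pole_a_over.
have A6 : s - a * q ^ 2 <> 0.
  move=> E; apply: (proj2 (off_lattice_mult q hq0 _ (q ^ 2 / s) ha _ 0%nat)).
    by apply: lattice_div => //; apply: lattice_pow.
  replace (a * (q ^ 2 / s)) with ((s - (s - a * q ^ 2)) / s) by (field; done).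
  by rewrite E /=; field.
apply: filter_imp (filter_and _ _ (filter_and _ _ (filter_and _ _ O1 O2) (filter_and _ _ A1 A2))
  (filter_and _ _ (filter_and _ _ A3 A4) A5)) => t.
by move=> [[[? ?] [? ?]] [[? ?] ?]].
Qed.

Lemma tends_prod_inf (y : C) : lattice q y ->
  tends F (fun t => prodl (fun x => qpoch_inf q (a * y * N t / x)) xs)
    (prodl (fun x => qpoch_inf q (a * y * N0 / x)) xs) /\
  prodl (fun x => qpoch_inf q (a * y * N0 / x)) xs <> 0.
Proof.
move=> Hy; split.
  apply: (tends_prodl (fun x t => qpoch_inf q (a * y * N t / x))).
  apply/List.Forall_forall => x _; apply: qpoch_inf_continuous => //; exact: tends_scaled.
apply: prodl_neq_0; apply: List.Forall_impl (no_pole_a_x _ (lattice_mult q _ _ Hy hN0)) => x Hx.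
apply: qpoch_inf_neq_0 => //; by replace (a * y * N0) with (y * N0 * a) by ring.
Qed.

Lemma tends_rec_error :
  tends F (fun t => rec_error q a b c d e f (N t)) (rec_error q a b c d e f N0).
Proof.
have lm := lattice_mult q; have lq := lattice_q q.
have inf := qpoch_inf_continuous q hq1.
have [T1 T2] := tends_prod_inf q lq.
have H1 : qpoch_inf q (s * N0 / (a * q ^ 2)) <> 0.
  apply: qpoch_inf_neq_0 => //.
  replace (s * N0 / (a * q ^ 2)) with (s * N0 / q ^ 2 / a) by (field; done).
  by apply: no_pole_over_a; apply: lattice_div; [done|exact: lm|exact: lattice_pow].
have H2 : qpoch_inf q (a * q ^ 3 / (s * N0)) <> 0.
  apply: qpoch_inf_neq_0 => //.
  replace (a * q ^ 3 / (s * N0)) with (q ^ 3 / (s * N0) * a) by (field; split; done).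
  by apply: no_pole_a_over; apply: lattice_div => //; [exact: lattice_pow|exact: lm].
rewrite /rec_error -/s -/xs; apply: tends_div; first by nz.
  apply: tends_mult.
    apply: tends_mult (tends_const _).
    by apply: tends_mult; [exact: tends_const|exact: tends_pow].
  apply: tends_mult; last by apply: inf; apply: tends_inv.
  apply: inf; apply: tends_mult (tends_const _).
  by apply: tends_mult; [exact: tends_const|exact: tends_pow].
apply: tends_mult => //; apply: tends_mult; first by apply: inf; apply: tends_scaled.
by apply: inf; apply: tends_div (tends_monomial s); [nz|exact: tends_const].
Qed.

Lemma rec_error_eq_0 :
  qpoch_inf q (s * N0 ^ 2 / q) * qpoch_inf q (/ N0) = 0 -> rec_error q a b c d e f N0 = 0.
Proof. by move=> E; rewrite /rec_error -/s E /Cdiv; ring. Qed.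

(** At [N0] the denominator parameters [a q / g] and [a q / h] are integral powers of [q] times [a],
    hence without poles: the nonterminating series is continuous also at points where it
    terminates. *)
Lemma tends_phi_lattice :
  tends F (fun t => phi q a b c d e f (s * N t / q) (/ N t)) (phi q a b c d e f (s * N0 / q) (/ N0)).
Proof.
have lm := lattice_mult q; have lq := lattice_q q.
apply: tends_phi => //; try exact: param_pole; try by nz.
- by apply: no_pole_1m; rewrite -(Cmult_1_l a); apply: no_pole_a_over; apply: (lattice_pow q 0).
- exact: tends_scaled.
- exact: tends_inv.
- replace (a * q / (s * N0 / q)) with (q * q / (s * N0) * a) by (field; repeat split; done).
  by apply: no_pole_a_over; apply: lattice_div => //; apply: lm.
- replace (a * q / / N0) with (q * N0 * a) by (field; done).
  by apply: no_pole_a_over; apply: lm.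
Qed.

Lemma tends_sol : no_pole q (s * N0 / q) ->
  tends F (fun t => sol q a b c d e f (N t)) (sol q a b c d e f N0).
Proof.
move=> Hp; have lm := lattice_mult q; have lq := lattice_q q.
have inf := qpoch_inf_continuous q hq1.
have [T1 T2] := tends_prod_inf q lq.
have H1 := qpoch_inf_neq_0 q hq1 _ Hp.
have H2 : qpoch_inf q (s * N0 / (a * q)) <> 0.
  apply: qpoch_inf_neq_0 => //.
  replace (s * N0 / (a * q)) with (s * N0 / q / a) by (field; split; done).
  by apply: no_pole_over_a; apply: lattice_div => //; apply: lm.
rewrite /sol /pref -/s -/xs; apply: tends_mult tends_phi_lattice.
apply: tends_div; first by nz.
  apply: tends_mult; last by apply: inf; apply: tends_monomial.
  apply: inf; apply: tends_mult (tends_const _).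
  by apply: tends_mult; [exact: tends_const|exact: tends_pow].
by apply: tends_mult => //; apply: tends_mult; apply: inf; apply: tends_scaled.
Qed.

(* The removable singularity of the prefactor, at [s N = q]. *)
Lemma tends_sol_1 : s = q -> N0 = 1 -> F (fun t => 1 - N t <> 0) ->
  tends F (fun t => sol q a b c d e f (N t))
    (2 / prodl (fun x => qpoch_inf q (a * q * N0 / x)) xs
     * qpoch_inf q (a * q) / qpoch_inf q (/ a) * phi q a b c d e f (s * N0 / q) (/ N0)).
Proof.
move=> Es EN HF; have inf := qpoch_inf_continuous q hq1.
have lq := lattice_q q.
have [T1 T2] := tends_prod_inf q lq.
have Hq : qpoch_inf q q <> 0 by apply: qpoch_inf_neq_0 => //; apply: no_pole_q.
have Ha : qpoch_inf q (/ a) <> 0.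
  apply: qpoch_inf_neq_0 => //; replace (/ a) with (1 / a) by (field; done).
  by apply: no_pole_over_a; apply: (lattice_pow q 0).
have TN : tends F N 1 by rewrite -EN.
have TqN : tends F (fun t => N t * q) q.
  by rewrite -{2}(Cmult_1_l q); apply: tends_mult TN _; apply: tends_const.
have TqN2 : tends F (fun t => N t ^ 2 * q) q.
  rewrite -{2}(Cmult_1_l q); apply: tends_mult (tends_const _).
  by replace (RtoC 1) with (1 ^ 2) by (rewrite /=; ring); apply: tends_pow.
have T3 : tends F (fun t => qpoch_inf q (1 * N t / a)) (qpoch_inf q (1 * 1 / a)).
  by apply: inf; apply: tends_mult (tends_const _); apply: tends_mult TN; apply: tends_const.
have T4 : tends F (fun t => qpoch_inf q (a * q * N t)) (qpoch_inf q (a * q * 1)).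
  by apply: inf; apply: tends_mult TN; apply: tends_const.
have HF2 : F (fun t => qpoch_inf q (N t * q) <> 0) by apply: tends_neq Hq (inf _ _ _ _ _ TqN).
(* For [s = q] the quotient [(N^2)_infinity / (N)_infinity] equals [(1 + N) (q N^2)_infinity / (q
   N)_infinity]; at [N = 1] this leaves the constant 2. *)
apply: (tends_ext_loc (fun t => (1 + N t) * qpoch_inf q (N t ^ 2 * q) * qpoch_inf q (a * q * N t)
   / (qpoch_inf q (N t * q) * qpoch_inf q (1 * N t / a) * prodl (fun x => qpoch_inf q (a * q * N t / x)) xs)
   * phi q a b c d e f (s * N t / q) (/ N t))).
  have H0 : F (fun t => qpoch_inf q (1 * N t / a) <> 0).
    by apply: tends_neq T3; replace (1 * 1 / a) with (/ a) by (field; done).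
  have H1 : F (fun t => prodl (fun x => qpoch_inf q (a * q * N t / x)) xs <> 0) by apply: tends_neq T2 T1.
  apply: filter_imp (filter_and _ _ HF (filter_and _ _ HF2 (filter_and _ _ H0 H1))) => t [Ht [Ht1 [Ht2 Ht3]]].
  rewrite /sol /pref -/s -/xs; congr Cmult.
  have -> : s * N t ^ 2 / q = N t ^ 2 by rewrite Es; field.
  have -> : s * N t / q = N t by rewrite Es; field.
  have -> : s * N t / (a * q) = 1 * N t / a by rewrite Es; field; split.
  rewrite (qpoch_inf_step q hq1 (N t ^ 2)) (qpoch_inf_step q hq1 (N t)).
  move: (qpoch_inf q (N t * q)) Ht1 (qpoch_inf q (1 * N t / a)) Ht2 => u Hu v Hv.
  move: (prodl _ xs) Ht3 => w Hw.
  by rewrite /=; field; repeat split.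
apply: tends_mult tends_phi_lattice.
replace (2 / prodl (fun x => qpoch_inf q (a * q * N0 / x)) xs * qpoch_inf q (a * q) / qpoch_inf q (/ a))
  with ((1 + 1) * qpoch_inf q q * qpoch_inf q (a * q * 1) /
   (qpoch_inf q q * qpoch_inf q (1 * 1 / a) * prodl (fun x => qpoch_inf q (a * q * N0 / x)) xs)); last first.
  replace (1 * 1 / a) with (/ a) by (field; done); rewrite Cmult_1_r.
  by move: (prodl _ xs) T2 => w Hw; rewrite (_ : RtoC 2 = 1 + 1); [field|rewrite -RtoC_plus].
apply: tends_div.
- replace (1 * 1 / a) with (/ a) by (field; done); by nz.
- apply: tends_mult; last exact: T4.
  apply: tends_mult; last exact: inf.
  by apply: tends_plus => //; apply: tends_const.
- by apply: tends_mult => //; apply: tends_mult => //; apply: inf.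
Qed.
End AtPoint.
End Limits.

Lemma prodl_map (g h : C -> C) (xs : list C) : prodl g (map h xs) = prodl (fun x => g (h x)) xs.
Proof. by elim: xs => [//|x xs IH] /=; rewrite IH. Qed.

(** * Invariance under inversion of the parameters *)

Section Symmetry.
Variables (q a b c d e f N : C).
Hypothesis hq0 : q <> 0.
Hypothesis ha0 : a <> 0.
Let xs := [b; c; d; e; f].
Hypothesis hxs : List.Forall (fun x : C => x <> 0) xs.
Let s := s_param q a b c d e f.
Let s' := s_param q (q / a) (q / b) (q / c) (q / d) (q / e) (q / f).

Lemma s_param_dual : s' = q ^ 4 / s.
Proof.
move: hxs; rewrite !List.Forall_cons_iff => -[Hb [Hc [Hd [He [Hf _]]]]].
by rewrite /s /s' /s_param; field; repeat split.
Qed.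

Lemma prodl_dual (g h : C -> C) :
  (forall x : C, x <> 0 -> g (q / x) = h x) ->
  prodl g [q / b; q / c; q / d; q / e; q / f] = prodl h xs.
Proof.
move=> H; rewrite (prodl_map g (fun x => q / x) xs); apply: prodl_ext_in.
by apply: List.Forall_impl hxs => x; apply: H.
Qed.

(** Factor by factor: [1 - N] and [1 - N s / q^2] are exchanged, likewise the two products over the
    parameters, and each factor of the denominator is invariant. *)
Lemma rec_b_dual :
  rec_b q (q / a) (q / b) (q / c) (q / d) (q / e) (q / f) (s * N / q ^ 2) = rec_b q a b c d e f N.
Proof.
have Hs0 := s_neq_0 q a b c d e f hq0 ha0 hxs; rewrite -/s in Hs0.
rewrite /rec_b -/s -/s' s_param_dual.
rewrite (prodl_dual _ (fun x => 1 - N * (s * x / (a * q ^ 2)))); last first.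
  by move=> x Hx; rewrite /=; field; repeat split.
rewrite (prodl_dual _ (fun x => 1 - N * (a / x))); last first.
  by move=> x Hx; rewrite /=; field; repeat split.
rewrite -/xs.
have -> : 1 - s * N / q ^ 2 * (q ^ 4 / s / q ^ 2) = 1 - N by rewrite /=; field; split.
have -> : 1 - (s * N / q ^ 2) ^ 2 * (q ^ 4 / s / q) = 1 - N ^ 2 * (s / q) by rewrite /=; field; split.
have -> : 1 - (s * N / q ^ 2) ^ 2 * (q ^ 4 / s / q ^ 2) = 1 - N ^ 2 * (s / q ^ 2) by rewrite /=; field; split.
have -> : 1 - (s * N / q ^ 2) ^ 2 * (q ^ 4 / s / q ^ 3) = 1 - N ^ 2 * (s / q ^ 3) by rewrite /=; field; split.
by rewrite /Cdiv; ring.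
Qed.

(** The three summands are not permuted: the factor [1 - N s / q] of the first, for instance,
    becomes [1 - N q]. Only their sum is invariant, by an identity linear in the symmetric functions
    that uses [bcdef = a^3 q^3 / s]. *)
Lemma rec_a_dual :
  1 - N ^ 2 * (s / q) <> 0 -> 1 - N ^ 2 * s <> 0 -> 1 - N ^ 2 * (s / q ^ 2) <> 0 ->
  1 - N * (s / (a * q ^ 2)) <> 0 -> 1 - N * (a * q) <> 0 ->
  1 - s * N / q ^ 2 * (s' / (q / a * q ^ 2)) <> 0 -> 1 - s * N / q ^ 2 * (q / a * q) <> 0 ->
  rec_a q (q / a) (q / b) (q / c) (q / d) (q / e) (q / f) (s * N / q ^ 2) = rec_a q a b c d e f N.
Proof.
move=> B1 B0 B2 A3 C2.
have Hs0 := s_neq_0 q a b c d e f hq0 ha0 hxs; rewrite -/s in Hs0.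
rewrite s_param_dual.
replace (s * N / q ^ 2 * (q ^ 4 / s / (q / a * q ^ 2))) with (a * N / q) by (rewrite /=; field; repeat split; done).
replace (s * N / q ^ 2 * (q / a * q)) with (s * N / a) by (rewrite /=; field; repeat split; done).
move=> A3' C2'.
move: (hxs); rewrite !List.Forall_cons_iff => -[Hb [Hc [Hd [He [Hf _]]]]].
have [e1 [e2 [e3 [e4 H]]]] := esym_expand b c d e f Hb Hc Hd He Hf.
have E5 : b * c * d * e * f = a ^ 3 * q ^ 3 / s by rewrite /s /s_param; field; repeat split.
rewrite E5 in H.
rewrite /rec_a -/s -/s' s_param_dual -/xs.
rewrite (prodl_dual _ (fun x => 1 - x * (s * N / (a * q)))); last first.
  by move=> x Hx; rewrite /=; field; repeat split.
rewrite (prodl_dual _ (fun x => 1 - (N * a) / x)); last first.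
  by move=> x Hx; rewrite /=; field; repeat split.
rewrite (prodl_dual _ (fun x => 1 - q / x)) //.
rewrite (prodl_ext_in (fun x => 1 - N * (a * q / x)) (fun x => 1 - (N * a * q) / x)); last first.
  by apply: List.Forall_impl hxs => x Hx; field.
rewrite (prodl_ext_in (fun x => 1 - N * (s * x / (a * q ^ 2))) (fun x => 1 - x * (N * s / (a * q ^ 2)))); last first.
  by apply: List.Forall_impl hxs => x Hx; field; split.
rewrite (prodl_ext (fun x => 1 - x) (fun x => 1 - x * 1)); last by move=> x; ring.
rewrite !(proj1 (H _)) !(proj2 (H _)) /esym_poly /esym_rev.
have neq (x y z : C) : x <> 0 -> z <> 0 -> y = x * z -> y <> 0 by move=> Hx Hz ->; nz.
have K1 : q - N ^ 2 * s <> 0 by apply: (neq _ _ q B1) => //; field.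
have K2 : q ^ 2 - N ^ 2 * s <> 0 by apply: (neq _ _ (q ^ 2) B2); [nz|rewrite /=; field].
have K3 : a * q ^ 2 - N * s <> 0 by apply: (neq _ _ (a * q ^ 2) A3); [nz|rewrite /=; field; split].
have K4 : q - a * N <> 0 by apply: (neq _ _ q A3') => //; field.
have K5 : a - s * N <> 0 by apply: (neq _ _ a C2') => //; field.
clear H E5; move: (s) Hs0 B0 B1 B2 A3 C2 A3' C2' K1 K2 K3 K4 K5 => s0 Hs0 B0 B1 B2 A3 C2 A3' C2' K1 K2 K3 K4 K5.
rewrite /= ?Cmult_1_r in K1 K2 K3 K4 K5 B0 B1 B2 A3 C2 *.
by field; repeat split=> //; rewrite Cmult_comm.
Qed.
End Symmetry.

(** * Limits of the coefficients and removable singularities *)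

Section CoefficientLimits.
Variables (q a b c d e f : C).
Hypothesis hq1 : (Cmod q < 1)%R.
Hypothesis hq0 : q <> 0.
Hypothesis ha0 : a <> 0.
Hypothesis ha : off_lattice q a.
Let xs := [b; c; d; e; f].
Let s := s_param q a b c d e f.
Hypothesis hs : lattice q s.

Context {T : Type} {F : (T -> Prop) -> Prop} {FF : Filter F}.
Variables (N : T -> C) (N0 : C).
Hypothesis hN : tends F N N0.
Hypothesis hN0 : lattice q N0.

Lemma tends_linear (x : C) : tends F (fun t => 1 - N t * x) (1 - N0 * x).
Proof. by apply: tends_minus; [exact: tends_const|exact: tends_monomial_r]. Qed.

Lemma tends_quadratic (x : C) : tends F (fun t => 1 - N t ^ 2 * x) (1 - N0 ^ 2 * x).
Proof. by apply: tends_minus; [exact: tends_const|exact: tends_sq]. Qed.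

Lemma tends_linear_prod (k : C -> C) :
  tends F (fun t => prodl (fun x => 1 - N t * k x) xs) (prodl (fun x => 1 - N0 * k x) xs).
Proof.
apply: (tends_prodl (fun x t => 1 - N t * k x)).
by apply/List.Forall_forall => x _; apply: tends_linear.
Qed.

Lemma limit_den_a : 1 - N0 * (a * q) <> 0 /\ 1 - N0 * (s / (a * q ^ 2)) <> 0.
Proof.
have lm := lattice_mult q; have lq := lattice_q q; split.
  replace (N0 * (a * q)) with (N0 * q * a) by ring; apply: (no_pole_1m q).
  by apply: no_pole_a_over => //; apply: lm.
replace (N0 * (s / (a * q ^ 2))) with (N0 * s / q ^ 2 / a) by (field; done); apply: (no_pole_1m q).
by apply: no_pole_over_a => //; apply: lattice_div; [done|exact: lm|exact: lattice_pow].
Qed.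

Ltac tends_tac := repeat first
  [ assumption | exact: tends_linear_prod | exact: tends_linear | exact: tends_quadratic
  | exact: tends_const | exact: hN | apply: tends_pow | apply: tends_mult | apply: tends_plus ].

Lemma tends_rec_a :
  1 - N0 ^ 2 * s <> 0 -> 1 - N0 ^ 2 * (s / q) <> 0 -> 1 - N0 ^ 2 * (s / q ^ 2) <> 0 ->
  tends F (fun t => rec_a q a b c d e f (N t)) (rec_a q a b c d e f N0).
Proof.
move=> H0 H1 H2; have [H3 H4] := limit_den_a.
have H1m : tends F (fun t => 1 - N t) (1 - N0) by apply: tends_minus hN; apply: tends_const.
rewrite /rec_a -/s -/xs; apply: tends_div; first by nz.
  apply: tends_plus; first apply: tends_plus.
  - by apply: tends_div; [done|tends_tac|tends_tac].
  - apply: tends_mult; first exact: tends_const.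
    by apply: tends_div; [done|tends_tac|tends_tac].
  - apply: tends_mult; last exact: tends_const.
    apply: tends_mult; last exact: tends_const.
    apply: tends_mult; last exact: tends_quadratic.
    apply: tends_div; [by nz|tends_tac|exact: tends_const].
by tends_tac.
Qed.

Lemma tends_rec_b :
  1 - N0 ^ 2 * (s / q) <> 0 -> 1 - N0 ^ 2 * (s / q ^ 2) <> 0 -> 1 - N0 ^ 2 * (s / q ^ 3) <> 0 ->
  tends F (fun t => rec_b q a b c d e f (N t)) (rec_b q a b c d e f N0).
Proof.
move=> H0 H1 H2.
have H1m : tends F (fun t => 1 - N t) (1 - N0) by apply: tends_minus hN; apply: tends_const.
by rewrite /rec_b -/s -/xs; apply: tends_div; [by nz|tends_tac|tends_tac].
Qed.

Lemma q_neq_1 : 1 - q <> 0.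
Proof. exact: no_pole_1m (no_pole_q q hq1). Qed.

Lemma q_sq_neq_1 : 1 - q ^ 2 <> 0.
Proof. by apply/one_minus_neq_0 => E; apply: (no_pole_q q hq1 1%nat); rewrite -E /=; ring. Qed.

Lemma q_inv_neq_1 : 1 - / q <> 0.
Proof.
move=> E; apply: q_neq_1; replace (1 - q) with (- (q * (1 - / q))) by (field; done).
by rewrite E; ring.
Qed.

Lemma two_neq_0 : 1 + 1 <> 0.
Proof. by rewrite -RtoC_plus => /RtoC_inj; lra. Qed.

Hypothesis hreg : F (fun t => regular q a b c d e f (N t)).

Lemma near_one_plus : N0 = 1 -> F (fun t => 1 + N t <> 0).
Proof.
move=> E; apply: (tends_neq _ (1 + N0)); first by rewrite E; apply: two_neq_0.
by apply: tends_plus hN; apply: tends_const.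
Qed.

(* In the exceptional cases [s = q], [s = q^2] the singularity of [rec_a] at [N = 1], and for
   [s = q] that of [rec_b] at [N = q], is removable. *)
Lemma rec_a_limit_1 : s = q -> N0 = 1 ->
  exists l, tends F (fun t => rec_a q a b c d e f (N t)) l.
Proof.
move=> Es E0; have [H3 H4] := limit_den_a.
have Hp0 : 1 + N0 <> 0 by rewrite E0; apply: two_neq_0.
have Hq1 := q_neq_1; have Hq2 := q_inv_neq_1.
have B0 : 1 - N0 ^ 2 * s <> 0 by rewrite E0 Es; replace (1 - 1 ^ 2 * q) with (1 - q) by (rewrite /=; ring).
have B2 : 1 - N0 ^ 2 * (s / q ^ 2) <> 0.
  by rewrite E0 Es; replace (1 - 1 ^ 2 * (q / q ^ 2)) with (1 - / q) by (rewrite /=; field; done).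
(* Here [1 - N^2 s / q = (1 - N) (1 + N)]. The first summand contains [1 - N] as [1 - N s / q], the
   second contains it openly, and the third contains the whole vanishing factor. *)
pose G (y : C) := ((1 - y * (s / (a * q))) * (1 - y * (s / (a * q ^ 2)))
       * prodl (fun x => 1 - y * (a * q / x)) xs / (1 - y ^ 2 * s)
     + q * ((1 - y * a) * (1 - y * (a * q))
       * prodl (fun x => 1 - y * (s * x / (a * q ^ 2))) xs / (1 - y ^ 2 * (s / q ^ 2))))
     / ((1 + y) * (1 - y * (s / (a * q ^ 2))) * (1 - y * (a * q)))
   + s * y ^ 2 * / (a * q) * (1 - s / (a * q ^ 2)) * prodl (fun x => 1 - x) xs
     / ((1 - y * (s / (a * q ^ 2))) * (1 - y * (a * q))).
exists (G N0); apply: (tends_ext_loc (fun t => G (N t))); last first.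
  rewrite /G; apply: tends_plus; last by apply: tends_div; [by nz|tends_tac|tends_tac].
  apply: tends_div; [by nz| |tends_tac].
  apply: tends_plus; first by apply: tends_div; [exact: B0|tends_tac|tends_tac].
  apply: tends_mult; first exact: tends_const.
  by apply: tends_div; [exact: B2|tends_tac|tends_tac].
apply: filter_imp (filter_and _ _ hreg (near_one_plus E0)) => t [Hr Ht].
have [A [B [C0 [C1 [C2 [A3 A4]]]]]] := regular_neq_0 _ _ _ _ _ _ _ hq0 ha0 _ Hr.
have B0t := B 0%nat; have B2t := B 2%nat; rewrite -/s in B0t B2t A3 A4.
replace (s / q ^ 0) with s in B0t by (rewrite /=; field).
rewrite /G /rec_a -/s -/xs.
have -> : 1 - N t * (s / q) = 1 - N t by rewrite Es; field.
have -> : 1 - N t ^ 2 * (s / q) = (1 - N t) * (1 + N t) by rewrite Es /=; field.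
move: (prodl _ xs) (prodl _ xs) (prodl _ xs) => P1 P2 P3.
move: (1 - N t ^ 2 * s) B0t (1 - N t ^ 2 * (s / q ^ 2)) B2t (1 - N t * (s / (a * q ^ 2))) A3 (1 - N t * (a * q)) C2 => u Hu v Hv w Hw z Hz.
move: (1 - s / (a * q ^ 2)) (1 - N t * (s / (a * q))) (1 - N t * a) => k1 k2 k3.
by field; repeat split.
Qed.

Lemma rec_a_limit_2 : s = q ^ 2 -> N0 = 1 ->
  exists l, tends F (fun t => rec_a q a b c d e f (N t)) l.
Proof.
move=> Es E0; have [H3 H4] := limit_den_a.
have Hp0 : 1 + N0 <> 0 by rewrite E0; apply: two_neq_0.
have Hq1 := q_neq_1; have Hq2 := q_sq_neq_1.
have B0 : 1 - N0 ^ 2 * s <> 0 by rewrite E0 Es; replace (1 - 1 ^ 2 * q ^ 2) with (1 - q ^ 2) by (rewrite /=; ring).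
have B1 : 1 - N0 ^ 2 * (s / q) <> 0.
  by rewrite E0 Es; replace (1 - 1 ^ 2 * (q ^ 2 / q)) with (1 - q) by (rewrite /=; field; done).
(* Only the inner denominator [1 - N^2 s / q^2 = (1 - N) (1 + N)] of the second summand vanishes,
   and [1 - N] stands above it. *)
pose G (y : C) := ((1 - y * (s / q)) * (1 - y * (s / (a * q))) * (1 - y * (s / (a * q ^ 2)))
       * prodl (fun x => 1 - y * (a * q / x)) xs / (1 - y ^ 2 * s)
     + q * ((1 - y * a) * (1 - y * (a * q))
       * prodl (fun x => 1 - y * (s * x / (a * q ^ 2))) xs / (1 + y))
     + s * y ^ 2 * / (a * q) * (1 - y ^ 2 * (s / q)) * (1 - s / (a * q ^ 2)) * prodl (fun x => 1 - x) xs)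
    / ((1 - y ^ 2 * (s / q)) * (1 - y * (s / (a * q ^ 2))) * (1 - y * (a * q))).
exists (G N0); apply: (tends_ext_loc (fun t => G (N t))); last first.
  rewrite /G; apply: tends_div; [by nz| |tends_tac].
  apply: tends_plus; first apply: tends_plus.
  - by apply: tends_div; [exact: B0|tends_tac|tends_tac].
  - apply: tends_mult; first exact: tends_const.
    by apply: tends_div; [exact: Hp0|tends_tac|tends_tac].
  - by tends_tac.
apply: filter_imp (filter_and _ _ hreg (near_one_plus E0)) => t [Hr Ht].
have [A [B [C0 [C1 [C2 [A3 A4]]]]]] := regular_neq_0 _ _ _ _ _ _ _ hq0 ha0 _ Hr.
rewrite /G /rec_a -/s -/xs.
have -> : 1 - N t ^ 2 * (s / q ^ 2) = (1 - N t) * (1 + N t) by rewrite Es /=; field.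
congr (_ / _); congr (_ + _); congr (_ + _); congr (_ * _).
move: (prodl _ xs) => P1; by field; split.
Qed.

Lemma rec_b_limit_1 : s = q -> N0 = q ->
  exists l, tends F (fun t => rec_b q a b c d e f (N t)) l.
Proof.
move=> Es E0.
have Hp : tends F (fun t => 1 + N t / q) (1 + N0 / q).
  by apply: tends_plus; [exact: tends_const|apply: tends_mult hN _; exact: tends_const].
have Hp0 : 1 + N0 / q <> 0.
  by rewrite E0; replace (q / q) with (RtoC 1) by (field; done); apply: two_neq_0.
have H1m : tends F (fun t => 1 - N t) (1 - N0) by apply: tends_minus hN; apply: tends_const.
have Hq1 := q_neq_1; have Hq2 := q_sq_neq_1.
have B1 : 1 - N0 ^ 2 * (s / q) <> 0.
  by rewrite E0 Es; replace (1 - q ^ 2 * (q / q)) with (1 - q ^ 2) by (field; done).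
have B2 : 1 - N0 ^ 2 * (s / q ^ 2) <> 0.
  by rewrite E0 Es; replace (1 - q ^ 2 * (q / q ^ 2)) with (1 - q) by (rewrite /=; field; done).
(* The factor [1 - N s / q^2 = 1 - N / q] cancels in [1 - N^2 s / q^3 = (1 - N / q) (1 + N / q)]. *)
pose G (y : C) := (1 - y) * prodl (fun x => 1 - y * (a / x)) xs
    * prodl (fun x => 1 - y * (s * x / (a * q ^ 2))) xs
  / ((1 - y ^ 2 * (s / q)) * (1 - y ^ 2 * (s / q ^ 2)) ^ 2 * (1 + y / q)).
exists (G N0); apply: (tends_ext_loc (fun t => G (N t))); last first.
  by rewrite /G; apply: tends_div; [by nz|tends_tac|tends_tac].
apply: filter_imp (filter_and _ _ hreg (tends_neq _ _ _ Hp0 Hp)) => t [Hr Ht].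
have [A [B _]] := regular_neq_0 _ _ _ _ _ _ _ hq0 ha0 _ Hr.
have B1t := B 1%nat; have B2t := B 2%nat; have A2 := A 2%nat; rewrite -/s in B1t B2t A2.
rewrite [q ^ 1]/= Cmult_1_r in B1t.
rewrite /G /rec_b -/s -/xs.
have E2 : 1 - N t * (s / q ^ 2) = 1 - N t / q by rewrite Es /=; field.
rewrite E2 in A2 *.
have -> : 1 - N t ^ 2 * (s / q ^ 3) = (1 - N t / q) * (1 + N t / q) by rewrite Es /=; field.
move: (1 - N t / q) A2 (1 + N t / q) Ht (1 - N t ^ 2 * (s / q)) B1t (1 - N t ^ 2 * (s / q ^ 2)) B2t => u Hu v Hv w Hw z Hz.
by field; repeat split.
Qed.
End CoefficientLimits.

(** * The two solutions *)

Section SolutionFamily.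
Variables (q a b c d e f W : C) (X A B P w Nn : C -> C).
Hypothesis hq1 : (Cmod q < 1)%R.
Hypothesis hq0 : q <> 0.
Hypothesis ha0 : a <> 0.
Hypothesis ha : off_lattice q a.
Let xs := [b; c; d; e; f].
Let s := s_param q a b c d e f.
Hypothesis hs : lattice q s.
Hypothesis hxs : List.Forall (fun x : C => x <> 0) xs.
Hypothesis hax : List.Forall (fun x => off_lattice q (a / x)) xs.
Hypothesis HX : forall n, X n = P n * sol q a b c d e f (Nn n).
Hypothesis HA : forall j : nat, near0 (fun t : C =>
  A (INR j + t) = w (INR j + t) * rec_a q a b c d e f (Nn (INR j + t))).
Hypothesis HB : forall n, B n * P (n - 1) = P n * w n * (q * rec_b q a b c d e f (Nn n)).
Hypothesis HP : forall n, P (n + 1) = P n * w n.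
Hypothesis HP0 : forall n, P n <> 0.
Hypothesis HN1 : forall n, Nn (n + 1) = Nn n * q.
Hypothesis HN2 : forall n, Nn (n - 1) = Nn n / q.
Hypothesis HTP : forall j : nat, tends near0 (fun t : C => P (INR j + t)) (P (INR j)).
Hypothesis HTw : forall j : nat, tends near0 (fun t : C => w (INR j + t)) (w (INR j)).
Hypothesis HTN : forall j : nat, tends near0 (fun t : C => Nn (INR j + t)) (Nn (INR j)).
Hypothesis HNl : forall j : nat, lattice q (Nn (INR j)).
Hypothesis HNreg : forall j : nat, near0 (fun t : C => regular q a b c d e f (Nn (INR j + t))).
Hypothesis Hz : forall j : nat,
  qpoch_inf q (s * Nn (INR j) ^ 2 / q) * qpoch_inf q (/ Nn (INR j)) = 0.
Hypothesis Hy0 : exists y, tends near0 (fun t : C => X (INR 0 + t)) y.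
Hypothesis Hy1 : forall j : nat, no_pole q (s * Nn (INR (S j)) / q).
Hypothesis HN0 : tends eventually (fun j => Nn (INR j)) 0.
Hypothesis HW : tends eventually (fun j =>
  phi q a b c d e f (s * Nn (INR j) / q) (/ Nn (INR j))) W.

(** One argument for both solutions: [Nn n] is [q^n] for the given parameters and [s q^(n-2)] for
    the inverted ones. The value at [j = 0] is a separate limit because the prefactor of the first
    solution is singular there when [s = q]. As [Nn] tends to 0 the prefactor tends to 1, so the
    normalized sequence inherits the limit of the series. *)
Lemma general_solution : exists y, is_solution A B (fun n => P (INR n)) X y W.
Proof.
have [y0 H0] := Hy0.
have ha1 : 1 - a <> 0 := off_lattice_neq q a ha.
exists (fun j => match j with O => y0 | S k => P (INR (S k)) * sol q a b c d e f (Nn (INR (S k))) end).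
split=> [[|j]|]; first exact: H0.
  apply: (tends_ext (fun t : C => P (INR (S j) + t) * sol q a b c d e f (Nn (INR (S j) + t)))).
    by move=> t; rewrite HX.
  by apply: tends_mult (HTP _) _; apply: tends_sol => //; apply: HTN.
split=> [j|].
  apply: (tends_ext_loc (fun t : C => P (INR j + t) * w (INR j + t) * rec_error q a b c d e f (Nn (INR j + t)))).
    apply: filter_imp (filter_and _ _ (HA j) (HNreg j)) => t [HAt Hreg].
    have E := sol_relation q a b c d e f hq1 hq0 ha0 ha1 hxs (param_pole q a b c d e f hq0 hxs hax) _ Hreg.
    rewrite !HX HP HN1 HN2 HAt -E.
    transitivity (P (INR j + t) * w (INR j + t) * sol q a b c d e f (Nn (INR j + t) * q)
      - P (INR j + t) * w (INR j + t) * rec_a q a b c d e f (Nn (INR j + t)) * sol q a b c d e f (Nn (INR j + t))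
      + (P (INR j + t) * w (INR j + t) * (q * rec_b q a b c d e f (Nn (INR j + t))))
        * sol q a b c d e f (Nn (INR j + t) / q)); first by ring.
    by rewrite -HB; ring.
  rewrite -[X in tends _ _ X](_ : P (INR j) * w (INR j) * rec_error q a b c d e f (Nn (INR j)) = 0); last first.
    by rewrite rec_error_eq_0 //; ring.
  apply: tends_mult; first by apply: tends_mult; [exact: HTP|exact: HTw].
  by apply: tends_rec_error => //; exact: HTN.
have inf := qpoch_inf_continuous q hq1.
have I0 := qpoch_inf_0 q.
have Tm (x y : C) : tends eventually (fun j => x * Nn (INR j) / y) 0.
  replace (RtoC 0) with (x * 0 / y) by (rewrite /Cdiv; ring).
  by apply: tends_mult (tends_const _); apply: tends_mult HN0; apply: tends_const.
have Ti (u : nat -> C) : tends eventually u 0 -> tends eventually (fun j => qpoch_inf q (u j)) 1.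
  by move=> Hu; rewrite -I0; apply: inf.
have Tpref : tends eventually (fun j => pref q a b c d e f (Nn (INR j))) 1.
  rewrite -[X in tends _ _ X](_ : 1 * 1 / (1 * 1 * prodl (fun _ => RtoC 1) xs) = 1); last first.
    by rewrite /=; field; move=> /RtoC_inj; lra.
  have H1 : 1 * 1 * prodl (fun _ => RtoC 1) xs <> 0.
    by rewrite /= !Cmult_1_r => /RtoC_inj; lra.
  rewrite /pref -/s -/xs; apply: tends_div => //.
    apply: tends_mult; apply: Ti.
      replace (RtoC 0) with (s * (0 * 0) / q) by (field; done).
      apply: tends_mult (tends_const _); apply: tends_mult; first exact: tends_const.
      apply: (tends_ext (fun j => Nn (INR j) * Nn (INR j))); first by move=> j /=; ring.
      exact: tends_mult.
    by replace (RtoC 0) with (a * q * 0) by ring; apply: tends_mult HN0; apply: tends_const.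
  apply: tends_mult; first by apply: tends_mult; apply: Ti.
  apply: (tends_prodl (fun x j => qpoch_inf q (a * q * Nn (INR j) / x))).
  by apply/List.Forall_forall => x _; apply: Ti.
apply: (tends_ext_loc (fun j => pref q a b c d e f (Nn (INR j)) *
  phi q a b c d e f (s * Nn (INR j) / q) (/ Nn (INR j)))).
  exists 1%nat => -[|j] Hj; first lia.
  by rewrite /sol -/s; have H := HP0 (INR (S j)); field.
by rewrite -(Cmult_1_l W); apply: tends_mult.
Qed.
End SolutionFamily.

Lemma phi_swap (q a b c d e f g h : C) : phi q a b c d e f g h = phi q a b c d e f h g.
Proof.
rewrite /phi; congr Cseries; apply: functional_extensionality => k.
exact: phi_term_sym.
Qed.

(** * Normalizing factors and half-integral powers *)

Section Exponents.
Variables (q L : C) (m : nat).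
Hypothesis hL : Cexp L = q.
Hypothesis hq1 : (Cmod q < 1)%R.

Let hq0 : q <> 0 := q_neq_0 q L hL.

(** Common to both solutions; its multiplier [scale_step] from [n] to [n + 1] carries the
    half-integral powers of [a_n]. *)
Definition scale (n : C) : C := qpow L (- n ^ 2 / 2 + n) / qpow L (INR m * n / 2).
Definition scale_step (n : C) : C := qpow L (- n + 1 / 2) / qpow L (INR m / 2).

Lemma two_C_neq_0 : RtoC 2 <> 0.
Proof. by move=> /RtoC_inj; lra. Qed.

Lemma RtoC_2 : RtoC 2 = 1 + 1.
Proof. by rewrite -RtoC_plus. Qed.

Lemma scale_neq_0 (n : C) : scale n <> 0.
Proof. by apply: Cdiv_neq_0; apply: qpow_neq_0. Qed.

Lemma scale_step_neq_0 (n : C) : scale_step n <> 0.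
Proof. by apply: Cdiv_neq_0; apply: qpow_neq_0. Qed.

Lemma scale_succ (n : C) : scale (n + 1) = scale n * scale_step n.
Proof.
have H2 := two_C_neq_0; rewrite /scale /scale_step.
have -> : - (n + 1) ^ 2 / 2 + (n + 1) = (- n ^ 2 / 2 + n) + (- n + 1 / 2) by rewrite RtoC_2 in H2 *; field.
have -> : INR m * (n + 1) / 2 = INR m * n / 2 + INR m / 2 by field.
rewrite !qpow_plus; field; split; exact: qpow_neq_0.
Qed.

Lemma scale_step_pred (n : C) : scale_step (n - 1) = q * scale_step n.
Proof.
rewrite /scale_step; have -> : - (n - 1) + 1 / 2 = 1 + (- n + 1 / 2) by ring.
by rewrite qpow_plus (qpow_1 q L hL) /Cdiv; ring.
Qed.

Lemma scale_pred (n : C) : scale n = scale (n - 1) * (q * scale_step n).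
Proof. by rewrite -scale_step_pred -scale_succ; congr scale; ring. Qed.

Lemma qpow_double (n : C) : qpow L (2 * n) = qpow L n ^ 2.
Proof. by rewrite (_ : 2 * n = n + n); [rewrite qpow_plus /=; ring|rewrite RtoC_2; ring]. Qed.

Lemma qpow_half_sq : qpow L (INR m / 2) ^ 2 = q ^ m.
Proof.
rewrite -qpow_double -(qpow_INR q L hL); congr qpow; have H2 := two_C_neq_0; field.
Qed.

Lemma qpow_nat (k : nat) (x : R) : x = INR k -> qpow L x = q ^ k.
Proof. by move=> ->; apply: qpow_INR. Qed.

(** The square is rational in [q^n]: this accounts for [b_n], which has no half-integral powers, and
    for the last summand of [a_n], where the inverse of [scale_step] occurs. *)
Lemma scale_step_sq (n : C) : scale_step n ^ 2 = q / (qpow L n ^ 2 * q ^ m).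
Proof.
have H2 := two_C_neq_0.
rewrite /scale_step -qpow_half_sq.
transitivity (qpow L (2 * (- n + 1 / 2)) / qpow L (INR m / 2) ^ 2).
  by rewrite qpow_double; have H := qpow_neq_0 L (INR m / 2); rewrite /=; field.
have -> : 2 * (- n + 1 / 2) = 1 - 2 * n by rewrite RtoC_2 in H2 *; field.
rewrite qpow_minus (qpow_1 q L hL) qpow_double.
by have H := qpow_neq_0 L (INR m / 2); have H' := qpow_neq_0 L n; rewrite /=; field; repeat split.
Qed.

Lemma tends_scale (j : nat) : tends near0 (fun t : C => scale (INR j + t)) (scale (INR j)).
Proof.
have Hj : tends near0 (fun t : C => INR j + t) (INR j).
  rewrite -[X in tends _ _ X]Cplus_0_r; apply: tends_plus near0_id; exact: tends_const.
apply: tends_div; [exact: qpow_neq_0| |]; apply: tends_qpow.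
  apply: tends_plus => //; apply: tends_mult (tends_const _); apply: tends_opp.
  exact: tends_pow.
apply: tends_mult (tends_const _); apply: tends_mult Hj; exact: tends_const.
Qed.

Lemma tends_scale_step (j : nat) :
  tends near0 (fun t : C => scale_step (INR j + t)) (scale_step (INR j)).
Proof.
have Hj : tends near0 (fun t : C => INR j + t) (INR j).
  rewrite -[X in tends _ _ X]Cplus_0_r; apply: tends_plus near0_id; exact: tends_const.
apply: tends_mult (tends_const _); apply: tends_qpow.
by apply: tends_plus; [exact: tends_opp|exact: tends_const].
Qed.

Lemma tends_qpow_nat (j : nat) : tends near0 (fun t : C => qpow L (INR j + t)) (q ^ j).
Proof.
rewrite -(qpow_INR q L hL); apply: tends_qpow.
rewrite -[X in tends _ _ X]Cplus_0_r; apply: tends_plus near0_id; exact: tends_const.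
Qed.

(** Near [t = 0] the power is close to 1 but different from 1, while every other integral power of
    [q] has modulus at most [p] or at least [1 / p], hence distance at least [1 - p] from 1. The
    factor [k] will be 1 for [N] and 2 for [N^2]. *)
Lemma off_lattice_near0 (k : C) : k <> 0 -> near0 (fun t => off_lattice q (qpow L (k * t))).
Proof.
move=> Hk; set p := Cmod q; have Hp : (0 < p)%R by apply/Cmod_gt_0.
have Hp1 : (p < 1)%R := hq1.
have T1 : tends near0 (fun t : C => qpow L (k * t)) 1.
  rewrite -[X in tends _ _ X](_ : qpow L (k * 0) = 1); last first.
    by rewrite -[RHS](qpow_0 L); congr qpow; ring.
  by apply: tends_qpow; apply: tends_mult near0_id; apply: tends_const.
have He : (0 < 1 - p)%R by lra.
apply: filter_imp (filter_and _ _ (T1 _ He) (qpow_near0_neq_1 q L hL k hq1 Hk)) => t [H1 Hne].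
move: (qpow L (k * t)) H1 Hne => y H1 Hne.
have H2 := Cmod_sub_ge y 1; have H3 := Cmod_sub_ge 1 y.
rewrite (Cmod_sub_sym 1 y) Cmod_1 in H3; rewrite Cmod_1 in H2.
have Hpk j : (p ^ S j <= p)%R.
  have : (p ^ j <= 1)%R by rewrite -(pow1 j); apply: pow_incr; lra.
  by rewrite /= => H; have := Rmult_le_compat_l p _ _ (Rlt_le _ _ Hp) H; lra.
case=> [|j]; first by rewrite /= Cmult_1_r.
split=> E.
- have Em : (Cmod y * p ^ S j = 1)%R by rewrite -Cmod_pow -Cmod_mult E Cmod_1.
  have := Rmult_le_compat_l _ _ _ (Cmod_ge_0 y) (Hpk j); rewrite Em.
  by have := Rle_0_sqr (1 - p); rewrite /Rsqr; nra.
- have Em : (Cmod y = p ^ S j)%R by rewrite E Cmod_pow.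
  by have := Hpk j; lra.
Qed.
End Exponents.

(** The argument of [W] is [s / (a q)], an integral power of [q] times [1 / a], hence not an
    integral power itself. *)
Lemma lattice_admissible (q a b c d e f : C) :
  (Cmod q < 1)%R -> q <> 0 -> a <> 0 -> off_lattice q a -> lattice q (s_param q a b c d e f) ->
  List.Forall (fun x : C => x <> 0) [b; c; d; e; f] ->
  List.Forall (fun x => off_lattice q (a / x)) [b; c; d; e; f] ->
  admissible q a b c d e f.
Proof.
move=> hq1 hq0 ha0 ha hs hxs hax; split=> //; split; first exact: param_pole.
have -> : a ^ 2 * q ^ 2 / (b * c * d * e * f) = / a * (s_param q a b c d e f / q).
  move: hxs; rewrite !List.Forall_cons_iff => -[Hb [Hc [Hd [He [Hf _]]]]].
  by rewrite s_param_z //; field; repeat split.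
have O : off_lattice q (/ a * (s_param q a b c d e f / q)).
  apply: off_lattice_mult => //; first exact: off_lattice_inv.
  by apply: lattice_div => //; apply: lattice_q.
split; first exact: off_lattice_no_pole.
have hs0 := lattice_neq_0 q hq0 _ hs.
by apply: off_lattice_no_pole; apply: off_lattice_inv => //; nz.
Qed.

(** * The given coefficients and solutions for [s = q^m] *)

Section IntegralExponent.
Variables (q L a b c d e f : C) (m : nat).
Hypothesis hL : Cexp L = q.
Hypothesis hq1 : (Cmod q < 1)%R.
Hypothesis hm : (1 <= m)%nat.
Hypothesis ha0 : a <> 0.
Let xs := [b; c; d; e; f].
Hypothesis hxs : List.Forall (fun x : C => x <> 0) xs.
Hypothesis hs : s_param q a b c d e f = q ^ m.
Hypothesis ha : off_lattice q a.
Hypothesis hax : List.Forall (fun x => off_lattice q (a / x)) xs.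

Let hq0 : q <> 0 := q_neq_0 q L hL.
Let P := scale L m.
Let w := scale_step L m.
Let s := s_param q a b c d e f.

Let hs0 : s <> 0.
Proof. by rewrite /s hs; apply: Cpow_nz. Qed.

Let q2 : qpow L 2 = q ^ 2.
Proof. by rewrite (qpow_nat q L hL 2) //=; lra. Qed.

Let q3 : qpow L 3 = q ^ 3.
Proof. by rewrite (qpow_nat q L hL 3) //=; lra. Qed.

Lemma a_coefE (n : C) :
  a_coef q L m a b c d e f n = w n * rec_a q a b c d e f (qpow L n).
Proof.
have HN := qpow_neq_0 L n; have Hh := qpow_neq_0 L (INR m / 2).
rewrite /a_coef /rec_a -/s -/xs; set N := qpow L n in HN *.
have E1 : qpow L (n + 1) = N * q by rewrite qpow_plus (qpow_1 q L hL).
have E2 : qpow L (n - 2) = N / q ^ 2 by rewrite qpow_minus q2.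
have E3 : qpow L (2 * n - 1) = N ^ 2 / q by rewrite qpow_minus qpow_double (qpow_1 q L hL).
have E4 : qpow L (2 * n - 2) = N ^ 2 / q ^ 2 by rewrite qpow_minus qpow_double q2.
have E5 : qpow L (n - 1) = N / q by rewrite qpow_minus (qpow_1 q L hL).
have Ew : qpow L (- n + 1 / 2) / qpow L (INR m / 2) = w n by [].
have Ew2 : qpow L (- n + 3 / 2) / qpow L (INR m / 2) = q * w n.
  rewrite -(scale_step_pred q L m hL) /scale_step; congr (qpow L _ / _).
  have H2 := two_C_neq_0; rewrite (_ : RtoC 3 = RtoC 2 + 1); [by rewrite RtoC_2 in H2 *; field|].
  by rewrite -RtoC_plus; congr RtoC; lra.
(* The left side is [1 / (a w)], and [1 / w = w s N^2 / q] by [scale_step_sq]. *)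
have Ew3 : qpow L (INR m / 2) / a * qpow L (n - 1 / 2) = w n * (s * N ^ 2 / (a * q)).
  have Hw0 : qpow L (n - 1 / 2) = / qpow L (- n + 1 / 2).
    by rewrite -qpow_opp; congr qpow; ring.
  have Hw1 := scale_step_sq q L m hL n; rewrite -hs -/s -/N in Hw1.
  have Hn1 := qpow_neq_0 L (- n + 1 / 2).
  rewrite Hw0 /w.
  transitivity (/ a / scale_step L m n); first by rewrite /scale_step; field; repeat split.
  have Hwn := scale_step_neq_0 L m n.
  transitivity (/ a * scale_step L m n / scale_step L m n ^ 2); first by rewrite /=; field; split.
  by rewrite Hw1; field; repeat split.
rewrite E1 E2 E3 E4 E5 Ew Ew2 qpow_double -/N.
have F1 : 1 - s * (N ^ 2 / q) = 1 - N ^ 2 * (s / q) by rewrite /Cdiv; ring.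
have F2 : 1 - s / a * (N / q ^ 2) = 1 - N * (s / (a * q ^ 2)) by field; split.
have F3 : 1 - a * (N * q) = 1 - N * (a * q) by ring.
have F4 : 1 - s * (N / q) = 1 - N * (s / q) by rewrite /Cdiv; ring.
have F5 : 1 - s / a * (N / q) = 1 - N * (s / (a * q)) by field; split.
have F6 : 1 - s * N ^ 2 = 1 - N ^ 2 * s by ring.
have F7 : 1 - s * (N ^ 2 / q ^ 2) = 1 - N ^ 2 * (s / q ^ 2) by rewrite /Cdiv; ring.
have F8 : 1 - a * N = 1 - N * a by ring.
rewrite F1 F2 F3 F4 F5 F6 F7 F8.
have G1 : prodl (fun x => 1 - a / x * (N * q)) xs = prodl (fun x => 1 - N * (a * q / x)) xs.
  by apply: prodl_ext => x; rewrite /Cdiv; ring.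
have G2 : prodl (fun x => 1 - x * s / a * (N / q ^ 2)) xs = prodl (fun x => 1 - N * (s * x / (a * q ^ 2))) xs.
  by apply: prodl_ext => x; field; split.
by rewrite G1 G2 Ew3 /Cdiv; ring.
Qed.

Lemma b_coefE (n : C) :
  b_coef q L a b c d e f n = q ^ 3 / (qpow L n ^ 2 * s) * rec_b q a b c d e f (qpow L n).
Proof.
have HN := qpow_neq_0 L n.
rewrite /b_coef /rec_b -/s -/xs.
have -> : qpow L (- 2 * n + 3) = q ^ 3 / qpow L n ^ 2.
  transitivity (qpow L (3 - 2 * n)); last by rewrite qpow_minus qpow_double q3.
  by congr qpow; rewrite ?E; ring.
set N := qpow L n in HN *.
have E2 : qpow L (n - 2) = N / q ^ 2 by rewrite qpow_minus q2.
have E3 : qpow L (2 * n - 1) = N ^ 2 / q by rewrite qpow_minus qpow_double (qpow_1 q L hL).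
have E4 : qpow L (2 * n - 2) = N ^ 2 / q ^ 2 by rewrite qpow_minus qpow_double q2.
have E5 : qpow L (2 * n - 3) = N ^ 2 / q ^ 3 by rewrite qpow_minus qpow_double q3.
rewrite E2 E3 E4 E5.
have F1 : 1 - s * (N ^ 2 / q) = 1 - N ^ 2 * (s / q) by rewrite /Cdiv; ring.
have F2 : 1 - s * (N / q ^ 2) = 1 - N * (s / q ^ 2) by rewrite /Cdiv; ring.
have F7 : 1 - s * (N ^ 2 / q ^ 2) = 1 - N ^ 2 * (s / q ^ 2) by rewrite /Cdiv; ring.
have F8 : 1 - s * (N ^ 2 / q ^ 3) = 1 - N ^ 2 * (s / q ^ 3) by rewrite /Cdiv; ring.
rewrite F1 F2 F7 F8.
have G1 : prodl (fun x => 1 - a / x * N) xs = prodl (fun x => 1 - N * (a / x)) xs.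
  by apply: prodl_ext => x; rewrite /Cdiv; ring.
have G2 : prodl (fun x => 1 - x * s / a * (N / q ^ 2)) xs = prodl (fun x => 1 - N * (s * x / (a * q ^ 2))) xs.
  by apply: prodl_ext => x; field; split.
rewrite G1 G2 {2 3}/Cdiv; have -> : q ^ 3 / N ^ 2 / s = q ^ 3 / (N ^ 2 * s) by field; split.
by rewrite /Cdiv; ring.
Qed.

Lemma b_coef_scale (n : C) :
  b_coef q L a b c d e f n * P (n - 1) = P n * w n * (q * rec_b q a b c d e f (qpow L n)).
Proof.
rewrite b_coefE (scale_pred q L m hL n : P n = P (n - 1) * (q * w n)).
have Hw := scale_step_sq q L m hL n; rewrite -hs -/s -/w in Hw.
have HN := qpow_neq_0 L n.
transitivity (P (n - 1) * q ^ 2 * (w n ^ 2) * rec_b q a b c d e f (qpow L n)); last by rewrite /=; ring.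
by rewrite Hw; move: (rec_b _ _ _ _ _ _ _ _) => R; rewrite /=; field; repeat split.
Qed.

Lemma sol1E (n : C) : sol1 q L m a b c d e f n = P n * sol q a b c d e f (qpow L n).
Proof.
have HN := qpow_neq_0 L n.
rewrite /sol1 /sol /pref -/s -/xs qpow_opp; set N := qpow L n in HN *.
have E1 : qpow L (n + 1) = N * q by rewrite qpow_plus (qpow_1 q L hL).
have E3 : qpow L (2 * n - 1) = N ^ 2 / q by rewrite qpow_minus qpow_double (qpow_1 q L hL).
have E5 : qpow L (n - 1) = N / q by rewrite qpow_minus (qpow_1 q L hL).
rewrite E1 E3 E5.
have -> : s * (N ^ 2 / q) = s * N ^ 2 / q by rewrite /Cdiv; ring.
have -> : a * (N * q) = a * q * N by ring.
have -> : s * (N / q) = s * N / q by rewrite /Cdiv; ring.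
have -> : s / a * (N / q) = s * N / (a * q) by field; split.
have -> : prodl (fun x => qpoch_inf q (a / x * (N * q))) xs = prodl (fun x => qpoch_inf q (a * q * N / x)) xs.
  by apply: prodl_ext => x; congr qpoch_inf; rewrite /Cdiv; ring.
by rewrite /P /scale; ring.
Qed.

Lemma sol2E (n : C) : sol2 q L m a b c d e f n =
  P n * sol q (q / a) (q / b) (q / c) (q / d) (q / e) (q / f) (s * qpow L n / q ^ 2).
Proof.
have HN := qpow_neq_0 L n.
rewrite /sol2 /sol /pref -/s -/xs s_param_dual // -/s phi_swap; set N := qpow L n in HN *.
have E1 : qpow L (n + 1) = N * q by rewrite qpow_plus (qpow_1 q L hL).
have E3 : qpow L (2 * n - 1) = N ^ 2 / q by rewrite qpow_minus qpow_double (qpow_1 q L hL).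
have E5 : qpow L (n - 1) = N / q by rewrite qpow_minus (qpow_1 q L hL).
have E6 : qpow L (- n + 2) = q ^ 2 / N.
  by rewrite qpow_plus qpow_opp q2 -/N /Cdiv; ring.
rewrite E1 E3 E5 E6.
rewrite (prodl_dual q b c d e f hxs _ (fun x => qpoch_inf q (x * s / a * (N / q)))); last first.
  by move=> x Hx; congr qpoch_inf; rewrite /=; field; repeat split.
have -> : q ^ 4 / s * (s * N / q ^ 2) ^ 2 / q = s * (N ^ 2 / q) by rewrite /=; field; repeat split.
have -> : q / a * q * (s * N / q ^ 2) = s / a * N by rewrite /=; field; repeat split.
have -> : q ^ 4 / s * (s * N / q ^ 2) / q = N * q by rewrite /=; field; repeat split.
have -> : q ^ 4 / s * (s * N / q ^ 2) / (q / a * q) = a * N by rewrite /=; field; repeat split.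
have -> : / (s * N / q ^ 2) = q ^ 2 / N / s by rewrite /=; field; repeat split.
rewrite /P /scale (Cmult_comm (qpoch_inf q (s / a * N))) -/xs; ring.
Qed.

Lemma pow_neq_1 (k : nat) : (0 < k)%nat -> 1 - q ^ k <> 0.
Proof.
case: k => [|k] Hk; first lia.
by apply/one_minus_neq_0; apply: no_pole_q.
Qed.

Lemma no_pole_qpow (k : nat) : (0 < k)%nat -> no_pole q (q ^ k).
Proof.
case: k => [|k] Hk; first lia.
by apply: no_pole_pow; apply: no_pole_q.
Qed.

Lemma qpow_off (j : nat) :
  near0 (fun t : C => off_lattice q (qpow L (INR j + t))) /\
  near0 (fun t : C => off_lattice q (qpow L (INR j + t) ^ 2)).
Proof.
have C1 : RtoC 1 <> 0 by move=> /RtoC_inj; lra.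
have C2 := two_C_neq_0.
have H1 := off_lattice_near0 q L hL hq1 1 C1; have H2 := off_lattice_near0 q L hL hq1 2 C2.
have Hl k := lattice_pow q k.
split.
- apply: filter_imp H1 => t; rewrite Cmult_1_l qpow_plus (qpow_INR q L hL) Cmult_comm => H.
  exact: off_lattice_mult.
- apply: filter_imp H2 => t; rewrite qpow_double qpow_plus (qpow_INR q L hL) => H.
  replace ((q ^ j * qpow L t) ^ 2) with (qpow L t ^ 2 * q ^ (j + j)) by (rewrite Cpow_add_r /=; ring).
  exact: off_lattice_mult.
Qed.

Let lat_s : lattice q s.
Proof. by rewrite /s hs; apply: lattice_pow. Qed.

Lemma regular1 (j : nat) : near0 (fun t : C => regular q a b c d e f (qpow L (INR j + t))).
Proof.
have [O1 O2] := qpow_off j.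
apply: near_regular => //; [exact: (tends_qpow_nat q L hL j)|exact: lattice_pow].
Qed.

(** At an integral index the denominators free of [a] are [1 - q^(2 j + m - i)], non-zero when the
    exponent is positive: this decides where the coefficients are regular. *)
Let hs_exp (j i : nat) : (i <= j + j + m)%nat -> (q ^ j) ^ 2 * (s / q ^ i) = q ^ (j + j + m - i).
Proof.
move=> Hi; have Hqi := Cpow_nz q i hq0.
transitivity (q ^ (j + j + m) / q ^ i).
  by rewrite /s hs !Cpow_add_r /=; field.
have {1}-> : (j + j + m)%nat = (j + j + m - i + i)%nat by lia.
by rewrite Cpow_add_r; field.
Qed.

Let hs_neq (j i : nat) : (i < j + j + m)%nat -> 1 - (q ^ j) ^ 2 * (s / q ^ i) <> 0.
Proof. by move=> Hi; rewrite hs_exp; [apply: pow_neq_1; lia|lia]. Qed.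

Let sq1 : s / q = s / q ^ 1.
Proof. by rewrite /= Cmult_1_r. Qed.

Lemma tends_cf_a (j : nat) :
  tends near0 (fun t : C => a_coef q L m a b c d e f (INR j + t)) (cf_a q L m a b c d e f j).
Proof.
have Tw := tends_scale_step L m j.
have TN := tends_qpow_nat q L hL j.
have Hl := lattice_pow q j; have Hr := regular1 j.
have Hgen l : tends near0 (fun t : C => rec_a q a b c d e f (qpow L (INR j + t))) l ->
    tends near0 (fun t : C => a_coef q L m a b c d e f (INR j + t)) (w (INR j) * l).
  move=> H; apply: (tends_ext (fun t : C => w (INR j + t) * rec_a q a b c d e f (qpow L (INR j + t)))).
    by move=> t; rewrite a_coefE.
  exact: tends_mult.
rewrite /cf_a; case E : (_ && _)%bool.
- have {E} [Ej Em] : j = 0%nat /\ (m <= 2)%nat.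
    by move/andb_prop: E => [/Nat.eqb_eq -> /Nat.leb_le].
  subst j; have [l Tl] : exists l, tends near0 (fun t : C => rec_a q a b c d e f (qpow L (INR 0 + t))) l.
    have [E1|E2] : m = 1%nat \/ m = 2%nat by lia.
    + apply: (rec_a_limit_1 q a b c d e f hq1 hq0 ha0 ha lat_s _ _ TN) => //.
      by rewrite hs E1 /= Cmult_1_r.
    + apply: (rec_a_limit_2 q a b c d e f hq1 hq0 ha0 ha lat_s _ _ TN) => //.
      by rewrite hs E2.
  rewrite /Clim0 (Clim_eq _ (w (INR 0) * l)); first exact: Hgen.
  by apply: tends_ext (Hgen _ Tl) => t; rewrite /= Cplus_0_l.
(* The smallest exponent in the denominators of [a_j] is [2 j + m - 2], positive except for [j = 0],
   [m <= 2]. *)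
- have Hjm : (2 < j + j + m)%nat.
    case: j E {Tw TN Hl Hr Hgen} => [|j] /=; last lia.
    by move/Nat.leb_gt.
  rewrite a_coefE; apply: Hgen; rewrite (qpow_INR q L hL).
  apply: tends_rec_a => //; rewrite -/s.
  + by have := hs_neq j 0 ltac:(lia); replace (s / q ^ 0) with s by (rewrite /=; field).
  + by rewrite sq1; apply: hs_neq; lia.
  + exact: hs_neq.
Qed.

Lemma tends_cf_b (j : nat) :
  tends near0 (fun t : C => b_coef q L a b c d e f (INR (S j) + t)) (cf_b q L m a b c d e f (S j)).
Proof.
have TN := tends_qpow_nat q L hL (S j).
have Hl := lattice_pow q (S j); have Hr := regular1 (S j).
have Hgen l : tends near0 (fun t : C => rec_b q a b c d e f (qpow L (INR (S j) + t))) l ->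
    tends near0 (fun t : C => b_coef q L a b c d e f (INR (S j) + t))
      (q ^ 3 / ((q ^ S j) ^ 2 * s) * l).
  move=> H; apply: (tends_ext (fun t : C => q ^ 3 / (qpow L (INR (S j) + t) ^ 2 * s)
      * rec_b q a b c d e f (qpow L (INR (S j) + t)))).
    by move=> t; rewrite b_coefE.
  apply: tends_mult H; apply: tends_div; [|exact: tends_const|].
    by have Hq := Cpow_nz q (S j) hq0; nz.
  by apply: tends_mult (tends_const _); apply: tends_pow.
rewrite /cf_b; case E : (_ && _)%bool.
- have {E} [Ej Em] : j = 0%nat /\ (m <= 2)%nat.
    by move/andb_prop: E => [/Nat.eqb_eq [->] /Nat.leb_le].
  subst j; have [l Tl] : exists l, tends near0 (fun t : C => rec_b q a b c d e f (qpow L (INR 1 + t))) l.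
    have [E1|E2] : m = 1%nat \/ m = 2%nat by lia.
    + apply: (rec_b_limit_1 q a b c d e f hq1 hq0 ha0 _ _ TN) => //.
        by rewrite hs E1 /= Cmult_1_r.
      by rewrite /= Cmult_1_r.
    (* For [m = 2] the coefficient [b_1] is regular; [cf_b] still takes a limit there, which
       continuity evaluates. *)
    + exists (rec_b q a b c d e f (q ^ 1)); apply: tends_rec_b => //; rewrite -/s.
      * by rewrite sq1; apply: hs_neq; lia.
      * by apply: hs_neq; lia.
      * by apply: hs_neq; lia.
  rewrite /Clim0 (Clim_eq _ (q ^ 3 / ((q ^ 1) ^ 2 * s) * l)); first exact: Hgen.
  apply: tends_ext (Hgen _ Tl) => t.
  by rewrite Cplus_comm.
- have Hjm : (3 < S j + S j + m)%nat.
    case: j E {TN Hl Hr Hgen} => [|j]; last lia.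
    by move/Nat.leb_gt => H; lia.
  rewrite b_coefE; rewrite (qpow_INR q L hL); apply: Hgen.
  apply: tends_rec_b => //; rewrite -/s.
  + by rewrite sq1; apply: hs_neq; lia.
  + by apply: hs_neq; lia.
  + by apply: hs_neq; lia.
Qed.

Variable W : C -> C -> C -> C -> C -> C -> C.
Hypothesis hW : is_W_continuation q W.

Let qpow_S (n : C) : qpow L (n + 1) = qpow L n * q.
Proof. by rewrite qpow_plus (qpow_1 q L hL). Qed.

Let qpow_P (n : C) : qpow L (n - 1) = qpow L n / q.
Proof. by rewrite qpow_minus (qpow_1 q L hL). Qed.

Lemma solution_1 : exists y,
  is_solution (a_coef q L m a b c d e f) (b_coef q L a b c d e f) (fun n => P (INR n))
    (sol1 q L m a b c d e f) y (W a b c d e f).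
Proof.
have TN := tends_qpow_nat q L hL.
have TN0 : tends near0 (fun t : C => qpow L (INR 0 + t)) 1 := TN 0%nat.
apply: (general_solution q a b c d e f _ _ _ _ P w (qpow L)) => //.
- exact: sol1E.
- by move=> j; apply: filter_forall => t; rewrite a_coefE.
- exact: b_coef_scale.
- exact: scale_succ.
- exact: scale_neq_0.
- exact: tends_scale.
- exact: tends_scale_step.
- by move=> j; rewrite (qpow_INR q L hL).
- by move=> j; rewrite (qpow_INR q L hL); apply: lattice_pow.
- exact: regular1.
- move=> j; rewrite (qpow_INR q L hL) (qpoch_inf_eq_0 q (/ q ^ j) j); first by ring.
  by have H := Cpow_nz q j hq0; field.
- have TP : tends near0 (fun t : C => P (INR 0 + t)) (P (INR 0)) := tends_scale L m 0%nat.
  have [y Ty] : exists y, tends near0 (fun t : C => sol q a b c d e f (qpow L (INR 0 + t))) y.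
    have l1 := lattice_pow q 0.
    (* For [m = 1] the denominator [(s N / q)_infinity] of the prefactor vanishes at [N = 1]. *)
    have [E1|Hm] : m = 1%nat \/ (1 < m)%nat by lia.
    + eexists; apply: (tends_sol_1 q a b c d e f _ _ _ _ _ _ _ _ 1 TN0) => //.
        by rewrite hs E1 /= Cmult_1_r.
      have [O _] := qpow_off 0; apply: filter_imp O => t; exact: off_lattice_neq.
    + eexists; apply: (tends_sol q a b c d e f _ _ _ _ _ _ _ _ 1 TN0) => //.
      rewrite hs; case: m Hm => [|k] Hm; first lia.
      rewrite (_ : q ^ S k * 1 / q = q ^ k); last by rewrite /=; field.
      by apply: no_pole_qpow; lia.
  exists (P (INR 0) * y).
  apply: (tends_ext (fun t : C => P (INR 0 + t) * sol q a b c d e f (qpow L (INR 0 + t)))).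
    by move=> t; rewrite sol1E.
  exact: tends_mult.
- move=> j; rewrite (qpow_INR q L hL) hs.
  rewrite (_ : q ^ m * q ^ S j / q = q ^ (m + j)); last by rewrite Cpow_add_r /=; field.
  by apply: no_pole_qpow; lia.
- by apply: (tends_ext (fun j => q ^ j)); [move=> j; rewrite (qpow_INR q L hL)|apply: geom_tends].
- apply: (tends_ext (phi_seq q a b c d e f)).
    by move=> j; rewrite (qpow_INR q L hL).
  apply: phi_seq_limit => //; first exact: off_lattice_no_pole.
  exact: lattice_admissible.
Qed.

Let a' := q / a.
Let b' := q / b.
Let c' := q / c.
Let d' := q / d.
Let e' := q / e.
Let f' := q / f.
Let s' := s_param q a' b' c' d' e' f'.
(** The counterpart of [q^n] for the inverted parameters: [s' M n / q] and [1 / M n] are the last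
    two parameters of the series in [X_n^(2)], in exchanged order. *)
Let M (n : C) := s * qpow L n / q ^ 2.

Let ha0' : a' <> 0.
Proof. exact: Cdiv_neq_0. Qed.

Let ha' : off_lattice q a'.
Proof.
rewrite /a' /Cdiv Cmult_comm; apply: off_lattice_mult => //; first exact: off_lattice_inv.
exact: lattice_q.
Qed.

Let hxs' : List.Forall (fun x : C => x <> 0) [b'; c'; d'; e'; f'].
Proof.
have H : List.Forall (fun x : C => q / x <> 0) xs.
  by apply: List.Forall_impl hxs => x Hx; apply: Cdiv_neq_0.
move: H; rewrite /xs !List.Forall_cons_iff !List.Forall_nil_iff => H; exact: H.
Qed.

Let hax' : List.Forall (fun x => off_lattice q (a' / x)) [b'; c'; d'; e'; f'].
Proof.
have H : List.Forall (fun x : C => off_lattice q (a' / (q / x))) xs.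
  apply: List.Forall_impl (Forall_and hxs hax) => x [Hx H].
  replace (a' / (q / x)) with (/ (a / x)) by (rewrite /a'; field; repeat split; done).
  by apply: off_lattice_inv => //; apply: Cdiv_neq_0.
move: H; rewrite /xs !List.Forall_cons_iff !List.Forall_nil_iff => H; exact: H.
Qed.

Let s'E : s' = q ^ 4 / s.
Proof. by rewrite /s' /a' /b' /c' /d' /e' /f' s_param_dual. Qed.

Let lat_s' : lattice q s'.
Proof. by rewrite s'E; apply: lattice_div => //; apply: lattice_pow. Qed.

Let lat_M (j : nat) : lattice q (M (INR j)).
Proof.
rewrite /M (qpow_INR q L hL); apply: lattice_div => //; last exact: lattice_pow.
by apply: lattice_mult => //; apply: lattice_pow.
Qed.

Let tends_M (j : nat) : tends near0 (fun t : C => M (INR j + t)) (M (INR j)).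
Proof.
apply: tends_mult (tends_const _); apply: tends_mult; first exact: tends_const.
by rewrite (qpow_INR q L hL); apply: tends_qpow_nat.
Qed.

Let regular2 (j : nat) : near0 (fun t : C => regular q a' b' c' d' e' f' (M (INR j + t))).
Proof.
have [O1 O2] := qpow_off j.
have l2 : lattice q (s / q ^ 2) by apply: lattice_div => //; apply: lattice_pow.
apply: (near_regular q a' b' c' d' e' f' hq1 hq0 ha0' ha' lat_s' hxs' hax' _ _ (tends_M j) (lat_M j)).
- apply: filter_imp O1 => t H; rewrite /M.
  replace (s * qpow L (INR j + t) / q ^ 2) with (qpow L (INR j + t) * (s / q ^ 2)) by (rewrite /Cdiv; ring).
  exact: off_lattice_mult.
- apply: filter_imp O2 => t H; rewrite /M.
  replace ((s * qpow L (INR j + t) / q ^ 2) ^ 2) with (qpow L (INR j + t) ^ 2 * ((s / q ^ 2) * (s / q ^ 2))) by (rewrite /Cdiv; ring).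
  by apply: off_lattice_mult => //; apply: lattice_mult.
Qed.

Let M_pow (j : nat) : (2 <= m + j)%nat -> M (INR j) = q ^ (m + j - 2).
Proof.
move=> Hj; rewrite /M (qpow_INR q L hL) /s hs -Cpow_add_r.
have {1}-> : (m + j)%nat = (m + j - 2 + 2)%nat by lia.
by rewrite Cpow_add_r; field.
Qed.

(** The exponent is positive already at [j = 0], so the second solution has no singularity there,
    unlike the first one for [m = 1]. *)
Let sM (j : nat) : s' * M (INR j) / q = q ^ S j.
Proof. by rewrite s'E /M (qpow_INR q L hL) /=; field; split. Qed.

Lemma solution_2 : exists y,
  is_solution (a_coef q L m a b c d e f) (b_coef q L a b c d e f) (fun n => P (INR n))
    (sol2 q L m a b c d e f) y (W a' b' c' d' e' f').
Proof.
apply: (general_solution q a' b' c' d' e' f' _ _ _ _ P w M) => //.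
- exact: sol2E.
(* [rec_a_dual] needs the denominators of both sides to be non-zero, hence regularity for both sets
   of parameters. *)
- move=> j; apply: filter_imp (filter_and _ _ (regular1 j) (regular2 j)) => t [R1 R2].
  have [_ [B [_ [_ [C1 [A1 _]]]]]] := regular_neq_0 _ _ _ _ _ _ _ hq0 ha0 _ R1.
  have [_ [_ [_ [_ [C2 [A2 _]]]]]] := regular_neq_0 _ _ _ _ _ _ _ hq0 ha0' _ R2.
  rewrite a_coefE -rec_a_dual //.
  + by have := B 1%nat; rewrite -/s -sq1.
  + by have := B 0%nat; rewrite -/s; replace (s / q ^ 0) with s by (rewrite /=; field).
- by move=> n; rewrite rec_b_dual //; apply: b_coef_scale.
- exact: scale_succ.
- exact: scale_neq_0.
- by move=> n; rewrite /M qpow_S /Cdiv; ring.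
- by move=> n; rewrite /M qpow_P /Cdiv; ring.
- exact: tends_scale.
- exact: tends_scale_step.
- move=> j; have [H|H] : (2 <= m + j)%nat \/ (m + j = 1)%nat by lia.
    rewrite (M_pow j H) (qpoch_inf_eq_0 q (/ _) (m + j - 2)); first by ring.
    by have H' := Cpow_nz q (m + j - 2) hq0; field.
  (* Here [M 0 = 1 / q] and the series does not terminate; the boundary term vanishes through its
     other factor, because [s' M^2 / q = 1]. *)
  have [Em Ej] : m = 1%nat /\ j = 0%nat by lia.
  rewrite (qpoch_inf_eq_0 q (_ / q) 0); first by ring.
  by rewrite -/s' s'E /M (qpow_INR q L hL) /s hs Em Ej /=; field.
- exists (P (INR 0) * sol q a' b' c' d' e' f' (M (INR 0))).
  apply: (tends_ext (fun t : C => P (INR 0 + t) * sol q a' b' c' d' e' f' (M (INR 0 + t)))).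
    by move=> t; rewrite sol2E.
  apply: tends_mult; first exact: tends_scale.
  apply: tends_sol => //; rewrite -/s' sM.
  by apply: no_pole_qpow; lia.
- by move=> j; rewrite -/s' sM; apply: no_pole_qpow; lia.
- rewrite -[X in tends _ _ X](_ : s / q ^ 2 * 0 = 0); last by ring.
  apply: (tends_ext (fun j => s / q ^ 2 * q ^ j)).
    by move=> j; rewrite /M (qpow_INR q L hL) /Cdiv; ring.
  by apply: tends_mult; [exact: tends_const|exact: geom_tends].
(* [M (INR j)] is [q^(m + j - 2)], with a negative exponent for [m = 1], [j = 0]. From [j = 2] on
   the truncated subtraction is exact, and the sequence is a shift of [phi_seq]. *)
- apply: (tends_ext_loc (fun j => phi_seq q a' b' c' d' e' f' (m + (j - 2)))).
    exists 2%nat => j Hj; rewrite /phi_seq M_pow; last lia.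
    by have -> : (m + (j - 2) = m + j - 2)%nat by lia.
  apply: (tends_shift_back (fun j => phi_seq q a' b' c' d' e' f' (m + j))).
  apply: (tends_subseq (fun j => (m + j)%nat)); first by move=> j; lia.
  apply: phi_seq_limit => //; first exact: off_lattice_no_pole.
  exact: lattice_admissible.
Qed.
End IntegralExponent.

Lemma qpow_off_lattice (q L y : C) :
  Cexp L = q -> (forall k : Z, y <> qpow L (IZR k)) -> off_lattice q y.
Proof.
move=> hL Hy k; have Hk := Cpow_nz q k (q_neq_0 q L hL); split=> E.
- apply: (Hy (- Z.of_nat k)%Z); rewrite (qpow_IZR_opp q L hL).
  by rewrite -[RHS]Cmult_1_l -E; field.
- by apply: (Hy (Z.of_nat k)); rewrite -INR_IZR_INZ (qpow_INR q L hL).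
Qed.

Theorem theorem4 (q L a b c d e f : C) (m : nat)
    (W : C -> C -> C -> C -> C -> C -> C)
    (hq0 : (0 < Cmod q)%R) (hq1 : (Cmod q < 1)%R) (hL : Cexp L = q)
    (hm : (1 <= m)%nat)
    (ha : a <> 0)
    (hxs : List.Forall (fun x : C => x <> 0) [b; c; d; e; f])
    (hs : s_param q a b c d e f = q ^ m)
    (* W and its analytic continuation *)
    (hW : is_W_continuation q W)
    (* genericity: no zero among the denominators *)
    (hgen_a : forall k : Z, a <> qpow L (IZR k))
    (hgen_x : List.Forall (fun x : C => forall k : Z, x <> a * qpow L (IZR k))
                [b; c; d; e; f]) :
  let W1 := W a b c d e f in
  let W2 := W (q / a) (q / b) (q / c) (q / d) (q / e) (q / f) in
  let X1 := sol1 q L m a b c d e f in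
  let X2 := sol2 q L m a b c d e f in
  let num := fun n : C => W2 * X1 n - W1 * X2 n in
  let den := fun n : C =>
    b_coef q L a b c d e f n * (W2 * X1 (n - 1) - W1 * X2 (n - 1)) in
  (* genericity: the denominator on the right does not tend to 0 *)
  ~ filterlim den (locally' (T := C_UniformSpace) (RtoC 0))
      (locally (T := C_UniformSpace) (RtoC 0)) ->
  exists l : C,
    is_cfrac (cf_a q L m a b c d e f) (cf_b q L m a b c d e f) l /\
    filterlim (fun n => num n / den n) (locally' (T := C_UniformSpace) (RtoC 0))
      (locally (T := C_UniformSpace) l).
Proof.
move=> W1 W2 X1 X2 num den Hden.
have hq := q_neq_0 q L hL.
have Ha := qpow_off_lattice q L a hL hgen_a.
have Hax : List.Forall (fun x => off_lattice q (a / x)) [b; c; d; e; f].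
  apply: List.Forall_impl (Forall_and hxs hgen_x) => x [Hx H].
  apply: qpow_off_lattice hL _ => k E; apply: (H (- k)%Z).
  rewrite opp_IZR RtoC_opp qpow_opp -E; field; by split.
have [y1 S1] := solution_1 q L a b c d e f m hL hq1 hm ha hxs hs Ha Hax W hW.
have [y2 S2] := solution_2 q L a b c d e f m hL hq1 hm ha hxs hs Ha Hax W hW.
have [] := pincherle _ _ _ _ _ (tends_cf_a q L a b c d e f m hL hq1 hm ha hxs hs Ha Hax)
  (tends_cf_b q L a b c d e f m hL hq1 hm ha hxs hs Ha Hax)
  (fun n => scale_neq_0 L m (INR n)) _ _ _ _ _ _ S1 S2.
  by move=> H; apply: Hden; apply/tends_filterlim.
move=> l [Hl Tl]; exists l; split=> //.
by apply/tends_filterlim.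
Qed.
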